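(* Let $0<\alpha<n$ and let $\vec p_1=(p_{11},\dots,p_{1n})$, $\vec p_2=(p_{21},\dots,p_{2n})$ satisfy at least one of the following: (a) $1<\vec p_1\le\vec p_2<\infty$, $\vec p_1\ne\vec p_2$, $\sum_{i=1}^n\frac1{p_{1i}}-\sum_{i=1}^n\frac1{p_{2i}}\le\alpha<n$; (b) $0<\vec p_2<\vec p_1\le\infty$, $\vec p_1>1$, $0<\alpha<n$; (c) $0<\vec p_2<\infty$, $1<\vec p_1<\infty$, $\sum_{i=1}^n\left(\frac1{p_{1i}}-\frac1{p_{2i}}\right)_+<\alpha<n$. Let $0<\theta_2\le\infty$ and $\omega_2\in\Omega_{\theta_2}$. Then there is a constant $C>0$ such that for all $f\in L_1^{loc}(\mathbb R^n)$ $$\|I_\alpha f\|_{LM_{\vec p_2\theta_2,\omega_2}}\le C\,\|Hg_{\vec p_1}\|_{L_{\theta_2,\nu_2}(0,\infty)},$$ where, for $t,r>0$, $$g_{\vec p_1}(t)=\|f\|_{L_{\vec p_1}(Q(0,t^{-1/\sigma}))},\qquad \sigma=\sum_{i=1}^n\frac1{p_{1i}}-\alpha,\qquad \nu_2(r)=\omega_2(r^{-\frac1\sigma})\,r^{-\frac1\sigma\sum_{i=1}^n\frac1{p_{2i}}-\frac1{\theta_2\sigma}-\frac1{\theta_2}}.$$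
   Context: Inequalities between tuples, or between a tuple and a number, are componentwise; $1/\infty=0$; $t_+=t$ if $t>0$ and $0$ otherwise. $Q(x,r)$ is the open cube (sides parallel to the axes) centered at $x\in\mathbb R^n$ with side length $2r$. The mixed Lebesgue quasi-norm $\|f\|_{L_{\vec p}(\mathbb R^n)}$, $0<\vec p\le\infty$, is obtained by taking successively the $L_{p_1}(\mathbb R)$-norm in $x_1$, ..., the $L_{p_n}(\mathbb R)$-norm in $x_n$, in that order; $\|f\|_{L_{\vec p}(E)}:=\|f\chi_E\|_{L_{\vec p}(\mathbb R^n)}$. For $0<\vec p,\theta\le\infty$ and a non-negative measurable $\omega$ on $(0,\infty)$, $\|f\|_{LM_{\vec p\theta,\omega}}=\big\|\omega(r)\|f\|_{L_{\vec p}(Q(0,r))}\big\|_{L_\theta(0,\infty)}$. $\Omega_\theta$ is the set of non-negative measurable $\omega$ on $(0,\infty)$, not equivalent to $0$, with $\|\omega\|_{L_\theta(t,\infty)}<\infty$ for some $t>0$. $I_\alpha f(x)=\int_{\mathbb R^n}\frac{f(y)}{|x-y|^{n-\alpha}}\,dy$. The Hardy operator is $(Hg)(t)=\int_0^tg(r)\,dr$, $0<t<\infty$, for non-negative measurable $g$ on $(0,\infty)$. $\|g\|_{L_{\theta,\nu}(0,\infty)}=\|\nu g\|_{L_\theta(0,\infty)}$. Both sides of the inequality may be infinite.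
   Formalization: The condition σ>0 is added: for σ=0 the expression t^{-1/σ} is undefined, and for σ<0 the inequality fails, e.g. for ω_2=χ_(0,1) and f the indicator of Q(0,3)\Q(0,2), where the right side is 0 and the left side is positive. *)

(* Defs.v *)
From HB Require Import structures.
From mathcomp Require Import all_boot all_order all_algebra.
From mathcomp Require Import all_classical all_reals all_analysis.

Set Implicit Arguments.
Unset Strict Implicit.
Unset Printing Implicit Defensive.

Import Order.TTheory GRing.Theory Num.Theory.
Import numFieldNormedType.Exports.

Local Open Scope classical_set_scope.
Local Open Scope ring_scope.

Definition tcons (T : Type) (n : nat) (tx : T * n.-tuple T) : n.+1.-tuple T :=
  [tuple of tx.1 :: tx.2].

Lemma measurable_tcons d (T : measurableType d) (n : nat) :
  measurable_fun [set: T * n.-tuple T] (@tcons T n).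
Proof. exact: measurable_cons. Qed.

Section product_measure_tcons.
Context d (T : measurableType d) (R : realType) (n : nat).
Variable m1 : {sigma_finite_measure set T -> \bar R}.
Variable m2 : {sigma_finite_measure set (n.-tuple T) -> \bar R}.

Definition product_tcons : set (n.+1.-tuple T) -> \bar R :=
  pushforward (m1 \x m2)%E (@tcons T n).

Let product_tcons0 : product_tcons set0 = 0%E.
Proof. by rewrite /product_tcons /pushforward preimage_set0 measure0. Qed.

Let product_tcons_ge0 A : (0 <= product_tcons A)%E.
Proof. by rewrite /product_tcons /pushforward measure_ge0. Qed.

Let product_tcons_sigma_additive : semi_sigma_additive product_tcons.
Proof.
move=> F mF tF mUF; rewrite /product_tcons /pushforward preimage_bigcup.
have mc := @measurable_tcons d T n.
apply: measure_semi_sigma_additive.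
- by move=> k; rewrite -[X in measurable X]setTI; exact: mc.
- apply/trivIsetP => /= i j _ _ ij; rewrite -preimage_setI.
  by move/trivIsetP : tF => /(_ _ _ _ _ ij) ->//; rewrite preimage_set0.
- by rewrite -preimage_bigcup -[X in measurable X]setTI; exact: mc.
Qed.

HB.instance Definition _ := isMeasure.Build _ _ _ product_tcons
  product_tcons0 product_tcons_ge0 product_tcons_sigma_additive.

Let product_tcons_sigma_finite : sigma_finite setT product_tcons.
Proof.
have /sigma_finiteP[F [FT ndF Foo]] := sigma_finiteT m1.
have /sigma_finiteP[G [GT ndG Goo]] := sigma_finiteT m2.
pose uncons (x : n.+1.-tuple T) : T * n.-tuple T :=
  (thead x, [tuple of behead x]).
have tconsK : cancel (@tcons T n) uncons.
  by case=> t y; rewrite /uncons; congr pair; apply: val_inj.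
have muncons : measurable_fun setT uncons.
  apply/measurable_fun_pairP; split; first exact: measurable_tnth.
  exact: measurable_behead.
exists (fun i => uncons @^-1` (F i `*` G i)).
  apply/esym; rewrite -subTset => x _.
  have [i _ Fix] : (\bigcup_i F i) (thead x) by rewrite -FT.
  have [j _ Gjx] : (\bigcup_j G j) [tuple of behead x] by rewrite -GT.
  exists (maxn i j) => //; split => /=.
    by move: Fix; exact/subsetPset/ndF/leq_maxl.
  by move: Gjx; exact/subsetPset/ndG/leq_maxr.
move=> i; have [mFi Fioo] := Foo i; have [mGi Gioo] := Goo i; split.
  by rewrite -[X in measurable X]setTI; apply: muncons => //; exact: measurableX.
rewrite /product_tcons /pushforward -comp_preimage.
rewrite (_ : uncons \o _ = id); last by apply/funext => x /=; rewrite tconsK.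
by rewrite preimage_id product_measure1E// lte_mul_pinfty// ge0_fin_numE.
Qed.

HB.instance Definition _ := Measure_isSigmaFinite.Build _ _ _ product_tcons
  product_tcons_sigma_finite.

End product_measure_tcons.

Fixpoint power_measure d (T : measurableType d) (R : realType)
    (m : {sigma_finite_measure set T -> \bar R}) (n : nat) :
    {sigma_finite_measure set (n.-tuple T) -> \bar R} :=
  match n with
  | 0 => \d_([tuple] : 0.-tuple T)
  | k.+1 => product_tcons m (power_measure m k)
  end.

(* R^n is n.-tuple R, with the product sigma-algebra of the library. *)
Notation euclidean R n := (n.-tuple (measurableTypeR R)).

Definition lebesgue (R : realType) (n : nat) :
    {sigma_finite_measure set (euclidean R n) -> \bar R} :=
  power_measure (@lebesgue_measure R) n.

(* Measurability with respect to the mu-completion of the sigma-algebra. *)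
Definition completed_measurable_fun d (T : measurableType d) (R : realType)
    (mu : set T -> \bar R) (D : set T) (f : T -> R) : Prop :=
  exists2 g : T -> R, measurable_fun D g & f = g %[ae mu in D].

(* Tuples carry no topology in the library: compactness is that of the
   row vectors. *)
Definition L1loc (R : realType) (n : nat) (f : euclidean R n -> R) : Prop :=
  completed_measurable_fun (lebesgue R n) setT f /\
  forall K : set 'rV[R]_n, compact K ->
    (\int[lebesgue R n]_(x in [set x | K (\row_i tnth x i)]) `|f x|%:E
       < +oo)%E.

Definition cube (R : realType) (n : nat) (x : euclidean R n) (r : R) :
    set (euclidean R n) :=
  [set y | forall i : 'I_n, `|tnth y i - tnth x i| < r].

Definition origin (R : realType) (n : nat) : euclidean R n :=
  [tuple (0 : R) | _ < n].

Definition euclidean_dist (R : realType) (n : nat) (x y : euclidean R n) : R :=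
  Num.sqrt (\sum_(i < n) (tnth x i - tnth y i) ^+ 2).

(* 1 / p, with 1 / oo = 0. *)
Definition recip (R : realType) (p : \bar R) : R := fine (p^-1)%E.

(* The norm in the first variable is taken first, and is innermost. *)
Fixpoint mixed_norm (R : realType) (n : nat) :
    ('I_n -> \bar R) -> (euclidean R n -> \bar R) -> \bar R :=
  match n with
  | 0 => fun _ f => `|f [tuple]|%E
  | m.+1 => fun p f =>
      mixed_norm (fun i : 'I_m => p (lift ord0 i))
        (fun y : euclidean R m =>
           Lnorm (@lebesgue_measure R) (p ord0) (fun t => f (tcons (t, y))))
  end.

Definition mixed_norm_on (R : realType) (n : nat) (p : 'I_n -> \bar R)
    (E : set (euclidean R n)) (f : euclidean R n -> \bar R) : \bar R :=
  mixed_norm p (f \_ E).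

Definition Lnorm_on (R : realType) (theta : \bar R) (E : set R)
    (g : R -> \bar R) : \bar R :=
  Lnorm (@lebesgue_measure R) theta (g \_ E).

Definition weighted_norm (R : realType) (theta : \bar R) (nu : R -> R)
    (g : R -> \bar R) : \bar R :=
  Lnorm_on theta `]0, +oo[ (fun r => (nu r)%:E * g r)%E.

Definition LM_norm (R : realType) (n : nat) (p : 'I_n -> \bar R)
    (theta : \bar R) (omega : R -> R) (f : euclidean R n -> \bar R) : \bar R :=
  weighted_norm theta omega (fun r => mixed_norm_on p (cube (origin R n) r) f).

Definition Omega (R : realType) (theta : \bar R) (omega : R -> R) : Prop :=
  [/\ forall r, 0 < r -> 0 <= omega r,
      completed_measurable_fun (@lebesgue_measure R) `]0, +oo[ omega,
      ~ (omega = cst 0 %[ae @lebesgue_measure R in `]0, +oo[%classic]) &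
      exists2 t, 0 < t &
        (Lnorm_on theta `]t, +oo[ (EFin \o omega) < +oo)%E].

(* Where the integral does not converge absolutely, this has the value the
   library gives to a difference of integrals of positive parts, oo - oo being
   -oo. *)
Definition riesz_potential (R : realType) (n : nat) (alpha : R)
    (f : euclidean R n -> R) (x : euclidean R n) : \bar R :=
  (\int[lebesgue R n]_y
     (f y / euclidean_dist x y `^ (n%:R - alpha))%:E)%E.

Definition hardy (R : realType) (g : R -> \bar R) (t : R) : \bar R :=
  (\int[@lebesgue_measure R]_(r in `]0%R, t[) g r)%E.

Definition sigma (R : realType) (n : nat) (alpha : R) (p1 : 'I_n -> \bar R) :
    R :=
  \sum_(i < n) recip (p1 i) - alpha.

Definition g_fun (R : realType) (n : nat) (alpha : R) (p1 : 'I_n -> \bar R)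
    (f : euclidean R n -> R) (t : R) : \bar R :=
  mixed_norm_on p1 (cube (origin R n) (t `^ (- (sigma alpha p1)^-1)))
    (EFin \o f).

Definition nu_fun (R : realType) (n : nat) (alpha : R)
    (p1 p2 : 'I_n -> \bar R) (theta2 : \bar R) (omega2 : R -> R) (r : R) : R :=
  let s := sigma alpha p1 in
  omega2 (r `^ (- s^-1)) *
  r `^ (- s^-1 * (\sum_(i < n) recip (p2 i))
        - recip theta2 / s - recip theta2).

(* Main.v *)
(* By Hoelder's inequality on cubes the exponents can be changed to reals
   1 < p <= q with sum_i (1/p_i - 1/q_i) = alpha, for which the Riesz potential is
   bounded from L_p to L_q in mixed norms. Over a cube Q(0,r), split
   f = f 1_{Q(0,2r)} + f 1_{complement}: the near part is controlled by this
   boundedness, the far part by a sum over the dyadic cubes Q(0,2^j r), and both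
   are at most a multiple of r^{sum_i 1/p_2i} sum_j (2^j r)^{-sigma}
   ||f||_{p_1, Q(0,2^j r)}, hence of r^{sum_i 1/p_2i} (H g)(r^{-sigma}), because
   g_{p_1} is monotone. The theorem follows by substituting t = r^{-sigma} in the
   L_{theta_2} norm.
   The mixed-norm boundedness is proved on grids: by the one-third trick the
   kernel is dominated by kernels constant on the cubes of finitely many dyadic
   grids. On a grid the coordinates with p_i = q_i cost a maximal function with
   values in a lattice norm, and those with p_i < q_i a one-dimensional
   Hardy-Littlewood-Sobolev inequality; the lattice norm carries vector-valued
   maximal inequalities of all exponents, obtained from one of them by a
   Calderon-Zygmund decomposition and a Garsia-Neveu argument. *)

Require Import Defs.
From HB Require Import structures.
From mathcomp Require Import all_boot all_order all_algebra.
From mathcomp Require Import all_classical all_reals all_analysis.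
From mathcomp Require Import measurable_realfun ess_sup_inf.
From mathcomp Require Import measurable_fun_approximation simple_functions.
From mathcomp Require Import ring lra zify.
Set Implicit Arguments.
Unset Strict Implicit.
Unset Printing Implicit Defensive.

Import Order.TTheory GRing.Theory Num.Theory.
Import numFieldNormedType.Exports.
Local Open Scope classical_set_scope.
Local Open Scope ring_scope.

(** The obstacle is the order of the norms. Once the first coordinate has been integrated, the
    operators in the remaining coordinates act on functions with values in an iterated l^p lattice,
    and a coordinate with p_i = q_i calls for a maximal inequality there at an exponent foreign to
    that lattice. Only the exponent of the outermost layer is free, by exchanging sums; hence the
    extrapolation to all exponents, with constants fixed before the lattice is known. The scales of
    the kernel can be summed only once, in a coordinate with p_i < q_i. One exists because alpha >
    0; for the rest a supremum over scales suffices. On a finite tree no question of measurability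
    or convergence arises; the mesh tends to 0 afterwards, by Fatou's lemma. Section norms at
    infinite exponents and the Hardy integrand are never shown to be measurable: they are compared
    through lower integrals. As sigma > 0, t -> t^(-1/sigma) is decreasing: the cubes larger than
    Q(0,r) are those with t < r^(-sigma), which is the range of the Hardy integral. *)

Lemma le_of_eq d (T : porderType d) (x y : T) : x = y -> (x <= y)%O.
Proof. by move=> ->. Qed.

(** * Powers, dyadic averages and maximal functions on indices *)

Section discrete.
Context {R : realType}.
Implicit Types (s p q a b c : R).

(** The graph of x^s lies above its tangent at [a]: b^s >= a^s + s a^(s-1) (b - a). This drives
    Burkholder's step, the Garsia-Neveu step and Hoelder's inequality below. *)
Lemma young_powR s a b : 1 < s -> 0 <= a -> 0 <= b ->
  s * (a `^ (s - 1) * b) <= (s - 1) * a `^ s + b `^ s.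
Proof.
move=> s1 a0 b0; have s0 : 0 < s by lra.
have := @conjugate_powR R b (a `^ (s - 1)) s (s / (s - 1)) b0 (powR_ge0 _ _).
have sn : s - 1 != 0 by lra.
rewrite -powRrM mulrCA mulfV// mulr1.
have -> : s^-1 + (s / (s - 1))^-1 = 1 by field; lra.
move=> /(_ s0 _ erefl) H.
have : b * a `^ (s - 1) <= b `^ s / s + a `^ s / (s / (s - 1)).
  by apply: H; apply: divr_gt0; lra.
rewrite -(ler_pM2l s0) mulrDr => /le_trans; rewrite [b * _]mulrC; apply.
apply: le_of_eq; field; lra.
Qed.

Lemma powR_mulD a s : 0 <= a -> 0 < s -> a `^ (s - 1) * a = a `^ s.
Proof. by move=> a0 s0; rewrite mulrC mulr_powRB1. Qed.

Lemma ler_powRl s : 0 <= s ->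
  forall a b, 0 <= a -> a <= b -> a `^ s <= b `^ s.
Proof.
by move=> s0 a b a0 ab; apply: ge0_ler_powR; rewrite ?nnegrE// (le_trans a0).
Qed.

(* If Z dominates a fraction of A then [A^(s-1) Z <= C Z^s]; otherwise the left
   side is absorbed by [A^s]. *)
Lemma powR_absorb s a b c : 1 < s -> 0 <= a -> 0 <= b -> 0 <= c ->
  c * (a `^ (s - 1) * b) <= a `^ s / 2 + c * (2 * c) `^ (s - 1) * b `^ s.
Proof.
move=> s1 a0 b0 c0; have s0 : 0 < s by lra.
have [ab|ba] := leP (2 * c * b) a.
  apply: (@le_trans _ _ (a `^ s / 2)); last first.
    by rewrite lerDl !mulr_ge0// powR_ge0.
  rewrite -(powR_mulD a0 s0) mulrCA -mulrA ler_wpM2l ?powR_ge0//; lra.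
apply: (@le_trans _ _ (c * (2 * c) `^ (s - 1) * b `^ s)); last first.
  by rewrite lerDr divr_ge0// powR_ge0.
rewrite -mulrA ler_wpM2l// -(powR_mulD b0 s0) mulrA ler_wpM2r//.
rewrite -powRM//; last lra.
by apply: ler_powRl; lra.
Qed.

Section sums.

Lemma sum_pow2S (K : nat) (G : nat -> R) :
  \sum_(x < 2 ^ K.+1) G x =
  \sum_(x < 2 ^ K) G x + \sum_(x < 2 ^ K) G (2 ^ K + x)%N.
Proof.
by rewrite expnS mul2n -addnn big_split_ord.
Qed.

Lemma pow2_gt0 (k : nat) : 0 < (2 ^ k)%:R :> R.
Proof. by rewrite ltr0n expn_gt0. Qed.

Lemma pow2S (k : nat) : (2 ^ k.+1)%:R = 2 * (2 ^ k)%:R :> R.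
Proof. by rewrite expnS natrM. Qed.

End sums.

(** Natural numbers index the finest cells of a grid, and [i %/ 2 ^ k] names the dyadic block of
    length 2^k around [i]: this is a conditional expectation. *)
Definition cell_avg (k : nat) (f : nat -> R) (i : nat) : R :=
  (\sum_(j < 2 ^ k) f ((i %/ 2 ^ k) * 2 ^ k + j)%N) / (2 ^ k)%:R.

(** Scales stop at [K], the depth of the tree. The 0 at the bottom makes the value nonnegative for
    every [f]. *)
Fixpoint dyadic_max (K : nat) (f : nat -> R) (i : nat) : R :=
  if K is K'.+1 then Num.max (dyadic_max K' f i) (cell_avg K f i)
  else Num.max 0 (f i).

Lemma cell_avg_ge0 k f i : (forall j, 0 <= f j) -> 0 <= cell_avg k f i.
Proof. by move=> f0; rewrite divr_ge0// sumr_ge0. Qed.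

Lemma le_cell_avg k f g i : (forall j, f j <= g j) -> cell_avg k f i <= cell_avg k g i.
Proof.
by move=> fg; rewrite ler_wpM2r ?invr_ge0// ler_sum.
Qed.

Lemma cell_avg_top K f i : (i < 2 ^ K)%N ->
  cell_avg K f i = (\sum_(j < 2 ^ K) f j) / (2 ^ K)%:R.
Proof. by move=> iK; rewrite /cell_avg divn_small// mul0n. Qed.

Lemma cell_avg0 f i : cell_avg 0 f i = f i.
Proof. by rewrite /cell_avg expn0 big_ord1 divn1 muln1 addn0 divr1. Qed.

Lemma cell_avg_shift K k f i : (k <= K)%N ->
  cell_avg k f (2 ^ K + i)%N = cell_avg k (fun j => f (2 ^ K + j)%N) i.
Proof.
move=> kK; rewrite /cell_avg; congr (_ / _); apply: eq_bigr => j _; congr f.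
have -> : (2 ^ K = 2 ^ (K - k) * 2 ^ k)%N by rewrite -expnD subnK.
by rewrite divnMDl ?expn_gt0// mulnDl addnA.
Qed.

Lemma dyadic_max_ge0 K f i : 0 <= dyadic_max K f i.
Proof. by elim: K => [|K IH] /=; rewrite le_max ?lexx ?IH. Qed.

Lemma cell_avg_le_max K k f i : (k <= K)%N -> cell_avg k f i <= dyadic_max K f i.
Proof.
elim: K => [|K IH] /=; first by rewrite leqn0 => /eqP ->; rewrite cell_avg0 le_max lexx orbT.
by rewrite leq_eqVlt ltnS le_max => /orP[/eqP ->|/IH ->//]; rewrite lexx orbT.
Qed.

Lemma dyadic_max0 f i : 0 <= f i -> dyadic_max 0 f i = f i.
Proof. by move=> f0; rewrite /= max_r. Qed.

Lemma dyadic_maxS K f i :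
  dyadic_max K.+1 f i = Num.max (dyadic_max K f i) (cell_avg K.+1 f i).
Proof. by []. Qed.

Lemma dyadic_max_shift K N f i : (K <= N)%N ->
  dyadic_max K f (2 ^ N + i)%N = dyadic_max K (fun j => f (2 ^ N + j)%N) i.
Proof.
elim: K => [//|K IH] KN; rewrite !dyadic_maxS IH; last exact: ltnW.
by rewrite cell_avg_shift.
Qed.

End discrete.

(** * Maximal inequalities on dyadic trees *)

Section doob.
Context {R : realType}.
Implicit Types (s p q a b c : R) (f : nat -> R).

Definition tree_avg K f : R := (\sum_(j < 2 ^ K) f j) / (2 ^ K)%:R.

Lemma tree_avgE K f : \sum_(j < 2 ^ K) f j = (2 ^ K)%:R * tree_avg K f.
Proof. by rewrite /tree_avg mulrC divfK// gt_eqF// pow2_gt0. Qed.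

Lemma tree_avg_ge0 K f : (forall x, 0 <= f x) -> 0 <= tree_avg K f.
Proof. by move=> f0; rewrite divr_ge0// sumr_ge0. Qed.

Definition right_half K f : nat -> R := fun j => f (2 ^ K + j)%N.

Lemma tree_avgS K f :
  tree_avg K.+1 f = (tree_avg K f + tree_avg K (right_half K f)) / 2.
Proof.
rewrite /tree_avg sum_pow2S pow2S; field.
by rewrite gt_eqF// pow2_gt0.
Qed.

(** Going down to a child of the root moves the root average into the running maximum [b]. All
    inductions on trees below, scalar or lattice-valued, take this step, to the left child here and
    to the right one in the next lemma. *)
Lemma running_max_left K f b (x : nat) : (x < 2 ^ K)%N ->
  Num.max b (dyadic_max K.+1 f x) =
  Num.max (Num.max b (tree_avg K.+1 f)) (dyadic_max K f x).
Proof.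
move=> xK; rewrite dyadic_maxS cell_avg_top.
  by rewrite [in LHS]maxC [Num.max (dyadic_max _ _ _) _]maxC maxC maxA.
by rewrite (leq_trans xK)// leq_exp2l.
Qed.

Lemma running_max_right K f b (x : nat) : (x < 2 ^ K)%N ->
  Num.max b (dyadic_max K.+1 f (2 ^ K + x)%N) =
  Num.max (Num.max b (tree_avg K.+1 f)) (dyadic_max K (right_half K f) x).
Proof.
move=> xK; rewrite dyadic_maxS cell_avg_top.
  rewrite dyadic_max_shift//.
  by rewrite [in LHS]maxC [Num.max (dyadic_max _ _ _) _]maxC maxC maxA.
by rewrite expnS mul2n -addnn ltn_add2l.
Qed.

Lemma running_max_leaf f b : 0 <= f 0%N ->
  Num.max b (dyadic_max 0 f 0) = Num.max b (tree_avg 0 f).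
Proof.
move=> f0; rewrite dyadic_max0//; congr Num.max.
by rewrite /tree_avg big_ord_recr big_ord0 /= add0r expn0 divr1.
Qed.

(* Burkholder's method: [(s-1) w^s - s w^(s-1) a] is linear in the martingale
   [a] and decreases when the running maximum [w] is updated. *)
Lemma doob_step s K f b : 1 < s -> 0 <= b -> (forall x, 0 <= f x) ->
  \sum_(x < 2 ^ K) ((s - 1) * Num.max b (dyadic_max K f x) `^ s
     - s * (Num.max b (dyadic_max K f x) `^ (s - 1) * f x)) <=
  (2 ^ K)%:R * ((s - 1) * Num.max b (tree_avg K f) `^ s
     - s * (Num.max b (tree_avg K f) `^ (s - 1) * tree_avg K f)).
Proof.
move=> s1; elim: K f b => [|K IH] f b b0 f0.
  rewrite expn0 mul1r; rewrite big_ord_recr big_ord0 /= add0r running_max_leaf//.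
  by rewrite /tree_avg !big_ord_recr !big_ord0 /= !add0r expn0 divr1.
have fr0 x : 0 <= right_half K f x by exact: f0.
set m := Num.max b (tree_avg K.+1 f).
have m0 : 0 <= m by rewrite le_max b0.
rewrite (sum_pow2S K (fun x => (s - 1) * Num.max b (dyadic_max K.+1 f x) `^ s
     - s * (Num.max b (dyadic_max K.+1 f x) `^ (s - 1) * f x))).
under eq_bigr do rewrite running_max_left//.
under [X in _ + X]eq_bigr do rewrite running_max_right//.
apply: (le_trans (lerD (IH _ _ m0 f0) (IH _ _ m0 fr0))).
have upd a : 0 <= a ->
   (s - 1) * Num.max m a `^ s - s * (Num.max m a `^ (s - 1) * a) <=
   (s - 1) * m `^ s - s * (m `^ (s - 1) * a).
  move=> a0; have [am|ma] := leP a m => //.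
  rewrite powR_mulD//; last lra.
  have := young_powR s1 m0 a0; lra.
rewrite -mulrDr pow2S [2 * _]mulrC -mulrA ler_wpM2l// -/m.
have := upd _ (tree_avg_ge0 K f0); have := upd _ (tree_avg_ge0 K fr0).
have -> : tree_avg K.+1 f = (tree_avg K f + tree_avg K (right_half K f)) / 2.
  exact: tree_avgS.
lra.
Qed.

Lemma doob s : 1 < s -> exists2 C, 0 < C &
  forall K f, (forall x, 0 <= f x) ->
    \sum_(x < 2 ^ K) dyadic_max K f x `^ s <= C * \sum_(x < 2 ^ K) f x `^ s.
Proof.
move=> s1; pose c := s / (s - 1).
have c0 : 0 < c by rewrite divr_gt0//; lra.
exists (2 * (c * (2 * c) `^ (s - 1))) => [|K f f0].
  have P : 0 < (2 * c) `^ (s - 1) by apply: powR_gt0; lra.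
  by apply: mulr_gt0 => //; exact: mulr_gt0.
set S := \sum_(x < _) _ `^ s; set F := \sum_(x < _) f x `^ s.
have := doob_step K s1 (lexx 0) f0.
under eq_bigr do rewrite max_r ?dyadic_max_ge0//.
(* With b = 0 the bound at the root is 2^K ((s-1) a^s - s a^s) <= 0, where [a] is the root average.
   So (s-1) times the sum of M^s is at most s times the sum of M^(s-1) f, and [powR_absorb] removes
   half of the former. *)
rewrite max_r ?tree_avg_ge0// powR_mulD ?tree_avg_ge0//; last lra.
rewrite sumrB -mulr_sumr -/S -mulr_sumr.
set G := \sum_(x < _) _ => H.
have SG : S <= c * G.
  have : (s - 1) * S <= s * G.
    rewrite -subr_le0; apply: le_trans H _; rewrite -mulrBl.
    apply: mulr_ge0_le0 => //; apply: mulr_le0_ge0; last exact: powR_ge0.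
    lra.
  by rewrite /c mulrAC ler_pdivlMr 1?mulrC//; lra.
have : c * G <= S / 2 + c * (2 * c) `^ (s - 1) * F.
  rewrite /G /S /F mulr_sumr mulr_suml mulr_sumr -big_split /= ler_sum// => x _.
  by apply: powR_absorb => //; [exact: dyadic_max_ge0|exact: ltW].
lra.
Qed.

End doob.

(** A monotone seminorm on nonnegative functions: [lp_norm] ignores the indices from [X] on, so N F
    = 0 cannot force F = 0. The set [Y] is arbitrary because it grows to [nat * Y] at each step of
    the inductions on coordinates. *)
Record lattice_norm (R : realType) (Y : Type) (N : (Y -> R) -> R) : Prop :=
  LatticeNorm {
    lnorm_le : forall F G, (forall y, 0 <= F y) -> (forall y, F y <= G y) ->
      N F <= N G;
    lnorm_add : forall F G, (forall y, 0 <= F y) -> (forall y, 0 <= G y) ->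
      N (fun y => F y + G y) <= N F + N G;
    lnorm_scale : forall c F, 0 <= c -> (forall y, 0 <= F y) ->
      N (fun y => c * F y) = c * N F }.

Section lattice_norm_theory.
Context {R : realType} (Y : Type) (N : (Y -> R) -> R) (lN : lattice_norm N).
Implicit Types F G : Y -> R.

Lemma lnorm0 : N (fun=> 0) = 0.
Proof.
have := @lnorm_scale _ _ _ lN 0 (fun=> 0) (lexx 0) (fun=> lexx 0).
by under eq_fun do rewrite mulr0; move=> ->; rewrite mul0r.
Qed.

Lemma lnorm_ge0 F : (forall y, 0 <= F y) -> 0 <= N F.
Proof. by move=> F0; rewrite -lnorm0; apply: (lnorm_le lN). Qed.

Lemma lnorm_sum (n : nat) (F : nat -> Y -> R) : (forall i y, 0 <= F i y) ->
  N (fun y => \sum_(i < n) F i y) <= \sum_(i < n) N (F i).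
Proof.
move=> F0; elim: n => [|n IH].
  rewrite big_ord0 -[leRHS]lnorm0; apply: le_of_eq.
  by congr N; apply/funext => y; rewrite big_ord0.
rewrite big_ord_recr /=; apply: le_trans (lerD IH (lexx _)).
rewrite -(_ : N (fun y => \sum_(i < n) F i y + F n y) = N _).
  by apply: (lnorm_add lN) => // y; apply: sumr_ge0.
by congr N; apply/funext => y; rewrite big_ord_recr.
Qed.

Lemma lnorm_cell_avg k (f : nat -> Y -> R) i : (forall j y, 0 <= f j y) ->
  N (fun y => cell_avg k (fun j => f j y) i) <= cell_avg k (fun j => N (f j)) i.
Proof.
move=> f0; rewrite /cell_avg mulrC.
have c0 : 0 <= (2 ^ k)%:R^-1 :> R by rewrite invr_ge0.
under [X in N X]eq_fun do rewrite mulrC.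
rewrite (lnorm_scale lN)//; last by move=> y; apply: sumr_ge0.
by rewrite ler_wpM2l//; apply: (@lnorm_sum _ (fun j => f _)).
Qed.

Lemma lnorm_tree_avg k (f : nat -> Y -> R) : (forall j y, 0 <= f j y) ->
  N (fun y => tree_avg k (fun j => f j y)) <= tree_avg k (fun j => N (f j)).
Proof.
move=> f0; have E (g : nat -> R) : tree_avg k g = cell_avg k g 0.
  by rewrite cell_avg_top ?expn_gt0.
rewrite E; under [X in N X]eq_fun do rewrite E.
exact: lnorm_cell_avg.
Qed.

Definition vec_max K (f : nat -> Y -> R) x : Y -> R :=
  fun y => dyadic_max K (fun i => f i y) x.

Lemma vec_max_ge0 K f x y : 0 <= vec_max K f x y.
Proof. exact: dyadic_max_ge0. Qed.

Definition vec_max_bound s C := forall K (f : nat -> Y -> R),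
  (forall i y, 0 <= f i y) ->
  \sum_(x < 2 ^ K) N (vec_max K f x) `^ s <= C * \sum_(x < 2 ^ K) N (f x) `^ s.

End lattice_norm_theory.

Lemma ler_sqrtr (R : realType) (a b : R) : a <= b -> Num.sqrt a <= Num.sqrt b.
Proof. exact: ler_wsqrtr. Qed.

Lemma sqrtr_add (R : realType) (a b : R) : 0 <= a -> 0 <= b ->
  Num.sqrt (a + b) <= Num.sqrt a + Num.sqrt b.
Proof.
move=> a0 b0; have sa := sqrtr_ge0 a; have sb := sqrtr_ge0 b.
rewrite -[leRHS]ger0_norm ?addr_ge0// -sqrtr_sqr ler_wsqrtr// sqrrD.
rewrite !sqr_sqrtr//; have : 0 <= Num.sqrt a * Num.sqrt b by rewrite mulr_ge0.
lra.
Qed.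

Section half_power.
Context {R : realType} (Y : Type) (N : (Y -> R) -> R) (lN : lattice_norm N).
Implicit Types (f g : nat -> Y -> R) (b : Y -> R).

Definition mean_norm K f := tree_avg K (fun i => N (f i)).
Definition vec_avg K f y := tree_avg K (fun i => f i y).
Definition vec_right K f := fun i => f (2 ^ K + i)%N.
Definition running_norm b K f x := N (fun y => Num.max (b y) (vec_max K f x y)).

Lemma running_norm_left b K f (x : nat) : (x < 2 ^ K)%N ->
  running_norm b K.+1 f x = running_norm (fun y => Num.max (b y) (vec_avg K.+1 f y)) K f x.
Proof.
by move=> xK; congr N; apply/funext => y; rewrite /vec_max running_max_left.
Qed.

Lemma running_norm_right b K f (x : nat) : (x < 2 ^ K)%N ->
  running_norm b K.+1 f (2 ^ K + x)%N =
  running_norm (fun y => Num.max (b y) (vec_avg K.+1 f y)) K (vec_right K f) x.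
Proof.
by move=> xK; congr N; apply/funext => y; rewrite /vec_max running_max_right.
Qed.

(** Kolmogorov's substitute for a weak (1,1) inequality: at exponent 1 the mean controls only powers
    below 1 of the maximal function, and 1/2 is the power used. The square root is moreover
    subadditive, which serves both the stopping argument and the Garsia-Neveu argument. *)
Definition half_bound D K := forall f, (forall i y, 0 <= f i y) ->
  \sum_(x < 2 ^ K) Num.sqrt (N (vec_max K f x)) <=
  D * ((2 ^ K)%:R * Num.sqrt (mean_norm K f)).

(* Calderon-Zygmund stopping at height [l]: [g] averages [f] over the maximal
   dyadic intervals where the mean of [N f] exceeds [l]; on those intervals the
   bound already known for smaller trees is used. *)
Lemma good_part D l K0 : 0 <= D -> 0 < l ->
  (forall K, (K < K0)%N -> half_bound D K) ->
  forall K f b, (K <= K0)%N -> (forall i y, 0 <= f i y) -> (forall y, 0 <= b y) ->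
  mean_norm K f <= l ->
  exists g : nat -> Y -> R, [/\ forall i y, 0 <= g i y,
    forall i, N (g i) <= 2 * l, forall y, vec_avg K g y = vec_avg K f y &
    \sum_(x < 2 ^ K) Num.sqrt (running_norm b K f x) <=
    \sum_(x < 2 ^ K) Num.sqrt (running_norm b K g x)
      + D / Num.sqrt l * \sum_(x < 2 ^ K) N (f x)].
Proof.
move=> D0 l0 IH0; elim=> [|K IH] f b KK f0 b0 fl.
  exists (fun=> f 0%N); split => //.
  - move=> _; have : mean_norm 0 f = N (f 0%N).
      by rewrite /mean_norm /tree_avg big_ord_recr big_ord0 /= add0r expn0 divr1.
    by have := lnorm_ge0 lN (f0 0%N); lra.
  - by move=> y; rewrite /vec_avg /tree_avg !big_ord_recr !big_ord0.
  - rewrite !big_ord_recr !big_ord0 /= !add0r lerDl.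
    apply: mulr_ge0; first by rewrite divr_ge0 ?sqrtr_ge0.
    by apply: (lnorm_ge0 lN).
(* A parent of mean at most l has children of mean at most 2 l. A child whose mean exceeds l is a
   stopping interval, and [g] is constant there; otherwise the recursion goes on inside it. *)
have child h c : (forall i y, 0 <= h i y) -> (forall y, 0 <= c y) ->
    mean_norm K h <= 2 * l ->
    exists g : nat -> Y -> R, [/\ forall i y, 0 <= g i y,
      forall i, N (g i) <= 2 * l, forall y, vec_avg K g y = vec_avg K h y &
      \sum_(x < 2 ^ K) Num.sqrt (running_norm c K h x) <=
      \sum_(x < 2 ^ K) Num.sqrt (running_norm c K g x)
        + D / Num.sqrt l * \sum_(x < 2 ^ K) N (h x)].
  move=> h0 c0 hl; have [hle|lth] := leP (mean_norm K h) l.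
    by apply: IH => //; exact: ltnW.
  have avh0 y : 0 <= vec_avg K h y by apply: tree_avg_ge0.
  exists (fun=> vec_avg K h); split => //.
  - by move=> _; apply: le_trans hl; exact: (lnorm_tree_avg lN).
  - move=> y; rewrite {1}/vec_avg /tree_avg sumr_const card_ord -[_ *+ _]mulr_natr.
    by rewrite mulfK// gt_eqF// pow2_gt0.
  have step x : Num.sqrt (running_norm c K h x) <=
      Num.sqrt (running_norm c K (fun=> vec_avg K h) x) + Num.sqrt (N (vec_max K h x)).
    apply: (@le_trans _ _ (Num.sqrt (N c + N (vec_max K h x)))).
      apply: ler_sqrtr; apply: le_trans (lnorm_add lN c0 _).
        apply: (lnorm_le lN) => // y; first by rewrite le_max c0.
        by rewrite ge_max lerDl lerDr c0 vec_max_ge0.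
      by move=> y; exact: vec_max_ge0.
    apply: le_trans (sqrtr_add _ _) _; try apply: (lnorm_ge0 lN) => // y.
      exact: vec_max_ge0.
    rewrite lerD2r; apply: ler_sqrtr; apply: (lnorm_le lN) => // y.
    by rewrite le_max lexx.
  apply: le_trans (ler_sum _ (fun (x : 'I_(2 ^ K)) _ => step x)) _.
  rewrite big_split /= lerD2l; apply: le_trans (IH0 K KK _ h0) _.
  (* On a stopping interval the mean m exceeds l, so sqrt m <= m / sqrt l: the bound from [IH0]
     becomes linear in the sum of N f and adds up over disjoint intervals. *)
  rewrite -[leRHS]mulrA ler_wpM2l// (tree_avgE K (fun x => N (h x))) mulrCA ler_wpM2l//.
  have sl : 0 < Num.sqrt l by rewrite sqrtr_gt0.
  have h0' : 0 <= mean_norm K h by apply: tree_avg_ge0 => x; apply: (lnorm_ge0 lN).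
  rewrite ler_pdivlMl// -[leRHS](sqr_sqrtr h0') expr2 ler_wpM2r ?sqrtr_ge0//.
  by apply: ler_sqrtr; exact: ltW.
have fr0 i y : 0 <= vec_right K f i y by exact: f0.
have navS : mean_norm K.+1 f =
    (mean_norm K f + mean_norm K (vec_right K f)) / 2 by exact: tree_avgS.
have nl0 : 0 <= mean_norm K f by apply: tree_avg_ge0 => x; apply: (lnorm_ge0 lN).
have nr0 : 0 <= mean_norm K (vec_right K f).
  by apply: tree_avg_ge0 => x; apply: (lnorm_ge0 lN).
pose c y := Num.max (b y) (vec_avg K.+1 f y).
have c0 y : 0 <= c y by rewrite le_max b0.
have [//|//||gl [gl0 glN glav glS]] := child f c; first lra.
have [//|//||gr [gr0 grN grav grS]] := child (vec_right K f) c; first lra.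
pose g i := if (i < 2 ^ K)%N then gl i else gr (i - 2 ^ K)%N.
have gE : forall x : nat, (x < 2 ^ K)%N -> g x = gl x by move=> x xK; rewrite /g xK.
have gvr : vec_right K g = gr.
  by apply/funext => x; rewrite /vec_right /g ltnNge leq_addr /= addKn.
have avg_g y : vec_avg K g y = vec_avg K f y.
  by rewrite -glav /vec_avg /tree_avg; congr (_ / _); apply: eq_bigr => x _; rewrite gE.
have avS : vec_avg K.+1 g = vec_avg K.+1 f.
  apply/funext => y; rewrite /vec_avg !tree_avgS; congr (_ / _); congr (_ + _).
    exact: avg_g.
  have := grav y; rewrite -gvr /vec_avg => E; exact: E.
exists g; split.
- by move=> i y; rewrite /g; case: ifP.
- by move=> i; rewrite /g; case: ifP.
- by move=> y; rewrite avS.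
have vg (x : nat) : (x < 2 ^ K)%N -> running_norm c K g x = running_norm c K gl x.
  move=> xK; congr N; apply/funext => y; congr Num.max; rewrite /vec_max.
  have : forall K', (K' <= K)%N ->
      dyadic_max K' (g^~ y) x = dyadic_max K' (gl^~ y) x.
    have cE k : (k <= K)%N -> cell_avg k (g^~ y) x = cell_avg k (gl^~ y) x.
      move=> kK; rewrite /cell_avg; congr (_ / _); apply: eq_bigr => j _.
      rewrite gE//.
      have -> : (2 ^ K = 2 ^ (K - k) * 2 ^ k)%N by rewrite -expnD subnK.
      have jk := ltn_ord j.
      apply: (@leq_trans ((x %/ 2 ^ k).+1 * 2 ^ k)%N).
        by rewrite mulSn addnC ltn_add2r.
      rewrite leq_mul2r ltn_divLR ?expn_gt0// -expnD subnK// xK.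
      by rewrite orbT.
    elim=> [|K' IHK] K'K; first by rewrite /= gE.
    by rewrite !dyadic_maxS IHK ?cE// ltnW.
  exact.
rewrite (sum_pow2S K (fun x => Num.sqrt (running_norm b K.+1 f x))).
rewrite (sum_pow2S K (fun x => Num.sqrt (running_norm b K.+1 g x))).
rewrite (sum_pow2S K (fun x => N (f x))).
under eq_bigr do rewrite running_norm_left//.
under [X in _ + X <= _]eq_bigr do rewrite running_norm_right//.
under [X in _ <= X + _ + _]eq_bigr do rewrite running_norm_left// avS vg//.
under [X in _ <= _ + X + _]eq_bigr do rewrite running_norm_right// avS gvr.
rewrite mulrDr; apply: le_trans (lerD glS grS) _.
by rewrite addrACA.
Qed.

(** Strong induction on the depth, stopping at height 4 A with A the mean of N f. The stopping
    intervals contribute D / sqrt (4 A) times 2^K A, exactly half of the claim. The averaged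
    function has norm at most 8 A, so the inequality of exponent s gives the other half; this fixes
    D = 2 (1 + C) sqrt 8. *)
Lemma half_boundP s C : 1 < s -> 0 <= C -> vec_max_bound N s C ->
  forall K, half_bound (2 * (1 + C) * Num.sqrt 8) K.
Proof.
move=> s1 C0 VM; set D := 2 * _ * _.
have s80 : 0 < Num.sqrt 8 :> R by rewrite sqrtr_gt0.
have D0 : 0 <= D by apply: mulr_ge0; lra.
elim/ltn_ind => K IH f f0; set A := mean_norm K f.
have Nf0 x : 0 <= N (f x) by apply: (lnorm_ge0 lN).
have A0 : 0 <= A by apply: tree_avg_ge0.
have sn0 : s != 0 by rewrite gt_eqF//; lra.
have [AE|An0] := eqVneq A 0.
  have Z (x : 'I_(2 ^ K)) : N (f x) = 0.
    apply/eqP; have := tree_avgE K (fun i => N (f i)); rewrite -/(mean_norm K f) -/A AE.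
    rewrite mulr0 => /eqP; rewrite psumr_eq0// => /allP/(_ x).
    by rewrite mem_index_enum => /(_ isT).
  have := VM K f f0.
  under [X in _ <= _ * X]eq_bigr do rewrite Z powR0//.
  rewrite [X in _ <= _ * X]big1// mulr0 => H.
  rewrite big1; first by rewrite AE sqrtr0 !mulr0.
  move=> x _; have V0 : 0 <= N (vec_max K f x).
    by apply: (lnorm_ge0 lN) => // y; exact: vec_max_ge0.
  have : N (vec_max K f x) `^ s <= 0.
    apply: le_trans H; rewrite (bigD1 x)//= lerDl sumr_ge0// => i _.
    exact: powR_ge0.
  rewrite le_eqVlt ltNge powR_ge0 orbF powR_eq0 => /andP[/eqP -> _].
  by rewrite sqrtr0.
have {}A0 : 0 < A by rewrite lt_def An0.
have l0 : 0 < 4 * A by lra.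
have Al : mean_norm K f <= 4 * A by rewrite -/A; lra.
have [g [g0 gN _ gS]] := good_part D0 l0 IH (leqnn K) f0 (fun _ => lexx 0) Al.
have vE h x : running_norm (fun=> 0) K h x = N (vec_max K h x).
  by congr N; apply/funext => y; rewrite max_r// vec_max_ge0.
under eq_bigr do rewrite -vE.
apply: le_trans gS _.
under eq_bigr do rewrite vE.
rewrite (tree_avgE K (fun x => N (f x))) -/(mean_norm K f) -/A.
have mu0 : 0 < 2 * (4 * A) by lra.
set mu := 2 * (4 * A) in gN mu0.
have smu : 0 <= Num.sqrt mu by rewrite sqrtr_ge0.
(* Below [mu] the first term suffices; above it the square root grows more slowly than the s-th
   power. This turns the bound of exponent s for a function of norm at most [mu] into one for square
   roots. *)
have ptw a : 0 <= a -> Num.sqrt a <= Num.sqrt mu * (1 + (a / mu) `^ s).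
  move=> a0; rewrite mulrDr mulr1; have [am|ma] := leP a mu.
    by apply: (le_trans (ler_sqrtr am)); rewrite lerDl mulr_ge0// powR_ge0.
  apply: (@le_trans _ _ (Num.sqrt mu * (a / mu) `^ s)); last by rewrite lerDr.
  have am1 : 1 <= a / mu by rewrite ler_pdivlMr// mul1r ltW.
  have -> : Num.sqrt a = Num.sqrt mu * Num.sqrt (a / mu).
    by rewrite -sqrtrM ?ltW// mulrC divfK// gt_eqF.
  rewrite ler_wpM2l// -powR12_sqrt; last by lra.
  by apply: ler_powR => //; lra.
have B : \sum_(x < 2 ^ K) Num.sqrt (N (vec_max K g x)) <=
    Num.sqrt mu * ((2 ^ K)%:R * (1 + C)).
  apply: (@le_trans _ _ (\sum_(x < 2 ^ K)
     Num.sqrt mu * (1 + (N (vec_max K g x) / mu) `^ s))).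
    apply: ler_sum => x _; apply: ptw; apply: (lnorm_ge0 lN) => // y.
    exact: vec_max_ge0.
  rewrite -mulr_sumr ler_wpM2l// big_split /= sumr_const card_ord mulrDr mulr1.
  rewrite lerD2l.
  have dv a : 0 <= a -> (a / mu) `^ s = mu^-1 `^ s * a `^ s.
    by move=> a0; rewrite powRM 1?mulrC// invr_ge0 ltW.
  have Vg x : 0 <= N (vec_max K g x).
    by apply: (lnorm_ge0 lN) => y; exact: vec_max_ge0.
  under eq_bigr do rewrite dv//.
  rewrite -mulr_sumr.
  apply: (@le_trans _ _ (mu^-1 `^ s * (C * \sum_(x < 2 ^ K) mu `^ s))).
    rewrite ler_wpM2l ?powR_ge0//; apply: le_trans (VM K g g0) _.
    rewrite ler_wpM2l// ler_sum// => x _; apply: ler_powRl => //; first lra.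
    exact: (lnorm_ge0 lN).
  have E : mu^-1 `^ s * mu `^ s = 1.
    by rewrite -powRM ?invr_ge0 ?ltW// mulVf ?gt_eqF// powR1.
  rewrite sumr_const card_ord -[_ *+ _]mulr_natr le_eqVlt; apply/orP; left.
  apply/eqP; rewrite -[RHS]mul1r -E; ring.
have -> : D * ((2 ^ K)%:R * Num.sqrt A) =
  Num.sqrt mu * ((2 ^ K)%:R * (1 + C)) + D / 2 * ((2 ^ K)%:R * Num.sqrt A).
  have -> : Num.sqrt mu = Num.sqrt 8 * Num.sqrt A.
    by rewrite -sqrtrM//; congr Num.sqrt; rewrite /mu; lra.
  by rewrite /D; field.
apply: lerD => //; apply: le_of_eq.
have s40 : Num.sqrt (4 * A) = 2 * Num.sqrt A.
  rewrite sqrtrM//; congr (_ * _).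
  by rewrite (_ : 4 = 2 ^+ 2 :> R) ?sqrtr_sqr ?ger0_norm//; rewrite expr2; lra.
have sA : 0 < Num.sqrt A by rewrite sqrtr_gt0.
rewrite s40 -[X in _ * (_ * X)](sqr_sqrtr (ltW A0)); field.
by rewrite gt_eqF.
Qed.

End half_power.

Section garsia.
Context {R : realType} (Y : Type) (N : (Y -> R) -> R) (lN : lattice_norm N).
Context (D : R) (D0 : 0 <= D) (HD : forall K, half_bound N D K).
Implicit Types (f g : nat -> Y -> R) (b : Y -> R) (Z : nat -> R).

Let A b K f x := Num.sqrt (running_norm N b K f x).

Let domination K f Z := forall x, (x < 2 ^ K)%N ->
  D * Num.sqrt (dyadic_max K (fun i => N (f i)) x) <= Z x.

(** The premise of the Garsia-Neveu inequality at a node: past the history [b], the expected growth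
    of [A] is at most the expectation of [Z]. By subadditivity of the square root this growth is at
    most the root of the norm of the maximal function of the subtree alone; [HD] bounds its mean by
    the mean of N f at the node, one of the averages under [dyadic_max]. *)
Let increment K f b Z : (forall i y, 0 <= f i y) -> (forall y, 0 <= b y) ->
  domination K f Z ->
  \sum_(x < 2 ^ K) A b K f x - (2 ^ K)%:R * Num.sqrt (N b) <=
  \sum_(x < 2 ^ K) Z x.
Proof.
move=> f0 b0 dom; rewrite lerBlDl.
apply: (@le_trans _ _ ((2 ^ K)%:R * Num.sqrt (N b) +
    \sum_(x < 2 ^ K) Num.sqrt (N (vec_max K f x)))).
  rewrite -[X in X%:R]card_ord mulr_natl -sumr_const -big_split /= ler_sum// => x _.
  apply: (@le_trans _ _ (Num.sqrt (N b + N (vec_max K f x)))); last first.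
    apply: sqrtr_add; apply: (lnorm_ge0 lN) => // y; exact: vec_max_ge0.
  apply: ler_sqrtr; apply: le_trans (lnorm_add lN b0 (vec_max_ge0 K f x)).
  apply: (lnorm_le lN) => y; first by rewrite le_max b0.
  by rewrite ge_max lerDl lerDr b0 vec_max_ge0.
rewrite lerD2l; apply: le_trans (@HD K f f0) _.
rewrite mulrCA -[X in X%:R * _]card_ord mulr_natl -sumr_const ler_sum// => x _.
apply: le_trans (dom _ (ltn_ord x)); rewrite ler_wpM2l//; apply: ler_sqrtr.
apply: le_trans (cell_avg_le_max _ _ (leqnn K)).
by rewrite cell_avg_top.
Qed.

(** One jump of the increasing process, from m to m'. Raising the weight from m^(t-1) to m'^(t-1) is
    harmless because SA - n m <= SZ; what remains is the tangent inequality for x^t. *)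
Lemma garsia_algebra (t n m m' SAt SAZ SZ SA : R) : 1 < t -> 0 <= n ->
  0 <= m -> m <= m' -> SA - n * m <= SZ ->
  SAt - n * m' `^ t <=
    t * (SAZ - m' `^ (t - 1) * SZ) + t * m' `^ (t - 1) * (SA - n * m') ->
  SAt - n * m `^ t <=
    t * (SAZ - m `^ (t - 1) * SZ) + t * m `^ (t - 1) * (SA - n * m).
Proof.
move=> t1 n0 m0 mm' inc; have m'0 := le_trans m0 mm'.
have Y1 := young_powR t1 m'0 m0.
have t0 : 0 < t by lra.
have E' := powR_mulD m'0 t0; have E := powR_mulD m0 t0.
have P : m `^ (t - 1) <= m' `^ (t - 1) by apply: ler_powRl => //; lra.
rewrite -E' -E in Y1 *.
move: P Y1; set u := m' `^ (t - 1); set v := m `^ (t - 1) => P Y1 H.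
have I1 : 0 <= t * (u - v) * (SZ - (SA - n * m)).
  by rewrite mulr_ge0 ?mulr_ge0 ?subr_ge0//; lra.
have I2 : 0 <= n * ((t - 1) * (u * m') + v * m - t * (u * m)).
  by rewrite mulr_ge0// subr_ge0.
lra.
Qed.

(* The Garsia-Neveu inequality for the increasing adapted process A. *)
Lemma garsia t K f b Z : 1 < t ->
  (forall i y, 0 <= f i y) -> (forall y, 0 <= b y) -> domination K f Z ->
  forall m, m = Num.sqrt (N b) ->
  \sum_(x < 2 ^ K) A b K f x `^ t - (2 ^ K)%:R * m `^ t <=
  t * (\sum_(x < 2 ^ K) A b K f x `^ (t - 1) * Z x
       - m `^ (t - 1) * \sum_(x < 2 ^ K) Z x)
  + t * m `^ (t - 1) * (\sum_(x < 2 ^ K) A b K f x - (2 ^ K)%:R * m).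
Proof.
move=> t1; elim: K f b Z => [|K IH] f b Z f0 b0 dom m mE.
  pose m' := A b 0 f 0%N.
  apply: (@garsia_algebra _ _ _ m') => //; first by rewrite mE sqrtr_ge0.
  - rewrite mE; apply: ler_sqrtr; apply: (lnorm_le lN) => // y.
    by rewrite le_max lexx.
  - by rewrite mE; exact: increment.
  - rewrite !big_ord_recr !big_ord0 /= !add0r !mul1r -/m' !subrr.
    lra.
pose c y := Num.max (b y) (vec_avg K.+1 f y).
have c0 y : 0 <= c y by rewrite le_max b0.
have fr0 i y : 0 <= vec_right K f i y by exact: f0.
pose m' := Num.sqrt (N c).
apply: (@garsia_algebra _ _ _ m') => //; first by rewrite mE sqrtr_ge0.
- by rewrite mE; apply: ler_sqrtr; apply: (lnorm_le lN) => // y; rewrite le_max lexx.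
- by rewrite mE; exact: increment.
rewrite (sum_pow2S K (fun x => A b K.+1 f x `^ t)).
rewrite (sum_pow2S K (fun x => A b K.+1 f x `^ (t - 1) * Z x)).
rewrite (sum_pow2S K Z) (sum_pow2S K (A b K.+1 f)).
have El (x : nat) : (x < 2 ^ K)%N -> A b K.+1 f x = A c K f x.
  by move=> xK; rewrite /A running_norm_left.
have Er (x : nat) : (x < 2 ^ K)%N ->
    A b K.+1 f (2 ^ K + x)%N = A c K (vec_right K f) x.
  by move=> xK; rewrite /A running_norm_right.
under eq_bigr do rewrite El//.
under [X in _ + X - _]eq_bigr do rewrite Er//.
under [X in _ <= _ * (X + _ - _) + _]eq_bigr do rewrite El//.
under [X in _ <= _ * (_ + X - _) + _]eq_bigr do rewrite Er//.
under [X in _ <= _ + _ * (X + _ - _)]eq_bigr do rewrite El//.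
under [X in _ <= _ + _ * (_ + X - _)]eq_bigr do rewrite Er//.
have dl : domination K f Z.
  move=> x xK; apply: le_trans (dom x _); last by rewrite expnS mul2n -addnn ltn_addr.
  by rewrite ler_wpM2l//; apply: ler_sqrtr; rewrite dyadic_maxS le_max lexx.
have dr : domination K (vec_right K f) (fun x => Z (2 ^ K + x)%N).
  move=> x xK; apply: le_trans (dom (2 ^ K + x)%N _); last first.
    by rewrite expnS mul2n -addnn ltn_add2l.
  rewrite ler_wpM2l//; apply: ler_sqrtr; rewrite dyadic_maxS dyadic_max_shift//.
  by rewrite le_max lexx.
have := IH f c Z f0 c0 dl _ erefl; have := IH _ c _ fr0 c0 dr _ erefl; rewrite -/m' /=.
rewrite pow2S; lra.
Qed.

(** Started from b = 0, hence m = 0, the boundary terms vanish: the sum of A^t is at most t times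
    the sum of A^(t-1) Z, and [powR_absorb] concludes. *)
Lemma garsia_bound t K f Z : 1 < t -> (forall i y, 0 <= f i y) ->
  (forall x, (x < 2 ^ K)%N ->
    D * Num.sqrt (dyadic_max K (fun i => N (f i)) x) <= Z x) ->
  (forall x, 0 <= Z x) ->
  \sum_(x < 2 ^ K) Num.sqrt (N (vec_max K f x)) `^ t <=
  2 * (t * (2 * t) `^ (t - 1)) * \sum_(x < 2 ^ K) Z x `^ t.
Proof.
move=> t1 f0 dom Z0.
have := garsia t1 f0 (fun _ => lexx 0) dom erefl.
have tn0 : t != 0 by rewrite gt_eqF//; lra.
have tn1 : t - 1 != 0 by rewrite gt_eqF//; lra.
rewrite lnorm0// sqrtr0 (powR0 tn0) (powR0 tn1).
rewrite !(mulr0, mul0r, addr0, subr0).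
have E (x : nat) : A (fun=> 0) K f x = Num.sqrt (N (vec_max K f x)).
  by congr (Num.sqrt (N _)); apply/funext => y; rewrite max_r// vec_max_ge0.
under eq_bigr do rewrite E.
under [X in _ <= _ * X]eq_bigr do rewrite E.
set S := \sum_(x < _) _ `^ t; set G := \sum_(x < _) _ * _ => SG.
set F := \sum_(x < _) _.
have : t * G <= S / 2 + t * (2 * t) `^ (t - 1) * F.
  rewrite /G /S /F mulr_sumr mulr_suml mulr_sumr -big_split /= ler_sum// => x _.
  by apply: powR_absorb; rewrite ?sqrtr_ge0//; lra.
lra.
Qed.

End garsia.

(* [half_boundP] bounds the square root of the norm of the maximal function; the
   Garsia-Neveu inequality turns this into a domination by the scalar maximal
   function of [N f], to which Doob's inequality applies. *)
Lemma vec_max_extrapolation (R : realType) (s0 C0 s : R) : 1 < s0 -> 0 <= C0 ->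
  1 < s -> exists2 C : R, 0 < C &
  forall (Y : Type) (N : (Y -> R) -> R), lattice_norm N ->
    vec_max_bound N s0 C0 -> vec_max_bound N s C.
Proof.
move=> s01 C00 s1; pose D := 2 * (1 + C0) * Num.sqrt 8 : R.
have D0 : 0 <= D by rewrite mulr_ge0 ?sqrtr_ge0//; lra.
(* The process is a square root, so its exponent 2 s is the exponent s of the norm itself. *)
have t1 : 1 < s * 2 by lra.
pose Cg := 2 * ((s * 2) * (2 * (s * 2)) `^ (s * 2 - 1)) : R.
have [Cd Cd0 Hd] := doob s1.
have sqE (a : R) : 0 <= a -> Num.sqrt a `^ (s * 2) = a `^ s.
  move=> a0; rewrite -powR12_sqrt// -powRrM; congr (_ `^ _); lra.
exists (Cg * (D `^ (s * 2) + 1) * Cd).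
  rewrite !mulr_gt0 ?powR_gt0//; try lra.
  by have := powR_ge0 D (s * 2); lra.
move=> Y N lN VM K f f0.
have HD := half_boundP lN s01 C00 VM.
pose Z x := D * Num.sqrt (dyadic_max K (fun i => N (f i)) x).
have Z0 x : 0 <= Z x by rewrite mulr_ge0 ?sqrtr_ge0.
have Nf0 x : 0 <= N (f x) by apply: (lnorm_ge0 lN).
have := garsia_bound lN D0 HD t1 f0 (fun _ _ => lexx _) Z0.
have V0 x : 0 <= N (vec_max K f x).
  by apply: (lnorm_ge0 lN) => y; exact: vec_max_ge0.
under eq_bigr do rewrite sqE//.
move=> /le_trans; apply; rewrite -/Cg.
under eq_bigr do rewrite powRM ?sqrtr_ge0// sqE ?dyadic_max_ge0//.
rewrite -mulr_sumr -2![leRHS]mulrA ler_wpM2l//.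
  by rewrite /Cg; apply: mulr_ge0 => //; apply: mulr_ge0; [lra|exact: powR_ge0].
apply: (@le_trans _ _ (D `^ (s * 2) * (Cd * \sum_(x < 2 ^ K) N (f x) `^ s))).
  by rewrite ler_wpM2l ?powR_ge0//; exact: Hd.
rewrite ler_wpM2r ?lerDl//; apply: mulr_ge0; first exact: ltW.
by apply: sumr_ge0 => x _; exact: powR_ge0.
Qed.

(** * Finite l^p norms as lattice norms *)

Section lp.
Context {R : realType}.
Implicit Types (X : nat) (p q : R) (a b : nat -> R).

Lemma powR_div c d p : 0 <= c -> 0 < d -> (c / d) `^ p = c `^ p / d `^ p.
Proof.
move=> c0 d0; have d1 : 0 <= d^-1 by rewrite invr_ge0 ltW.
rewrite powRM//; congr (_ * _).
by rewrite -(powR_inv1 (ltW d0)) -powRrM mulN1r powRN.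
Qed.

Definition lp X p a : R := (\sum_(i < X) a i `^ p) `^ p^-1.

Lemma lp_ge0 X p a : 0 <= lp X p a.
Proof. exact: powR_ge0. Qed.

Let sum_powR_ge0 X p a : 0 <= \sum_(i < X) a i `^ p.
Proof. by apply: sumr_ge0 => i _; exact: powR_ge0. Qed.

Lemma lp_powR X p a : 0 < p -> lp X p a `^ p = \sum_(i < X) a i `^ p.
Proof. by move=> p0; rewrite -powRrM mulVf ?gt_eqF// powRr1. Qed.

Lemma le_lp X p a b : 0 < p -> (forall i, (i < X)%N -> 0 <= a i) ->
  (forall i, (i < X)%N -> a i <= b i) -> lp X p a <= lp X p b.
Proof.
move=> p0 a0 ab; apply: ler_powRl => //; first by rewrite invr_ge0 ltW.
by apply: ler_sum => i _; apply: ler_powRl; [exact: ltW|exact: a0|exact: ab].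
Qed.

Lemma lp_scale X p c a : 0 < p -> 0 <= c -> (forall i, 0 <= a i) ->
  lp X p (fun i => c * a i) = c * lp X p a.
Proof.
move=> p0 c0 a0; rewrite /lp; under eq_bigr do rewrite powRM//.
by rewrite -mulr_sumr powRM ?powR_ge0// -powRrM mulfV ?gt_eqF// powRr1.
Qed.

Lemma lp_eq0 X p a : 0 < p -> (forall i, 0 <= a i) -> lp X p a = 0 ->
  forall i, (i < X)%N -> a i = 0.
Proof.
move=> p0 a0 /powR_eq0_eq0 /eqP; rewrite psumr_eq0; last first.
  by move=> i _; exact: powR_ge0.
move=> /allP H i iX; have := H (Ordinal iX); rewrite mem_index_enum => /(_ isT).
by move=> /eqP/powR_eq0_eq0.
Qed.

(** Testing against a^(p-1) keeps the conjugate exponent out of sight; with both norms scaled to 1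
    this is [young_powR] summed over the indices. *)
Lemma lp_holder X p a b : 1 < p -> (forall i, 0 <= a i) -> (forall i, 0 <= b i) ->
  \sum_(i < X) a i `^ (p - 1) * b i <= lp X p a `^ (p - 1) * lp X p b.
Proof.
move=> p1 a0 b0; have p0 : 0 < p by lra.
have pn : p - 1 != 0 by rewrite gt_eqF//; lra.
have [A0|An] := eqVneq (lp X p a) 0.
  rewrite big1 ?mulr_ge0 ?powR_ge0// => i _.
  by rewrite (lp_eq0 p0 a0 A0 (ltn_ord i)) powR0// mul0r.
have [B0|Bn] := eqVneq (lp X p b) 0.
  rewrite big1 ?mulr_ge0 ?powR_ge0// => i _.
  by rewrite (lp_eq0 p0 b0 B0 (ltn_ord i)) mulr0.
have Ap : 0 < lp X p a by rewrite lt_def An lp_ge0.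
have Bp : 0 < lp X p b by rewrite lt_def Bn lp_ge0.
have := lp_powR X a p0; have := lp_powR X b p0.
move: (lp X p a) (lp X p b) Ap Bp {An Bn} => A B Ap Bp EB EA.
have H : \sum_(i < X) p * ((a i / A) `^ (p - 1) * (b i / B)) <= p.
  apply: (@le_trans _ _ (\sum_(i < X)
      ((p - 1) * (a i / A) `^ p + (b i / B) `^ p))).
    apply: ler_sum => i _; apply: young_powR p1 _ _.
      exact: divr_ge0 (a0 i) (ltW Ap).
    exact: divr_ge0 (b0 i) (ltW Bp).
  rewrite big_split /= -mulr_sumr.
  have norm1 c C : (forall i, 0 <= c i) -> 0 < C ->
      C `^ p = \sum_(i < X) c i `^ p -> \sum_(i < X) (c i / C) `^ p = 1.
    move=> c0 C0 EC; under eq_bigr do rewrite powR_div//.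
    by rewrite -mulr_suml -EC mulfV// gt_eqF// powR_gt0.
  by rewrite !norm1//; lra.
have : p * \sum_(i < X) (a i `^ (p - 1) * b i) <= p * (A `^ (p - 1) * B).
  apply: (@le_trans _ _ ((A `^ (p - 1) * B) *
     \sum_(i < X) p * ((a i / A) `^ (p - 1) * (b i / B)))).
    rewrite !mulr_sumr ler_sum// => i _.
    rewrite powR_div//; apply: le_of_eq; field.
    by rewrite !gt_eqF// powR_gt0.
  by rewrite [leRHS]mulrC ler_wpM2l// mulr_ge0 ?powR_ge0// ltW.
by rewrite ler_pM2l.
Qed.

Lemma lp_add X p a b : 1 < p -> (forall i, 0 <= a i) -> (forall i, 0 <= b i) ->
  lp X p (fun i => a i + b i) <= lp X p a + lp X p b.
Proof.
move=> p1 a0 b0; have p0 : 0 < p by lra.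
set c := fun i => a i + b i; have c0 i : 0 <= c i by rewrite addr_ge0.
have [->|Cn] := eqVneq (lp X p c) 0; first by rewrite addr_ge0 ?lp_ge0.
have Cp : 0 < lp X p c by rewrite lt_def Cn lp_ge0.
rewrite -(ler_pM2l (powR_gt0 (p - 1) Cp)).
rewrite (powR_mulD (ltW Cp))// lp_powR//.
rewrite (_ : \sum_(i < X) c i `^ p =
    \sum_(i < X) c i `^ (p - 1) * a i + \sum_(i < X) c i `^ (p - 1) * b i).
  by rewrite mulrDr; apply: lerD; exact: lp_holder.
by rewrite -big_split /=; apply: eq_bigr => i _; rewrite -mulrDr powR_mulD.
Qed.

Definition lp_norm X p (Y : Type) (N : (Y -> R) -> R) (F : nat * Y -> R) : R :=
  lp X p (fun i => N (fun y => F (i, y))).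

Lemma lp_lattice_norm X p (Y : Type) (N : (Y -> R) -> R) : 1 < p ->
  lattice_norm N -> lattice_norm (lp_norm X p N).
Proof.
move=> p1 lN; have p0 : 0 < p by lra.
have N0 F : (forall y : nat * Y, 0 <= F y) -> forall i, 0 <= N (fun y => F (i, y)).
  by move=> F0 i; apply: (lnorm_ge0 lN).
split.
- move=> F G F0 FG; apply: le_lp => // i _; first exact: N0.
  by apply: (lnorm_le lN).
- move=> F G F0 G0; apply: le_trans (lp_add X p1 (N0 _ F0) (N0 _ G0)).
  apply: le_lp => // i _.
    by apply: (lnorm_ge0 lN) => y; rewrite addr_ge0.
  by apply: (lnorm_add lN).
- move=> c F c0 F0; rewrite /lp_norm -(lp_scale X p0 c0 (N0 _ F0)).
  by congr lp; apply/funext => i; rewrite (lnorm_scale lN).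
Qed.

(** At the exponent of the lattice itself the two sums can be exchanged, and the inequality holds
    with the same constant. This is the one exponent from which [vec_max_extrapolation] reaches all
    others. *)
Lemma lp_vec_max_bound X p C (Y : Type) (N : (Y -> R) -> R) : 1 < p ->
  lattice_norm N -> vec_max_bound N p C -> vec_max_bound (lp_norm X p N) p C.
Proof.
move=> p1 lN VM K f f0; have p0 : 0 < p by lra.
have E (F : nat * Y -> R) :
    lp_norm X p N F `^ p = \sum_(i < X) N (fun y => F (nat_of_ord i, y)) `^ p.
  exact: lp_powR.
have E1 := eq_bigr _ (fun (x : 'I_(2 ^ K)) (_ : true) => E (vec_max K f x)).
have E2 := eq_bigr _ (fun (x : 'I_(2 ^ K)) (_ : true) => E (f x)).
rewrite [leLHS]E1 [X in _ * X]E2.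
rewrite [leLHS]exchange_big [X in _ * X]exchange_big mulr_sumr /=.
by apply: ler_sum => i _; exact: (VM K (fun j y => f j (nat_of_ord i, y))).
Qed.

End lp.

(** * Discrete fractional integrals in mixed norms *)

Section fractional.
Context {R : realType}.
Implicit Types (p q : R) (f : nat -> R).

Local Notation two k := ((2 ^ k)%:R : R).

Lemma two_powRS k a : two k.+1 `^ a = 2 `^ a * two k `^ a.
Proof. by rewrite pow2S powRM. Qed.

Let two_gt0 k : 0 < two k. Proof. exact: pow2_gt0. Qed.

Lemma powR2_gt1 b : 0 < b -> 1 < 2 `^ b :> R.
Proof.
move=> b0; have /(_ ler01 (ler0n _ 2)) := @gt0_ltr_powR R b b0 1 2.
by rewrite powR1; apply; lra.
Qed.

Lemma geometric_low b : 0 < b -> exists2 C : R, 0 < C & forall T n, 0 < T ->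
  \sum_(k < n) (if two k <= T then two k `^ b else 0) <= C * T `^ b.
Proof.
move=> b0; have A1 := powR2_gt1 b0; set A := 2 `^ b in A1.
have full n : \sum_(k < n) two k `^ b <= two n `^ b / (A - 1).
  elim: n => [|n IH]; first by rewrite big_ord0 divr_ge0 ?powR_ge0//; lra.
  rewrite big_ord_recr /= two_powRS -/A; apply: le_trans (lerD IH (lexx _)) _.
  by apply: le_of_eq; field; lra.
exists (A / (A - 1)) => [|T n T0]; first by rewrite divr_gt0; lra.
elim: n => [|n IH].
  by rewrite big_ord0 mulr_ge0 ?powR_ge0// divr_ge0; lra.
rewrite big_ord_recr /=; case: ifPn => [nT|_]; last by rewrite addr0.
apply: (@le_trans _ _ (\sum_(k < n) two k `^ b + two n `^ b)).
  by rewrite lerD2r ler_sum// => k _; case: ifP => // _; exact: powR_ge0.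
apply: (le_trans (lerD (full n) (lexx _))).
have -> : two n `^ b / (A - 1) + two n `^ b = A / (A - 1) * two n `^ b.
  by field; lra.
rewrite ler_wpM2l ?divr_ge0//; try lra.
by apply: ler_powRl => //; exact: ltW.
Qed.

Lemma geometric_high c : 0 < c -> exists2 C : R, 0 < C & forall T n, 0 < T ->
  \sum_(k < n) (if two k <= T then 0 else two k `^ (- c)) <= C * T `^ (- c).
Proof.
move=> c0; have A1 := powR2_gt1 c0; set A := 2 `^ c in A1.
have decr a b : 0 < a -> a <= b -> b `^ (- c) <= a `^ (- c).
  move=> a0 ab; rewrite !powRN lef_pV2 ?posrE ?powR_gt0//; last exact: lt_le_trans ab.
  by apply: ler_powRl => //; exact: ltW.
exists (A / (A - 1)) => [|T n T0]; first by rewrite divr_gt0; lra.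
have K0 : 0 < A / (A - 1) by rewrite divr_gt0; lra.
(* The added term is the whole geometric tail from scale n on, which makes the claim inductive. *)
suff : \sum_(k < n) (if two k <= T then 0 else two k `^ (- c)) +
    (if two n <= T then 0 else A / (A - 1) * two n `^ (- c)) <=
    A / (A - 1) * T `^ (- c).
  apply: le_trans; rewrite lerDl; case: ifP => // _.
  by rewrite mulr_ge0 ?powR_ge0// ltW.
elim: n => [|n IH].
  rewrite big_ord0 add0r; case: ifPn => [_|]; first by rewrite mulr_ge0 ?powR_ge0// ltW.
  by rewrite -ltNge => /ltW Tn; rewrite ler_wpM2l ?(ltW K0)// decr.
rewrite big_ord_recr /=; case: (leP (two n) T) IH => nT IH.
  rewrite addr0 big1 ?add0r; last first.
    move=> k _; rewrite (le_trans _ nT)// ler_nat leq_exp2l//.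
    exact/ltnW/ltn_ord.
  case: ifPn => [_|]; first by rewrite mulr_ge0 ?powR_ge0// ltW.
  by rewrite -ltNge => /ltW Tn; rewrite ler_wpM2l ?(ltW K0)// decr.
apply: le_trans IH; rewrite -addrA lerD2l ifN; last first.
  by rewrite -ltNge (lt_le_trans nT)// ler_nat leq_exp2l.
rewrite two_powRS [2 `^ _]powRN -/A; apply: le_of_eq.
by field; rewrite !gt_eqF//; lra.
Qed.

Lemma sum_block_le n M c (G : nat -> R) : (forall x, 0 <= G x) -> (c < M)%N ->
  \sum_(j < n) G (c * n + j)%N <= \sum_(x < M * n) G x.
Proof.
move=> G0; elim: M => // M IH; rewrite ltnS leq_eqVlt mulSnr big_split_ord /=.
move=> /predU1P[->|/IH H]; first by rewrite lerDr sumr_ge0.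
by apply: le_trans H _; rewrite lerDl sumr_ge0.
Qed.

Lemma cell_avg_le_lp p K k f i : 1 < p -> (forall j, 0 <= f j) -> (k <= K)%N ->
  (i < 2 ^ K)%N -> cell_avg k f i <= two k `^ (- p^-1) * lp (2 ^ K) p f.
Proof.
move=> p1 f0 kK iK; have p0 : 0 < p by lra.
pose g j := f (i %/ 2 ^ k * 2 ^ k + j)%N.
have g0 j : 0 <= g j by exact: f0.
have := lp_holder (2 ^ k) p1 (fun _ => ler01) g0.
under eq_bigr do rewrite powR1 mul1r.
have -> : lp (2 ^ k) p (fun=> 1) = two k `^ p^-1.
  rewrite /lp; congr (_ `^ _); under eq_bigr do rewrite powR1.
  by rewrite sumr_const card_ord.
rewrite -powRrM; have -> : p^-1 * (p - 1) = 1 - p^-1 by field; lra.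
move=> H; rewrite /cell_avg ler_pdivrMr//; apply: (le_trans H).
have -> : two k `^ (- p^-1) * lp (2 ^ K) p f * two k =
   two k `^ (1 - p^-1) * lp (2 ^ K) p f.
  rewrite mulrAC; congr (_ * _); rewrite addrC powRD ?powRr1//.
  by rewrite (gt_eqF (two_gt0 k)) implybT.
rewrite ler_wpM2l ?powR_ge0//; apply: ler_powRl.
- by rewrite invr_ge0 ltW.
- by apply: sumr_ge0 => j _; exact: powR_ge0.
have -> : (2 ^ K = 2 ^ (K - k) * 2 ^ k)%N by rewrite -expnD subnK.
apply: (@sum_block_le _ _ _ (fun x => f x `^ p)) => [x|]; first exact: powR_ge0.
by rewrite ltn_divLR ?expn_gt0// -expnD subnK.
Qed.

(** Hedberg's argument. At each index the scales up to a threshold are bounded by the maximal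
    function, the larger ones by the p-norm [S] through Hoelder's inequality; both sums are
    geometric, and Doob's inequality handles the maximal function that is left. *)
Lemma hls_tree p q : 1 < p -> p < q -> exists2 C : R, 0 < C &
  forall K f, (forall i, 0 <= f i) ->
  lp (2 ^ K) q (fun i => \sum_(k < K.+1) two k `^ (p^-1 - q^-1) * cell_avg k f i)
    <= C * lp (2 ^ K) p f.
Proof.
move=> p1 pq; have p0 : 0 < p by lra.
have q0 : 0 < q by lra.
set b := p^-1 - q^-1; have b0 : 0 < b by rewrite subr_gt0 ltf_pV2.
have c0 : 0 < q^-1 by rewrite invr_gt0.
have [C1 C10 low] := geometric_low b0; have [C2 C20 high] := geometric_high c0.
have [C3 C30 Hd] := doob p1.
exists ((C1 + C2) * C3 `^ q^-1) => [|K f f0].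
  by apply: mulr_gt0; [lra|exact: powR_gt0].
set S := lp (2 ^ K) p f; set I := fun i => _.
have I0 i : 0 <= I i.
  by apply: sumr_ge0 => k _; rewrite mulr_ge0 ?powR_ge0// cell_avg_ge0.
have [S0|Sn] := eqVneq S 0.
  have Iz i : (i < 2 ^ K)%N -> I i = 0.
    move=> iK; apply: big1 => k _; apply/eqP; rewrite mulf_eq0; apply/orP; right.
    rewrite eq_le cell_avg_ge0// andbT.
    apply: le_trans (cell_avg_le_lp p1 f0 _ iK) _; first by rewrite -ltnS.
    by rewrite -/S S0 mulr0.
  rewrite S0 mulr0 /lp big1 ?powR0 ?invr_eq0 ?gt_eqF// => i _.
  by rewrite Iz// powR0// gt_eqF.
have Sp : 0 < S by rewrite lt_def Sn lp_ge0.
pose m i := dyadic_max K f i.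
have bd i : (i < 2 ^ K)%N -> I i <= (C1 + C2) * (S * (m i / S) `^ (p / q)).
  move=> iK; have [mi0|mn] := eqVneq (m i) 0.
    have -> : I i = 0.
      apply: big1 => k _; apply/eqP; rewrite mulf_eq0; apply/orP; right.
      rewrite eq_le cell_avg_ge0// andbT -mi0.
      by apply: cell_avg_le_max; rewrite -ltnS.
    by rewrite !mulr_ge0 ?powR_ge0//; lra.
  have mp : 0 < m i by rewrite lt_def mn dyadic_max_ge0.
  have rp : 0 < m i / S by rewrite divr_gt0.
  (* This threshold makes m T^(1/p - 1/q) and S T^(-1/q) equal: both are S (m/S)^(p/q), whose q-th
     power contains m only as m^p. *)
  pose T := (m i / S) `^ (- p).
  have T0 : 0 < T by exact: powR_gt0.
  have ET : m i * T `^ b = S * (m i / S) `^ (p / q).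
    rewrite /T -powRrM; have -> : - p * b = - 1 + p / q by rewrite /b; field; lra.
    rewrite powRD ?(gt_eqF rp) ?implybT// (powR_inv1 (ltW rp)).
    by rewrite invf_div mulrA mulrCA divff// mulr1.
  have ES : S * T `^ (- q^-1) = S * (m i / S) `^ (p / q).
    by congr (_ * _); rewrite /T -powRrM mulrNN.
  apply: (@le_trans _ _ (m i * (\sum_(k < K.+1) (if two k <= T then two k `^ b else 0)) +
     S * (\sum_(k < K.+1) (if two k <= T then 0 else two k `^ (- q^-1))))).
    rewrite !mulr_sumr -big_split /=; apply: ler_sum => k _.
    have kK : (k <= K)%N by rewrite -ltnS.
    case: ifPn => _.
      rewrite mulr0 addr0 mulrC ler_wpM2r ?powR_ge0//.
      exact: cell_avg_le_max.
    rewrite mulr0 add0r.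
    have -> : S * two k `^ (- q^-1) = two k `^ b * (two k `^ (- p^-1) * S).
      rewrite mulrA -powRD ?(gt_eqF (two_gt0 k)) ?implybT// mulrC; congr (_ `^ _ * _).
      by rewrite /b; lra.
    by rewrite ler_wpM2l ?powR_ge0//; apply: cell_avg_le_lp.
  apply: (@le_trans _ _ (m i * (C1 * T `^ b) + S * (C2 * T `^ (- q^-1)))).
    by apply: lerD; apply: ler_wpM2l; [exact: ltW|exact: low|exact: ltW|exact: high].
  by rewrite [m i * _]mulrCA ET [S * (C2 * _)]mulrCA ES -mulrDl.
have C120 : 0 <= C1 + C2 by lra.
have r0 i : 0 <= m i / S by rewrite divr_ge0 ?dyadic_max_ge0// ltW.
apply: (le_trans (le_lp q0 (fun i _ => I0 i) bd)).
have g0 i : 0 <= (m i / S) `^ (p / q) by exact: powR_ge0.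
have Sg0 i : 0 <= S * (m i / S) `^ (p / q) by exact: mulr_ge0 (ltW Sp) _.
rewrite [leLHS](lp_scale _ q0 C120 Sg0) -[leRHS]mulrA; apply: ler_wpM2l => //.
rewrite [leLHS](lp_scale _ q0 (ltW Sp) g0).
rewrite mulrC ler_wpM2r ?(ltW Sp)// /lp; apply: ler_powRl; first exact: ltW.
  by apply: sumr_ge0 => i _; exact: powR_ge0.
under eq_bigr do rewrite -powRrM divfK ?gt_eqF// powR_div// ?dyadic_max_ge0//.
have EP : S `^ p = \sum_(i < 2 ^ K) f i `^ p by exact: lp_powR.
rewrite -mulr_suml ler_pdivrMr ?(powR_gt0 p Sp)// EP.
exact: Hd.
Qed.

End fractional.

Section discrete_mixed.
Context {R : realType}.
Implicit Types (X k K : nat) (p q a b : R) (s u : seq nat) (F G : seq nat -> R).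

Local Notation two k := ((2 ^ k)%:R : R).

Fixpoint box_avg k s F : R :=
  if s is i :: s' then cell_avg k (fun j => box_avg k s' (fun u => F (j :: u))) i
  else F [::].

Fixpoint dmix X (ps : seq R) F : R :=
  if ps is p :: ps' then dmix X ps' (fun s => lp X p (fun i => F (i :: s)))
  else F [::].

Lemma box_avg_ge0 k s F : (forall u, 0 <= F u) -> 0 <= box_avg k s F.
Proof.
by elim: s F => [|i s IH] F F0 //=; apply: cell_avg_ge0 => j; apply: IH.
Qed.

Lemma le_box_avg k s F G : (forall u, F u <= G u) -> box_avg k s F <= box_avg k s G.
Proof.
by elim: s F G => [|i s IH] F G FG //=; apply: le_cell_avg => j; apply: IH.
Qed.

Lemma box_avg_lin k s (n : nat) (c : R) (F : nat -> seq nat -> R) :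
  box_avg k s (fun u => (\sum_(j < n) F j u) * c) =
  (\sum_(j < n) box_avg k s (F j)) * c.
Proof.
elim: s F => [//|i s IH] F /=; rewrite /cell_avg.
rewrite (eq_bigr _ (fun (j : 'I_(2 ^ k)) _ =>
  IH (fun j0 u => F j0 ((i %/ 2 ^ k * 2 ^ k + j)%N :: u)))).
by rewrite -[in LHS]mulr_suml exchange_big -[in RHS]mulr_suml mulrAC.
Qed.

(** [box_avg] averages in the first coordinate last. Averaging there first allows this average to be
    replaced by a maximal function before the remaining coordinates act. *)
Lemma box_avg_cons k i s F :
  box_avg k (i :: s) F = box_avg k s (fun u => cell_avg k (fun j => F (j :: u)) i).
Proof.
rewrite /= /cell_avg.
exact/esym/(box_avg_lin k s (2 ^ k) _ (fun j u => F ((i %/ 2 ^ k * 2 ^ k + j)%N :: u))).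
Qed.

Lemma scale_box_avg_le k i s c F (g : nat -> R) :
  (forall j, c * box_avg k s (fun u => F (j :: u)) <= g j) ->
  c * box_avg k (i :: s) F <= cell_avg k g i.
Proof.
move=> H; rewrite /= /cell_avg mulrA ler_wpM2r ?invr_ge0// mulr_sumr.
by apply: ler_sum => j _; exact: H.
Qed.

Lemma le_dmix X ps F G : all (fun p => 0 < p) ps ->
  (forall s, all (fun i => i < X)%N s -> 0 <= F s) ->
  (forall s, all (fun i => i < X)%N s -> F s <= G s) ->
  dmix X ps F <= dmix X ps G.
Proof.
elim: ps F G => [|p ps IH] F G /=; first by move=> _ _ FG; exact: FG.
move=> /andP[p0 ps0] F0 FG; apply: (IH _ _ ps0) => s sX; first exact: lp_ge0.
by apply: le_lp => // i iX; [apply: F0|apply: FG]; rewrite /= iX.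
Qed.

Lemma dmix_scale X ps c F : all (fun p => 0 < p) ps -> 0 <= c ->
  (forall s, 0 <= F s) -> dmix X ps (fun s => c * F s) = c * dmix X ps F.
Proof.
elim: ps F => [//|p ps IH] F /= /andP[p0 ps0] c0 F0.
rewrite -(IH _ ps0 c0); last by move=> s; exact: lp_ge0.
by congr dmix; apply/funext => s; rewrite lp_scale.
Qed.

Fixpoint frac_max K a s F : R :=
  if K is K'.+1 then Num.max (frac_max K' a s F) (two K `^ a * box_avg K s F)
  else Num.max 0 (two 0 `^ a * box_avg 0 s F).

(** The fractional integral of order [a] on a grid of unit mesh: in n coordinates, 2^(k a) times the
    average over a box of side 2^k is 2^(k (a - n)) times the sum over it. *)
Definition frac_sum K a s F : R :=
  \sum_(k < K.+1) two k `^ a * box_avg k s F.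

Lemma frac_max_ge0 K a s F : 0 <= frac_max K a s F.
Proof. by elim: K => [|K IH] /=; rewrite le_max ?lexx ?IH. Qed.

Lemma le_frac_max K k a s F : (k <= K)%N ->
  two k `^ a * box_avg k s F <= frac_max K a s F.
Proof.
elim: K => [|K IH] /=; first by rewrite leqn0 => /eqP ->; rewrite le_max lexx orbT.
by rewrite leq_eqVlt ltnS le_max => /predU1P[->|/IH ->//]; rewrite lexx orbT.
Qed.

Lemma frac_max_le K a s F c : 0 <= c ->
  (forall k, (k <= K)%N -> two k `^ a * box_avg k s F <= c) ->
  frac_max K a s F <= c.
Proof.
move=> c0; elim: K => [|K IH] H /=; rewrite ge_max.
  by rewrite c0 (H 0%N).
by rewrite H// IH// => k kK; apply: H; rewrite (leq_trans kK).
Qed.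

Lemma frac_sum_ge0 K a s F : (forall u, 0 <= F u) -> 0 <= frac_sum K a s F.
Proof.
by move=> F0; apply: sumr_ge0 => k _; rewrite mulr_ge0 ?powR_ge0// box_avg_ge0.
Qed.

(** The operator charged to one coordinate. In both cases it dominates the term of every single
    scale, which is what a supremum over scales asks of it. *)
Definition line_op p q K (g : nat -> R) (i : nat) : R :=
  if p == q then dyadic_max K g i
  else \sum_(k < K.+1) two k `^ (p^-1 - q^-1) * cell_avg k g i.

Lemma line_op_ge0 p q K g i : (forall j, 0 <= g j) -> 0 <= line_op p q K g i.
Proof.
move=> g0; rewrite /line_op; case: ifP => _; first exact: dyadic_max_ge0.
by apply: sumr_ge0 => k _; rewrite mulr_ge0 ?powR_ge0// cell_avg_ge0.
Qed.

Lemma le_line_op p q K k g i : (forall j, 0 <= g j) -> (k <= K)%N ->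
  two k `^ (p^-1 - q^-1) * cell_avg k g i <= line_op p q K g i.
Proof.
move=> g0 kK; rewrite /line_op; case: eqP => [->|_].
  by rewrite subrr powRr0 mul1r cell_avg_le_max.
have kK1 : (k < K.+1)%N by [].
rewrite (bigD1 (Ordinal kK1))//= lerDl sumr_ge0// => j _.
by rewrite mulr_ge0 ?powR_ge0// cell_avg_ge0.
Qed.

Definition vec_max_family (Cs : R -> R) (Y : Type) (N : (Y -> R) -> R) :=
  forall t, 1 < t -> vec_max_bound N t (Cs t).

(** For p < q the lattice norm passes inside the sum over scales by the triangle inequality, and the
    scalar [hls_tree] applies to N (G i). For p = q no such passage is possible for a maximum, and
    the vector-valued inequality of exponent p does the work. *)
Lemma line_op_bound p q (Cs : R -> R) : 1 < p -> p <= q -> 0 <= Cs p ->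
  exists2 C : R, 0 < C &
  forall (Y : Type) (N : (Y -> R) -> R), lattice_norm N -> vec_max_family Cs N ->
  forall K (G : nat -> Y -> R), (forall i y, 0 <= G i y) ->
  lp (2 ^ K) q (fun i => N (fun y => line_op p q K (fun j => G j y) i)) <=
    C * lp (2 ^ K) p (fun i => N (G i)).
Proof.
move=> p1 pq C0; have p0 : 0 < p by lra.
have q0 : 0 < q by lra.
rewrite /line_op; have [<-|pnq] := eqVneq p q.
  exists ((1 + Cs p) `^ p^-1) => [|Y N lN VM K G G0].
    by apply: powR_gt0; lra.
  have S0 : 0 <= \sum_(i < 2 ^ K) N (G i) `^ p.
    by apply: sumr_ge0 => i _; exact: powR_ge0.
  rewrite /lp -powRM//; last by lra.
  apply: ler_powRl.
  - by rewrite invr_ge0 ltW.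
  - by apply: sumr_ge0 => i _; exact: powR_ge0.
  - apply: le_trans (VM p p1 K G G0) _.
    by apply: ler_wpM2r => //; lra.
have pltq : p < q by rewrite lt_def eq_sym pnq.
have [C Cp H] := hls_tree p1 pltq; exists C => // Y N lN _ K G G0.
have NG0 i : 0 <= N (G i) by apply: (lnorm_ge0 lN).
apply: le_trans (H K _ NG0); apply: le_lp => // i _.
  apply: (lnorm_ge0 lN) => y; apply: sumr_ge0 => k _.
  by rewrite mulr_ge0 ?powR_ge0// cell_avg_ge0.
pose g k y := two k `^ (p^-1 - q^-1) * cell_avg k (fun j => G j y) i.
have g0 k y : 0 <= g k y by rewrite mulr_ge0 ?powR_ge0// cell_avg_ge0.
apply: le_trans (lnorm_sum lN K.+1 g0) _.
apply: ler_sum => k _; rewrite /g (lnorm_scale lN) ?powR_ge0//; last first.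
  by move=> y; exact: cell_avg_ge0.
by rewrite ler_wpM2l ?powR_ge0//; apply: lnorm_cell_avg.
Qed.

(** The constants [Cs'] depend on p and [Cs] alone, neither on the length [X] nor on [N]: the final
    bound has to be uniform in the depth of the grid. *)
Lemma lp_vec_max_family p (Cs : R -> R) : 1 < p -> (forall t, 1 < t -> 0 <= Cs t) ->
  exists2 Cs' : R -> R, (forall t, 1 < t -> 0 <= Cs' t) &
  forall X (Y : Type) (N : (Y -> R) -> R), lattice_norm N ->
    vec_max_family Cs N -> vec_max_family Cs' (lp_norm X p N).
Proof.
move=> p1 C0.
have H (s : R) : exists C : R, 1 < s -> 0 < C /\
    forall (Y : Type) (N : (Y -> R) -> R), lattice_norm N ->
      vec_max_bound N p (Cs p) -> vec_max_bound N s C.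
  have [s1|_] := boolP (1 < s); last by exists 0.
  by have [C Cp HC] := vec_max_extrapolation p1 (C0 p p1) s1; exists C.
have [Cs' HCs] := choice H.
exists Cs' => [s s1|X Y N lN VM s s1]; first by have [/ltW] := HCs s s1.
have [_] := HCs s s1; apply; first exact: lp_lattice_norm.
by apply: lp_vec_max_bound => //; exact: VM.
Qed.

Definition exponents_ok (e : seq (R * R)) := all (fun z => (1 < z.1) && (z.1 <= z.2)) e.

Definition gain (e : seq (R * R)) : R := \sum_(z <- e) (z.1^-1 - z.2^-1).

Lemma exponents_ok_gt0 e : exponents_ok e ->
  all (fun p => 0 < p) (unzip1 e) && all (fun p => 0 < p) (unzip2 e).
Proof.
elim: e => [//|[p q] e IH] /= /andP[/andP[p1 pq] /IH/andP[-> ->]].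
by rewrite !andbT; apply/andP; split; lra.
Qed.

(* In the inductions on the number of coordinates the first coordinate is moved
   into the space of values. *)
Lemma frac_max_bound e (Cs : R -> R) : exponents_ok e ->
  (forall t, 1 < t -> 0 <= Cs t) ->
  exists2 C : R, 0 < C &
  forall (Y : Type) (N : (Y -> R) -> R), lattice_norm N -> vec_max_family Cs N ->
  forall K (F : seq nat -> Y -> R), (forall s y, 0 <= F s y) ->
  dmix (2 ^ K) (unzip2 e)
      (fun s => N (fun y => frac_max K (gain e) s (fun u => F u y))) <=
    C * dmix (2 ^ K) (unzip1 e) (fun s => N (F s)).
Proof.
elim: e Cs => [|[p q] e IH] Cs /=.
  move=> _ _; exists 1 => // Y N lN _ K F F0; rewrite mul1r.
  apply: (lnorm_le lN) => y; first exact: frac_max_ge0.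
  by apply: frac_max_le => // k _; rewrite /gain big_nil powRr0 mul1r.
move=> /andP[/andP[p1 pq] ok] C0; have p0 : 0 < p by lra.
have q0 : 0 < q by lra.
have /andP[e1 e2] := exponents_ok_gt0 ok.
have [C1 C1p H1] := line_op_bound p1 pq (C0 _ p1).
have [Cs' Cs'0 HCs'] := lp_vec_max_family p1 C0.
have [C2 C2p H2] := IH Cs' ok Cs'0.
exists (C1 * C2) => [|Y N lN VM K F F0]; first exact: mulr_gt0.
pose F' u (z : nat * Y) := F (z.1 :: u) z.2.
have F'0 u z : 0 <= F' u z by exact: F0.
have lN' := lp_lattice_norm (2 ^ K) p1 lN.
apply: (@le_trans _ _ (dmix (2 ^ K) (unzip2 e) (fun s =>
   C1 * lp_norm (2 ^ K) p N (fun z => frac_max K (gain e) s (fun u => F' u z))))).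
  apply: (le_dmix e2) => s _; first exact: lp_ge0.
  apply: le_trans (H1 _ _ lN VM K (fun j y => frac_max K (gain e) s
     (fun u => F (j :: u) y)) _); last by move=> *; exact: frac_max_ge0.
  apply: le_lp => // i _; first by apply: (lnorm_ge0 lN) => y; exact: frac_max_ge0.
  apply: (lnorm_le lN) => y; first exact: frac_max_ge0.
  apply: frac_max_le => [|k kK].
    by apply: line_op_ge0 => j; exact: frac_max_ge0.
  apply: le_trans (le_line_op p q _ _ kK); last by move=> j; exact: frac_max_ge0.
  rewrite /gain big_cons /= powRD ?(gt_eqF (pow2_gt0 k)) ?implybT// -mulrA.
  rewrite ler_wpM2l ?powR_ge0//; apply: (@scale_box_avg_le k i s _ (fun u => F u y)) => j.
  exact: le_frac_max.
rewrite (dmix_scale _ e2 (ltW C1p)); last by move=> s; exact: lp_ge0.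
rewrite -mulrA; apply: ler_wpM2l; first exact: ltW.
exact: (H2 _ _ lN' (HCs' (2 ^ K)%N _ _ lN VM) K F' F'0).
Qed.

(** While p = q, the sum over scales is handed on to the later coordinates and the first one pays
    with its maximal function. At the first coordinate with p < q the sum is spent on [line_op], and
    the coordinates after it only have to carry [frac_max]. *)
Lemma frac_sum_bound e (Cs : R -> R) : exponents_ok e ->
  has (fun z => z.1 != z.2) e -> (forall t, 1 < t -> 0 <= Cs t) ->
  exists2 C : R, 0 < C &
  forall (Y : Type) (N : (Y -> R) -> R), lattice_norm N -> vec_max_family Cs N ->
  forall K (F : seq nat -> Y -> R), (forall s y, 0 <= F s y) ->
  dmix (2 ^ K) (unzip2 e)
      (fun s => N (fun y => frac_sum K (gain e) s (fun u => F u y))) <=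
    C * dmix (2 ^ K) (unzip1 e) (fun s => N (F s)).
Proof.
elim: e Cs => [//|[p q] e IH] Cs /= /andP[/andP[p1 pq] ok] ne C0.
have p0 : 0 < p by lra.
have q0 : 0 < q by lra.
have /andP[e1 e2] := exponents_ok_gt0 ok.
have [C1 C1p H1] := line_op_bound p1 pq (C0 _ p1).
have [Cs' Cs'0 HCs'] := lp_vec_max_family p1 C0.
have [pqE|pnq] := eqVneq p q.
  have [|C2 C2p H2] := IH Cs' ok _ Cs'0; first by move: ne; rewrite pqE eqxx.
  exists (C2 * C1) => [|Y N lN VM K F F0]; first exact: mulr_gt0.
  (* The maximal function in the first coordinate acts before the remaining coordinates, so the
     induction hypothesis is used on it and [line_op_bound] comes last; for p < q the order is the
     opposite one. *)
  pose F' u (z : nat * Y) := dyadic_max K (fun j => F (j :: u) z.2) z.1.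
  have F'0 u z : 0 <= F' u z by exact: dyadic_max_ge0.
  have lN' := lp_lattice_norm (2 ^ K) p1 lN.
  apply: (@le_trans _ _ (dmix (2 ^ K) (unzip2 e) (fun s =>
      lp_norm (2 ^ K) p N (fun z => frac_sum K (gain e) s (fun u => F' u z))))).
    apply: (le_dmix e2) => s _; first exact: lp_ge0.
    rewrite -pqE; apply: le_lp => // i _.
      by apply: (lnorm_ge0 lN) => y; exact: frac_sum_ge0.
    apply: (lnorm_le lN) => y; first exact: frac_sum_ge0.
    apply: ler_sum => k _; rewrite /gain big_cons /= pqE subrr add0r.
    rewrite ler_wpM2l ?powR_ge0// -/(box_avg k (i :: s) (fun u => F u y)).
    rewrite box_avg_cons; apply: le_box_avg => u.
    by apply: cell_avg_le_max; rewrite -ltnS.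
  apply: le_trans (H2 _ _ lN' (HCs' (2 ^ K)%N _ _ lN VM) K F' F'0) _.
  rewrite -mulrA; apply: ler_wpM2l; first exact: ltW.
  rewrite -(dmix_scale _ e1 (ltW C1p)); last by move=> s; exact: lp_ge0.
  apply: (le_dmix e1) => s _; first exact: lp_ge0.
  have := H1 _ _ lN VM K (fun j y => F (j :: s) y) (fun j y => F0 (j :: s) y).
  by rewrite /line_op -pqE eqxx.
have [C2 C2p H2] := frac_max_bound ok Cs'0.
exists (C1 * C2) => [|Y N lN VM K F F0]; first exact: mulr_gt0.
pose F' u (z : nat * Y) := F (z.1 :: u) z.2.
have F'0 u z : 0 <= F' u z by exact: F0.
have lN' := lp_lattice_norm (2 ^ K) p1 lN.
apply: (@le_trans _ _ (dmix (2 ^ K) (unzip2 e) (fun s =>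
   C1 * lp_norm (2 ^ K) p N (fun z => frac_max K (gain e) s (fun u => F' u z))))).
  apply: (le_dmix e2) => s _; first exact: lp_ge0.
  apply: le_trans (H1 _ _ lN VM K (fun j y => frac_max K (gain e) s
     (fun u => F (j :: u) y)) _); last by move=> *; exact: frac_max_ge0.
  apply: le_lp => // i _; first by apply: (lnorm_ge0 lN) => y; exact: frac_sum_ge0.
  apply: (lnorm_le lN) => y; first exact: frac_sum_ge0.
  rewrite /line_op (negbTE pnq); apply: ler_sum => k _.
  rewrite /gain big_cons /= powRD ?(gt_eqF (pow2_gt0 k)) ?implybT// -mulrA.
  rewrite ler_wpM2l ?powR_ge0//; apply: (@scale_box_avg_le k i s _ (fun u => F u y)) => j.
  by apply: le_frac_max; rewrite -ltnS.
rewrite (dmix_scale _ e2 (ltW C1p)); last by move=> s; exact: lp_ge0.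
rewrite -mulrA; apply: ler_wpM2l; first exact: ltW.
exact: (H2 _ _ lN' (HCs' (2 ^ K)%N _ _ lN VM) K F' F'0).
Qed.

Theorem discrete_mixed_hls e : exponents_ok e -> has (fun z => z.1 != z.2) e ->
  exists2 C : R, 0 < C & forall K F, (forall s, 0 <= F s) ->
  dmix (2 ^ K) (unzip2 e) (fun s => frac_sum K (gain e) s F) <=
    C * dmix (2 ^ K) (unzip1 e) F.
Proof.
move=> ok ne; pose N (F : unit -> R) := F tt.
have lN : lattice_norm N by split => // F G F0; apply.
have H (s : R) : exists C : R, 1 < s -> 0 < C /\ vec_max_bound N s C.
  have [s1|_] := boolP (1 < s); last by exists 0.
  have [C Cp HC] := doob s1; exists C => _; split=> // K f f0.
  exact: (HC K (fun i => f i tt)).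
have [Cs HCs] := choice H.
have Cs0 (s : R) : 1 < s -> 0 <= Cs s by move=> s1; have [/ltW] := HCs s s1.
have [C Cp HC] := frac_sum_bound ok ne Cs0.
exists C => // K F F0.
apply: (HC _ N lN _ K (fun s _ => F s)) => // s s1.
by have [] := HCs s s1.
Qed.

End discrete_mixed.

(** * Integrals and mixed norms of arbitrary functions *)

Section ereal_power.
Context {R : realType}.
Local Open Scope ereal_scope.
Implicit Types (x y : \bar R) (r : R).

Lemma le_poweR r x y : (0 <= r)%R -> 0 <= x -> x <= y -> x `^ r <= y `^ r.
Proof.
move=> r0 x0 xy; apply: gt0_ler_poweR => //; rewrite in_itv /= leey andbT//.
exact: le_trans xy.
Qed.

Lemma poweRK r x : r != 0%R -> 0 <= x -> (x `^ r) `^ r^-1 = x.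
Proof. by move=> r0 x0; rewrite -poweRrM mulfV// poweRe1. Qed.

Lemma poweRVK r x : r != 0%R -> 0 <= x -> (x `^ r^-1) `^ r = x.
Proof. by move=> r0 x0; rewrite -poweRrM mulVf// poweRe1. Qed.

Lemma poweR_le_inv r x y : (0 < r)%R -> 0 <= x -> 0 <= y ->
  x `^ r <= y -> x <= y `^ r^-1.
Proof.
move=> r0 x0 y0 xy; rewrite -[leLHS](@poweRK r) ?gt_eqF//.
by apply: le_poweR => //; [rewrite invr_ge0 ltW|exact: poweR_ge0].
Qed.

Lemma poweR_add_le r x y : (0 < r)%R -> 0 <= x -> 0 <= y ->
  (x + y) `^ r <= (2 `^ r)%:E * (x `^ r + y `^ r).
Proof.
move=> r0; wlog xy : x y / x <= y => [H x0 y0|x0 y0].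
  have [xy|/ltW yx] := leP x y; first exact: H.
  by rewrite addeC [_ `^ r + _]addeC; exact: H.
apply: (@le_trans _ _ ((2%:E * y) `^ r)).
  apply: le_poweR; [exact: ltW|exact: adde_ge0|].
  by rewrite mule_natl mule2n leeD2r.
rewrite poweRM// poweR_EFin; apply: lee_wpmul2l; first by rewrite lee_fin powR_ge0.
by rewrite leeDr// poweR_ge0.
Qed.

End ereal_power.

Section lower_integral.
Context d (T : measurableType d) (R : realType).
Variable mu : {measure set T -> \bar R}.
Local Open Scope ereal_scope.
Implicit Types f g : T -> \bar R.
Import HBNNSimple.

(* The library's integral of a non-measurable non-negative function is its lower
   integral, so comparisons need no measurability. *)
Lemma integral_lower_le f M : (forall x, 0 <= f x) ->
  (forall h : {nnsfun T >-> R}, (forall x, (h x)%:E <= f x) ->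
     \int[mu]_x (h x)%:E <= M) ->
  \int[mu]_x f x <= M.
Proof.
move=> f0 H; rewrite ge0_integralTE//; apply: ge_ereal_sup => _ [h /= hf <-].
by rewrite -integralT_nnsfun; exact: H.
Qed.

Lemma le_lower_integral f g : (forall x, 0 <= f x) -> (forall x, f x <= g x) ->
  \int[mu]_x f x <= \int[mu]_x g x.
Proof.
move=> f0 fg; have g0 x : 0 <= g x by exact: le_trans (fg x).
apply: integral_lower_le => // h hf; rewrite [leRHS]ge0_integralTE//.
rewrite integralT_nnsfun; apply: ereal_sup_ubound; exists h => //= x.
exact: le_trans (fg x).
Qed.

Lemma le_lower_integral_ae f g : (forall x, 0 <= f x) -> (forall x, 0 <= g x) ->
  (\forall x \ae mu, f x <= g x) -> \int[mu]_x f x <= \int[mu]_x g x.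
Proof.
move=> f0 g0 [N [mN N0 Nfg]]; apply: integral_lower_le => // h hf.
(* Cutting the simple function off the exceptional null set keeps its integral and puts it below [g]
   everywhere. *)
pose h' : T -> \bar R := (fun x => (h x)%:E) \_ (~` N).
have mh' : measurable_fun setT h'.
  apply/(measurable_restrictT _ _).1; first exact: measurableC.
  by apply: measurable_funTS; apply/measurable_EFinP.
have h'0 x : 0 <= h' x.
  by rewrite /h' /patch; case: ifP => // _; rewrite lee_fin fun_ge0.
rewrite (@ge0_ae_eq_integral _ _ _ mu setT (fun x => (h x)%:E) h')//.
- apply: le_lower_integral => // x; rewrite /h' /patch; case: ifPn => // xN.
  apply: le_trans (hf x) _; apply: contrapT => H.
  by move: xN; rewrite inE => /(_ (Nfg x H)).
- by apply/measurable_EFinP.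
- by move=> x _; rewrite lee_fin fun_ge0.
- exists N; split => // x /= H; apply: contrapT => xN; apply: H => _.
  by rewrite /h' /patch ifT// inE.
Qed.

Lemma lower_integral_scale c f : (0 < c)%R -> (forall x, 0 <= f x) ->
  \int[mu]_x (c%:E * f x) = c%:E * \int[mu]_x f x.
Proof.
have le k g : (0 < k)%R -> (forall x, 0 <= g x) ->
    \int[mu]_x (k%:E * g x) <= k%:E * \int[mu]_x g x.
  move=> k0 g0; apply: integral_lower_le => [x|h hg].
    by rewrite mule_ge0// lee_fin ltW.
  rewrite -lee_pdivrMl// -ge0_integralZl_EFin//; last 3 first.
  - by move=> x _; rewrite lee_fin fun_ge0.
  - by apply/measurable_EFinP.
  - by rewrite invr_ge0 ltW.
  apply: le_lower_integral => x; first by rewrite mule_ge0// lee_fin ?invr_ge0 ?fun_ge0// ltW.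
  by rewrite lee_pdivrMl.
move=> c0 f0; apply/eqP; rewrite eq_le le//=.
rewrite -lee_pdivlMl//; apply: le_trans (le _ (fun x => c%:E * f x) _ _).
- apply: le_lower_integral => // x.
  by rewrite muleA -EFinM mulVf ?gt_eqF// mul1e.
- by rewrite invr_gt0.
- by move=> x; rewrite mule_ge0// lee_fin ltW.
Qed.

Lemma Lnorm_scale p c f : 0 < p -> (0 < c)%R ->
  Lnorm mu p (fun x => c%:E * f x) = c%:E * Lnorm mu p f.
Proof.
rewrite unlock; case: p => [r| |]//; last first.
  move=> _ c0; case: ifPn => muT; last by rewrite mule0.
  rewrite -ess_sup_pZl//; congr ess_sup; apply/funext => x /=.
  by rewrite abseM gee0_abs// lee_fin ltW.
rewrite lte_fin => r0 c0.
under eq_fun do rewrite abseM gee0_abs ?lee_fin ?(ltW c0)// poweRM ?lee_fin ?(ltW c0)//.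
rewrite poweR_EFin lower_integral_scale ?powR_gt0//; last first.
  by move=> x; exact: poweR_ge0.
rewrite poweRM ?lee_fin ?powR_ge0//; last first.
  by apply: integral_ge0 => x _; exact: poweR_ge0.
by rewrite poweR_EFin -powRrM mulfV ?gt_eqF// powRr1 ?ltW.
Qed.

Lemma le_Lnorm_ae p f g : 0 < p -> (\forall x \ae mu, `|f x| <= `|g x|) ->
  Lnorm mu p f <= Lnorm mu p g.
Proof.
rewrite unlock; case: p => [r| |]//; last first.
  by move=> _ fg; case: ifPn => muT//; exact: le_ess_sup.
rewrite lte_fin => r0 fg; apply: le_poweR; first by rewrite invr_ge0 ltW.
  by apply: integral_ge0 => x _; exact: poweR_ge0.
apply: le_lower_integral_ae => [x|x|]; try exact: poweR_ge0.
apply: filterS fg => x fgx; apply: le_poweR => //; exact: ltW.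
Qed.

Lemma le_Lnorm p f g : 0 < p -> (forall x, `|f x| <= `|g x|) ->
  Lnorm mu p f <= Lnorm mu p g.
Proof. by move=> p0 fg; apply: le_Lnorm_ae => //; exact: nearW. Qed.

Lemma Lnorm_fin (r : R) f : (0 < r)%R -> (forall x, 0 <= f x) ->
  Lnorm mu r%:E f = (\int[mu]_x (f x `^ r)) `^ r^-1.
Proof.
move=> r0 f0; rewrite unlock; congr (_ `^ _).
by apply: eq_integral => x _; rewrite gee0_abs.
Qed.

(** Entries of the second exponent may lie below 1, where only a quasi-triangle inequality holds.
    The factor 2 = (2^r)^(1/r) comes from the power under the integral, 2^(1/r) from the outer
    power. *)
Lemma Lnorm_add_le (r : R) f g : (0 < r)%R ->
  measurable_fun setT f -> measurable_fun setT g ->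
  (forall x, 0 <= f x) -> (forall x, 0 <= g x) ->
  Lnorm mu r%:E (fun x => f x + g x) <=
  (2 `^ (1 + r^-1))%:E * (Lnorm mu r%:E f + Lnorm mu r%:E g).
Proof.
move=> r0 mf mg f0 g0; have ri0 : (0 < r^-1)%R by rewrite invr_gt0.
rewrite !Lnorm_fin//; last by move=> x; exact: adde_ge0.
have If0 : 0 <= \int[mu]_x (f x `^ r) by apply: integral_ge0 => x _; exact: poweR_ge0.
have Ig0 : 0 <= \int[mu]_x (g x `^ r) by apply: integral_ge0 => x _; exact: poweR_ge0.
have mp (h : T -> \bar R) : measurable_fun setT h -> measurable_fun setT (fun x => h x `^ r).
  by move=> mh; have := measurableT_comp (@measurable_poweR R r) mh; apply.
apply: (@le_trans _ _ (((2 `^ r)%:E *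
   (\int[mu]_x (f x `^ r) + \int[mu]_x (g x `^ r))) `^ r^-1)).
  apply: le_poweR; first exact: ltW.
    by apply: integral_ge0 => x _; exact: poweR_ge0.
  rewrite -ge0_integralD//; try exact: mp; try by move=> x _; exact: poweR_ge0.
  rewrite -lower_integral_scale ?powR_gt0//; last first.
    by move=> x; rewrite adde_ge0 ?poweR_ge0.
  apply: le_lower_integral => x; first exact: poweR_ge0.
  exact: poweR_add_le.
rewrite poweRM; [|by rewrite lee_fin powR_ge0|exact: adde_ge0].
rewrite poweR_EFin -powRrM mulfV ?gt_eqF//.
have -> : (2 `^ (1 + r^-1) = 2 * 2 `^ r^-1 :> R)%R.
  by rewrite powRD ?powRr1// pnatr_eq0 implybT.
rewrite powRr1// EFinM -muleA.
by rewrite lee_wpmul2l// poweR_add_le.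
Qed.

End lower_integral.

Section ereal_sup_power.
Context {R : realType}.
Local Open Scope ereal_scope.

Lemma ereal_sup_poweR_le (r : R) (u : (\bar R)^nat) M : (0 < r)%R ->
  (forall n, 0 <= u n) -> 0 <= M -> (forall n, u n `^ r <= M) ->
  ereal_sup (range u) `^ r <= M.
Proof.
move=> r0 u0 M0 H.
have S0 : 0 <= ereal_sup (range u).
  by apply: le_trans (u0 0%N) _; apply: ereal_sup_ubound; exists 0%N.
have {H} : ereal_sup (range u) <= M `^ r^-1.
  by apply: ge_ereal_sup => _ [n _ <-]; exact: poweR_le_inv.
move=> /(le_poweR (ltW r0) S0); rewrite poweRVK// gt_eqF//.
Qed.

End ereal_sup_power.

Section measure_lemmas.
Context d (T : measurableType d) (R : realType).
Variable mu : {measure set T -> \bar R}.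
Local Open Scope ereal_scope.
Implicit Types f : T -> \bar R.

Lemma integral_sup_le (g : (T -> \bar R)^nat) M :
  (forall n, measurable_fun setT (g n)) -> (forall n x, 0 <= g n x) ->
  (forall x, nondecreasing_seq (g^~ x)) -> (forall n, \int[mu]_x g n x <= M) ->
  \int[mu]_x ereal_sup (range (g^~ x)) <= M.
Proof.
move=> mg g0 nd H.
have -> : (fun x => ereal_sup (range (g^~ x))) = (fun x => limn (g^~ x)).
  apply/funext => x; apply/esym/cvg_lim => //.
  exact: ereal_nondecreasing_cvgn.
rewrite monotone_convergence//.
apply: lime_le; last by apply: nearW.
apply: ereal_nondecreasing_is_cvgn => m n mn; apply: ge0_le_integral => //.
by move=> x _; exact: nd.
Qed.

(* Weighted AM-GM against a constant, optimised over the constant. *)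
Lemma integral_poweR_le (E : set T) (l u v : R) f : measurable E ->
  mu E = l%:E -> (0 < l)%R -> (0 < u)%R -> (u < v)%R ->
  measurable_fun setT f -> (forall x, 0 <= f x) -> (forall x, ~ E x -> f x = 0) ->
  \int[mu]_x (f x `^ u) <=
    (l `^ (1 - u / v))%:E * (\int[mu]_x (f x `^ v)) `^ (u / v).
Proof.
move=> mE muE l0 u0 uv mf f0 fE; have v0 : (0 < v)%R by lra.
set I := \int[mu]_x (f x `^ v).
have I0 : 0 <= I by apply: integral_ge0 => x _; exact: poweR_ge0.
have t0 : (0 < u / v)%R by rewrite divr_gt0.
have t1 : (u / v < 1)%R by rewrite ltr_pdivrMr// mul1r.
have mfv : measurable_fun setT (fun x => f x `^ v).
  by have := measurableT_comp (@measurable_poweR R v) mf; apply.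
have [II|Ilty] := eqVneq I +oo.
  rewrite II poweRyr ?gt_eqF// gt0_muley ?leey// lte_fin powR_gt0//.
have young (a L : R) : (0 <= a)%R -> (0 < L)%R ->
    (a `^ u <= (1 - u / v) * L `^ u + u / v * (L `^ (u - v) * a `^ v))%R.
  move=> a0 L0; pose b := (a / L)%R; have b0 : (0 <= b)%R by rewrite divr_ge0// ltW.
  have := @conjugate_powR R (b `^ u)%R 1%R (v / u)%R (1 - u / v)^-1%R (powR_ge0 _ _) ler01.
  rewrite divr_gt0// invr_gt0 subr_gt0 t1 => /(_ isT isT).
  rewrite invf_div invrK addrC subrK => /(_ erefl).
  have E0 : (u * (v / u) = v)%R by field; rewrite gt_eqF.
  rewrite mulr1 -powRrM E0 powR1 mul1r => H.
  have -> : (a = L * b)%R by rewrite /b; field; rewrite gt_eqF.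
  clearbody b.
  rewrite !powRM ?(ltW L0)//.
  have -> : (L `^ (u - v) * (L `^ v * b `^ v) = L `^ u * b `^ v)%R.
    rewrite mulrA -powRD ?subrK// (gt_eqF L0) implybT//.
  apply: (@le_trans _ _ (L `^ u * (b `^ v * (u / v) + (1 - u / v)))%R).
    by rewrite ler_wpM2l ?powR_ge0.
  apply: le_of_eq; field.
  by rewrite !gt_eqF.
have bound (L : R) : (0 < L)%R -> \int[mu]_x (f x `^ u) <=
    ((1 - u / v) * L `^ u * l)%:E + (u / v * L `^ (u - v))%:E * I.
  move=> L0.
  have c1 : (0 < (1 - u / v) * L `^ u)%R by rewrite mulr_gt0 ?powR_gt0// subr_gt0.
  have c2 : (0 < u / v * L `^ (u - v))%R by rewrite mulr_gt0// powR_gt0.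
  apply: (@le_trans _ _ (\int[mu]_x (((1 - u / v) * L `^ u)%:E * (\1_E x)%:E +
      (u / v * L `^ (u - v))%:E * f x `^ v))).
    apply: le_lower_integral => x; first exact: poweR_ge0.
    have [xE|xE] := boolP (x \in E); last first.
      rewrite fE; last by move: xE; rewrite notin_setE.
      by rewrite !poweR0r ?gt_eqF// mule0 adde0 mule_ge0// lee_fin// ltW.
    rewrite indicE xE mule1; move: (f0 x); case: (f x) => [a| |]//.
      rewrite lee_fin => a0; rewrite !poweR_EFin -EFinM -EFinD lee_fin.
      by have := young a L a0 L0; lra.
    by move=> _; rewrite [X in _ * X]poweRyr ?gt_eqF// gt0_muley ?lte_fin// addey ?leey.
  rewrite ge0_integralD//; last 4 first.
  - by move=> x _; rewrite mule_ge0// lee_fin ltW.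
  - apply: measurable_funeM; apply/measurable_EFinP; exact: measurable_indic.
  - by move=> x _; rewrite mule_ge0 ?poweR_ge0// lee_fin ltW.
  - exact: measurable_funeM.
  have E0x x : 0 <= (\1_E x)%:E :> \bar R by rewrite lee_fin.
  have fv0 x : 0 <= f x `^ v by exact: poweR_ge0.
  rewrite (lower_integral_scale _ c1 E0x) (lower_integral_scale _ c2 fv0).
  by rewrite integral_indic// setIT muE -EFinM.
have Ifin : I \is a fin_num by rewrite ge0_fin_numE// ltey.
move: I0 bound; rewrite -(fineK Ifin); move: (fine I) => J; rewrite lee_fin => J0 bound.
rewrite poweR_EFin -EFinM; have [JE|Jn] := eqVneq J 0%R.
  rewrite JE powR0 ?gt_eqF// mulr0; apply/lee_addgt0Pr => e e0; rewrite add0e.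
  pose L := ((e / ((1 - u / v) * l)) `^ u^-1)%R.
  have c0 : (0 < (1 - u / v) * l)%R by rewrite mulr_gt0// subr_gt0.
  have L0 : (0 < L)%R by rewrite powR_gt0// divr_gt0.
  apply: (le_trans (bound L L0)); rewrite JE mule0 adde0 lee_fin.
  rewrite /L -powRrM mulVf ?gt_eqF// powRr1 ?divr_ge0 ?(ltW e0) ?(ltW c0)//.
  apply: le_of_eq; field.
  by rewrite !gt_eqF// subr_gt0.
have {Jn}Jp : (0 < J)%R by rewrite lt_def Jn.
(* The optimal constant: [f] equal to [L] on [E] would have this same v-integral [J]. *)
pose L := ((J / l) `^ v^-1)%R.
have Jl : (0 < J / l)%R by rewrite divr_gt0.
have L0 : (0 < L)%R by rewrite powR_gt0.
apply: (le_trans (bound L L0)); rewrite -EFinM -EFinD lee_fin.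
have LJ : (J = l * L `^ v)%R.
  by rewrite /L -powRrM mulVf ?gt_eqF// powRr1 ?(ltW Jl)//; field; rewrite gt_eqF.
have E1 : (L `^ (u - v) * J = L `^ u * l)%R.
  by rewrite {1}LJ mulrCA -powRD ?subrK 1?mulrC// (gt_eqF L0) implybT.
have E2 : (l `^ (1 - u / v) * J `^ (u / v) = L `^ u * l)%R.
  rewrite {1}LJ powRM ?powR_ge0 ?(ltW l0)// -powRrM mulrA -powRD; last first.
    by rewrite (gt_eqF l0) implybT.
  by rewrite subrK powRr1 ?(ltW l0)// mulrCA divff ?gt_eqF// mulr1 mulrC.
rewrite E2 -mulrA -[(u / v * _ * J)%R]mulrA E1; lra.
Qed.

Lemma Lnorm_embedding (E : set T) (l u : R) (v : \bar R) f : measurable E ->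
  mu E = l%:E -> (0 < l)%R -> (0 < u)%R -> u%:E <= v ->
  measurable_fun setT f -> (forall x, 0 <= f x) -> (forall x, ~ E x -> f x = 0) ->
  Lnorm mu u%:E f <= (l `^ (u^-1 - recip v))%:E * Lnorm mu v f.
Proof.
move=> mE muE l0 u0 uv mf f0 fE; case: v uv => [v| |]//; last first.
  move=> _; rewrite /recip invey /= subr0 Lnorm_fin// unlock.
  have mT : 0 < mu setT.
    apply: (@lt_le_trans _ _ (mu E)); first by rewrite muE lte_fin.
    by apply: le_measure; rewrite ?inE.
  rewrite mT; set M := ess_sup _ _.
  have M0 : 0 <= M by apply: ess_sup_gee => //; apply: nearW => x /=.
  apply: (@le_trans _ _ ((M `^ u * l%:E) `^ u^-1)).
    apply: le_poweR; first by rewrite invr_ge0 ltW.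
      by apply: integral_ge0 => x _; exact: poweR_ge0.
    apply: (@le_trans _ _ (\int[mu]_x (M `^ u * (\1_E x)%:E))).
      apply: le_lower_integral_ae => [x|x|]; first exact: poweR_ge0.
        by rewrite mule_ge0 ?poweR_ge0 ?lee_fin.
      apply: filterS (ess_sup_ge mu (abse \o f)) => x /= fM.
      have [xE|xE] := boolP (x \in E).
        rewrite indicE xE mule1; apply: le_poweR => //; first exact: ltW.
        by rewrite -(gee0_abs (f0 x)).
      rewrite fE; last by move: xE; rewrite notin_setE.
      by rewrite poweR0r ?gt_eqF// mule_ge0 ?poweR_ge0 ?lee_fin.
    have mI : measurable_fun setT (fun x => (\1_E x)%:E : \bar R).
      by apply/measurable_EFinP; exact: measurable_indic.
    have I0 x : [set: T] x -> 0 <= (\1_E x)%:E :> \bar R by rewrite lee_fin.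
    rewrite (ge0_integralZl mu measurableT mI I0) ?poweR_ge0//.
    by rewrite integral_indic// setIT muE.
  rewrite poweRM ?poweR_ge0 ?lee_fin ?(ltW l0)// poweRK ?gt_eqF//.
  by rewrite poweR_EFin muleC.
rewrite lee_fin => uv; have v0 : (0 < v)%R by lra.
have -> : recip v%:E = v^-1%R by rewrite /recip inver gt_eqF.
move: uv; rewrite le_eqVlt => /predU1P[->|uv].
  by rewrite subrr powRr0 mul1e.
rewrite !Lnorm_fin//; have ui0 : (0 <= u^-1)%R by rewrite invr_ge0 ltW.
have L0 g : 0 <= \int[mu]_x (f x `^ g) by apply: integral_ge0 => x _; exact: poweR_ge0.
have := le_poweR ui0 (L0 u) (integral_poweR_le mE muE l0 u0 uv mf f0 fE).
rewrite poweRM ?lee_fin ?powR_ge0 ?poweR_ge0// -poweRrM poweR_EFin -powRrM.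
have -> : ((1 - u / v) / u = u^-1 - v^-1)%R by field; rewrite !gt_eqF.
by have -> : (u / v / u = v^-1)%R by field; rewrite !gt_eqF.
Qed.

End measure_lemmas.

Section tuples.
Context {R : realType}.
Local Open Scope ereal_scope.
Local Notation leb := (@lebesgue_measure R).

Lemma integral_tcons n (f : euclidean R n.+1 -> \bar R) :
  measurable_fun setT f -> (forall x, 0 <= f x) ->
  \int[lebesgue R n.+1]_x f x =
  \int[lebesgue R n]_y \int[leb]_t f (tcons (t, y)).
Proof.
move=> mf f0; have mc := @measurable_tcons _ (measurableTypeR R) n.
transitivity (\int[pushforward (leb \x lebesgue R n) (@tcons (measurableTypeR R) n)]_x f x).
  exact: eq_measure_integral.
rewrite ge0_integral_pushforward// preimage_setT fubini_tonelli2//.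
by apply: (measurableT_comp mf).
by move=> x; exact: f0.
Qed.

Lemma measurable_section n (f : euclidean R n.+1 -> \bar R) y :
  measurable_fun setT f -> measurable_fun setT (fun t => f (tcons (t, y))).
Proof.
move=> mf; apply: (measurableT_comp mf).
by apply: (measurableT_comp (@measurable_tcons _ (measurableTypeR R) n)).
Qed.

Lemma measurable_integral_section n (f : euclidean R n.+1 -> \bar R) :
  measurable_fun setT f -> (forall x, 0 <= f x) ->
  measurable_fun setT (fun y => \int[leb]_t f (tcons (t, y))).
Proof.
move=> mf f0.
apply: (@measurable_fun_fubini_tonelli_G _ _ _ _ _ leb
  (fun z : measurableTypeR R * euclidean R n => f (tcons z))) => //.
exact: (measurableT_comp mf (@measurable_tcons _ (measurableTypeR R) n)).
Qed.

Definition section_norm n (p : \bar R) (f : euclidean R n.+1 -> \bar R)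
    (y : euclidean R n) : \bar R := Lnorm leb p (fun t => f (tcons (t, y))).

Lemma section_norm_ge0 n p (f : euclidean R n.+1 -> \bar R) y : 0 <= section_norm p f y.
Proof. exact: Lnorm_ge0. Qed.

Lemma measurable_section_norm n (r : R) (f : euclidean R n.+1 -> \bar R) :
  measurable_fun setT f -> measurable_fun setT (section_norm r%:E f).
Proof.
move=> mf; rewrite /section_norm unlock.
have := @measurable_integral_section n (fun x => `|f x| `^ r) _ _.
move=> H; have := measurableT_comp (@measurable_poweR R r^-1) (H _ _); apply.
  have := measurableT_comp (@measurable_poweR R r)
    (measurableT_comp (@abse_measurable R setT) mf); apply.
by move=> x; exact: poweR_ge0.
Qed.

End tuples.

Section mixed_norm_theory.
Context {R : realType}.
Local Open Scope ereal_scope.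
Local Notation leb := (@lebesgue_measure R).

Lemma mixed_norm_ge0 n (p : 'I_n -> \bar R) f : 0 <= mixed_norm p f.
Proof. by elim: n p f => [|n IH] p f /=; [exact: abse_ge0|exact: IH]. Qed.

(** By Tonelli, almost every section of the exceptional null set is null, so the one-dimensional
    norms compare for almost every y and the induction goes on. In dimension 0 the measure is a
    point mass, whose only null set is empty. *)
Lemma le_mixed_norm_ae n (p : 'I_n -> \bar R) f g : (forall i, 0 < p i) ->
  (\forall x \ae lebesgue R n, `|f x| <= `|g x|) ->
  mixed_norm p f <= mixed_norm p g.
Proof.
elim: n p f g => [|n IH] p f g p0 /=.
  move=> [N [mN N0 fg]]; apply: contrapT => H; have : N [tuple] by exact: fg.
  by move/mem_set => NN; move: N0; rewrite /= diracE NN => -[] /eqP; rewrite oner_eq0.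
move=> [N [mN N0 fg]]; apply: IH => [i|]; first exact: p0.
have mI : measurable_fun setT (fun x : euclidean R n.+1 => (\1_N x)%:E : \bar R).
  by apply/measurable_EFinP; exact: measurable_indic.
have I0 x : 0 <= (\1_N x)%:E :> \bar R by rewrite lee_fin.
have : \int[lebesgue R n.+1]_x (\1_N x)%:E = 0.
  by rewrite integral_indic// setIT.
rewrite integral_tcons// => Z.
have {}Z : \int[lebesgue R n]_y `|\int[leb]_t (\1_N (tcons (t, y)))%:E| = 0.
  by rewrite -[RHS]Z; apply: eq_integral => y _; rewrite gee0_abs// integral_ge0.
have mG := measurable_integral_section mI I0.
have := (ae_eq_integral_abs (lebesgue R n) measurableT mG).1 Z.
apply: filterS => y /(_ I) /= {}Z.
rewrite !gee0_abs ?Lnorm_ge0//; apply: le_Lnorm_ae => //.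
have Z' : \int[leb]_t `|(\1_N (tcons (t, y)))%:E| = 0.
  by rewrite -[RHS]Z; apply: eq_integral => t _; rewrite gee0_abs// lee_fin.
have := (ae_eq_integral_abs leb measurableT (measurable_section y mI)).1 Z'.
apply: filterS => t /(_ I) /= [Nt]; apply: contrapT => H.
have : N (tcons (t, y)) by apply: fg.
by move/mem_set => NN; move: Nt; rewrite indicE NN => /eqP; rewrite oner_eq0.
Qed.

Lemma le_mixed_norm n (p : 'I_n -> \bar R) f g : (forall i, 0 < p i) ->
  (forall x, `|f x| <= `|g x|) -> mixed_norm p f <= mixed_norm p g.
Proof. by move=> p0 fg; apply: le_mixed_norm_ae => //; exact: nearW. Qed.

Lemma mixed_norm_scale n (p : 'I_n -> \bar R) f c : (forall i, 0 < p i) ->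
  (0 < c)%R -> mixed_norm p (fun x => c%:E * f x) = c%:E * mixed_norm p f.
Proof.
move=> + c0; elim: n p f => [|n IH] p f p0 /=.
  by rewrite abseM gee0_abs// lee_fin ltW.
rewrite -IH; last by move=> i; exact: p0.
by congr mixed_norm; apply/funext => y; rewrite Lnorm_scale.
Qed.

Lemma mixed_norm1 n (f : euclidean R n -> \bar R) :
  measurable_fun setT f -> (forall x, 0 <= f x) ->
  mixed_norm (fun=> 1%:E) f = \int[lebesgue R n]_x f x.
Proof.
elim: n f => [|n IH] f mf f0 /=.
  by rewrite integral_dirac// diracT mul1e gee0_abs.
rewrite integral_tcons// -IH; last 2 first.
- exact: measurable_integral_section.
- by move=> y; apply: integral_ge0.
congr mixed_norm; apply/funext => y; rewrite Lnorm1.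
by apply: eq_integral => t _; rewrite gee0_abs.
Qed.

Lemma mixed_norm_add_le n (q : 'I_n -> R) : (forall i, 0 < q i)%R ->
  exists2 C : R, (0 < C)%R &
  forall f g, measurable_fun setT f -> measurable_fun setT g ->
    (forall x, 0 <= f x) -> (forall x, 0 <= g x) ->
    mixed_norm (fun i => (q i)%:E) (fun x => f x + g x) <=
    C%:E * (mixed_norm (fun i => (q i)%:E) f + mixed_norm (fun i => (q i)%:E) g).
Proof.
elim: n q => [|n IH] q q0.
  exists 1%R => // f g _ _ f0 g0 /=; rewrite mul1e !gee0_abs//.
  exact: adde_ge0.
have [C C0 H] := IH (fun i => q (lift ord0 i)) (fun i => q0 _).
pose c := (2 `^ (1 + (q ord0)^-1))%R; have c0 : (0 < c)%R by exact: powR_gt0.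
exists (c * C)%R => [|f g mf mg f0 g0]; first exact: mulr_gt0.
have p0 i : 0 < (q (lift ord0 i))%:E by rewrite lte_fin.
pose F := section_norm (q ord0)%:E f; pose G := section_norm (q ord0)%:E g.
rewrite EFinM -muleA; apply: (@le_trans _ _ (mixed_norm (fun i => (q (lift ord0 i))%:E)
    (fun y => c%:E * (F y + G y)))).
  apply: le_mixed_norm => // y; rewrite !gee0_abs ?Lnorm_ge0//; last first.
    by rewrite mule_ge0 ?lee_fin ?(ltW c0)// adde_ge0 ?section_norm_ge0.
  by apply: Lnorm_add_le => //; exact: measurable_section.
rewrite mixed_norm_scale//; apply: lee_wpmul2l; first by rewrite lee_fin ltW.
by apply: H => *; try exact: section_norm_ge0; exact: measurable_section_norm.
Qed.

(** The Fatou property of mixed norms. The section norms of the [V j] increase again and are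
    measurable because the exponents are real; by monotone convergence their supremum bounds the
    section norm of [G], which is only compared through lower integrals. *)
Lemma mixed_norm_sup_le n (q : 'I_n -> R) (V : (euclidean R n -> \bar R)^nat) G M :
  (forall i, 0 < q i)%R ->
  (forall j, measurable_fun setT (V j)) -> (forall j x, 0 <= V j x) ->
  (forall x, nondecreasing_seq (V^~ x)) ->
  (forall x, 0 <= G x) -> (forall x, G x <= ereal_sup (range (V^~ x))) ->
  (forall j, mixed_norm (fun i => (q i)%:E) (V j) <= M) ->
  mixed_norm (fun i => (q i)%:E) G <= M.
Proof.
elim: n q V G M => [|n IH] q V G M q0 mV V0 nd G0 GV H.
  rewrite /= gee0_abs//; apply: le_trans (GV _) _.
  apply: ge_ereal_sup => _ [j _ <-]; apply: le_trans (H j).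
  by rewrite /= gee0_abs.
apply: (IH _ (fun j => section_norm (q ord0)%:E (V j))).
- by move=> i; exact: q0.
- by move=> j; exact: measurable_section_norm.
- by move=> j y; exact: section_norm_ge0.
- move=> y i j ij; apply: le_Lnorm; first by rewrite lte_fin.
  by move=> t; rewrite !gee0_abs//; exact: nd.
- by move=> y; exact: Lnorm_ge0.
- move=> y; set S := ereal_sup _.
  have S0 : 0 <= S.
    apply: le_trans (section_norm_ge0 (q ord0)%:E (V 0%N) y) _.
    by apply: ereal_sup_ubound; exists 0%N.
  have qi0 : (0 < (q ord0)^-1)%R by rewrite invr_gt0.
  rewrite Lnorm_fin//.
  rewrite -[leRHS](@poweRK _ (q ord0)) ?gt_eqF//; apply: le_poweR.
  + exact: ltW.
  + by apply: integral_ge0 => t _; exact: poweR_ge0.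
  pose W j t := V j (tcons (t, y)) `^ q ord0.
  apply: (@le_trans _ _ (\int[leb]_t ereal_sup (range (W^~ t)))).
    apply: le_lower_integral => t; first exact: poweR_ge0.
    apply: (@le_trans _ _ (ereal_sup (range (V^~ (tcons (t, y)))) `^ q ord0)).
      by apply: le_poweR => //; exact: ltW.
    apply: ereal_sup_poweR_le => //.
      apply: le_trans (poweR_ge0 (V 0%N (tcons (t, y))) (q ord0)) _.
      by apply: ereal_sup_ubound; exists 0%N.
    by move=> j; apply: ereal_sup_ubound; exists j.
  apply: integral_sup_le.
  + move=> j; have := measurableT_comp (@measurable_poweR R (q ord0))
      (measurable_section y (mV j)); apply.
  + by move=> j t; exact: poweR_ge0.
  + move=> t i j ij; apply: le_poweR => //; [exact: ltW|exact: nd].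
  + move=> j; have <- := @poweRVK _ (q ord0) (\int[leb]_t W j t).
    * apply: le_poweR; [exact: ltW|exact: poweR_ge0|].
      rewrite -Lnorm_fin//; apply: ereal_sup_ubound; exists j => //.
    * by rewrite gt_eqF.
    * by apply: integral_ge0 => t _; exact: poweR_ge0.
- exact: H.
Qed.

(** Hoelder's inequality in one coordinate after the other. The induction runs on section norms at
    the real exponents [u], which are measurable; the possibly infinite [v] enter only through the
    one-dimensional embedding and monotonicity. *)
Lemma mixed_norm_embedding n (u : 'I_n -> R) (v : 'I_n -> \bar R) (r : R) f :
  (0 < r)%R -> (forall i, 0 < u i)%R -> (forall i, (u i)%:E <= v i) ->
  measurable_fun setT f -> (forall x, 0 <= f x) ->
  (forall x, ~ cube (origin R n) r x -> f x = 0) ->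
  mixed_norm (fun i => (u i)%:E) f <=
  ((2 * r) `^ (\sum_i ((u i)^-1 - recip (v i))))%:E * mixed_norm v f.
Proof.
move=> r0; elim: n u v f => [|n IH] u v f u0 uv mf f0 fE.
  by rewrite big_ord0 powRr0 mul1e.
rewrite big_ord_recl powRD; last by rewrite (gt_eqF (_ : 0 < 2 * r)%R) ?implybT// mulr_gt0.
have r2 : (0 < 2 * r)%R by rewrite mulr_gt0.
set c := (_ `^ ((u ord0)^-1 - _))%R; have c0 : (0 < c)%R by exact: powR_gt0.
have v0 i : 0 < v i by apply: lt_le_trans (uv i); rewrite lte_fin.
pose g := section_norm (u ord0)%:E f.
have out t y : ~ cube (origin R n) r y -> f (tcons (t, y)) = 0.
  move=> cy; apply: fE => cx; apply: cy => i.
  by have := cx (lift ord0 i); rewrite /origin !tnth_mktuple /tcons tnthS.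
apply: (le_trans (IH _ (fun i => v (lift ord0 i)) g _ _ _ _ _)).
- by move=> i; exact: u0.
- by move=> i; exact: uv.
- exact: measurable_section_norm.
- by move=> y; exact: section_norm_ge0.
- move=> y cy; rewrite /g /section_norm.
  under eq_fun do rewrite out//.
  by rewrite Lnorm0// eqe gt_eqF.
rewrite EFinM [c%:E * _]muleC -muleA; apply: lee_wpmul2l.
  by rewrite lee_fin powR_ge0.
rewrite -[mixed_norm v f]/(mixed_norm (fun i => v (lift ord0 i)) (section_norm (v ord0) f)).
rewrite -(@mixed_norm_scale n)//; apply: le_mixed_norm => // y.
rewrite !gee0_abs ?Lnorm_ge0 ?mule_ge0 ?lee_fin ?(ltW c0) ?Lnorm_ge0//.
have mE : measurable (`](- r)%R, r[%classic : set (measurableTypeR R)) by [].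
have lE : leb `](- r)%R, r[%classic = (2 * r)%:E.
  by rewrite lebesgue_measure_itv /= lte_fin gtrN// -EFinD opprK mulr2n mulrDl mul1r.
have := @Lnorm_embedding _ _ _ leb _ _ _ (v ord0) (fun t => f (tcons (t, y)))
  mE lE r2 (u0 ord0) (uv ord0); apply => //.
- exact: measurable_section.
move=> t tr; apply: fE => /(_ ord0).
rewrite /origin tnth_mktuple /tcons tnth0 subr0 ltr_norml => H.
by apply: tr; rewrite /= in_itv.
Qed.

End mixed_norm_theory.

(** * Grids *)

Section cells.
Context {R : realType}.
Implicit Types (a h t : R).

Definition gcell a h (i : nat) : set (measurableTypeR R) :=
  [set t | a + i%:R * h <= t < a + i.+1%:R * h].

(** For t < a and h > 0 the quotient is negative and [truncn] returns 0, whence the condition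
    [a <= t] in the lemmas. *)
Definition cell_index a h t : nat := Num.truncn ((t - a) / h).

Lemma gcellE a h i : gcell a h i = `[a + i%:R * h, a + i.+1%:R * h[%classic.
Proof. by apply/seteqP; split => t; rewrite /gcell /= in_itv. Qed.

Lemma measurable_gcell a h i : measurable (gcell a h i).
Proof. by rewrite gcellE; exact: measurable_itv. Qed.

Lemma measurable_indic_gcell a h i :
  measurable_fun setT (fun t => (\1_(gcell a h i) t)%:E : \bar R).
Proof.
apply/measurable_EFinP; apply: measurable_indic; exact: measurable_gcell.
Qed.

Lemma lebesgue_gcell a h i : 0 < h -> lebesgue_measure (gcell a h i) = h%:E.
Proof.
move=> h0; rewrite gcellE lebesgue_measure_itv /= lte_fin ltrD2l.
rewrite ltr_pM2r// ltr_nat ltnSn -EFinD; congr EFin.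
by rewrite -natr1; ring.
Qed.

Lemma gcell_index a h t i : 0 < h -> a <= t ->
  gcell a h i t <-> cell_index a h t = i.
Proof.
move=> h0 at_; have x0 : 0 <= (t - a) / h by rewrite divr_ge0 ?subr_ge0// ltW.
have := truncn_eq i x0; rewrite ler_pdivlMr// ltr_pdivrMr// => E.
rewrite /gcell /cell_index /= -lerBrDl -ltrBlDl -E.
by split => [/eqP//|->].
Qed.

Lemma gcell_ge a h t i : 0 < h -> gcell a h i t -> a <= t.
Proof.
by move=> h0 /andP[+ _]; apply: le_trans; rewrite lerDl mulr_ge0// ltW.
Qed.

(** Grids with a common offset are nested, and the coarse index is the quotient of the fine one:
    this is what matches boxes with the averages [cell_avg]. *)
Lemma gcell_block a h t k i : 0 < h ->
  gcell a ((2 ^ k)%:R * h) i t <->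
  a <= t /\ (cell_index a h t %/ 2 ^ k)%N = i.
Proof.
move=> h0; have kh0 : 0 < (2 ^ k)%:R * h by rewrite mulr_gt0// pow2_gt0.
have p0 : (0 < 2 ^ k)%N by rewrite expn_gt0.
have K (at_ : a <= t) :
    cell_index a ((2 ^ k)%:R * h) t = (cell_index a h t %/ 2 ^ k)%N.
  have [/andP[lo hi]] := (gcell_index (cell_index a h t) h0 at_).2 erefl.
  apply/(gcell_index _ kh0 at_); set m := cell_index a h t in lo hi *.
  apply/andP; split.
    apply: le_trans lo; rewrite lerD2l mulrA ler_pM2r// -natrM ler_nat.
    exact: leq_trunc_div.
  apply: (lt_le_trans hi); rewrite lerD2l mulrA ler_pM2r// -natrM ler_nat.
  by rewrite ltn_ceil.
split=> [ct|[at_ <-]].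
  have at_ := gcell_ge kh0 ct; split => //; rewrite -K//.
  exact/gcell_index.
by apply/(gcell_index _ kh0 at_); exact: K.
Qed.

Definition in_range a h (X : nat) t := (a <= t) && (t < a + X%:R * h).

Lemma in_range_index a h X t : 0 < h -> in_range a h X t ->
  (cell_index a h t < X)%N.
Proof.
move=> h0 /andP[at_ tX]; have x0 : 0 <= (t - a) / h by rewrite divr_ge0 ?subr_ge0// ltW.
by rewrite /cell_index truncn_lt_nat// ltr_pdivrMr// ltrBlDl.
Qed.

Lemma gcell_in_range a h X t i : 0 < h -> (i < X)%N -> gcell a h i t ->
  in_range a h X t.
Proof.
move=> h0 iX ct; rewrite /in_range (gcell_ge h0 ct)/=.
move: ct => /andP[_ /lt_le_trans]; apply; rewrite lerD2l ler_pM2r//.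
by rewrite ler_nat.
Qed.

Lemma sum_gcell a h X (b : nat -> R) t : 0 < h ->
  \sum_(i < X) b i * \1_(gcell a h i) t =
  if in_range a h X t then b (cell_index a h t) else 0.
Proof.
move=> h0; case: ifPn => tX.
  have iX := in_range_index h0 tX; have /andP[at_ _] := tX.
  rewrite (bigD1 (Ordinal iX))//= big1 ?addr0.
    by rewrite indicE mem_set ?mulr1//; exact/gcell_index.
  move=> i ii; rewrite indicE memNset ?mulr0// => /(gcell_index _ h0 at_) E.
  by move/eqP: ii; apply; apply/val_inj => /=.
apply: big1 => i _; rewrite indicE memNset ?mulr0// => H.
by move/negP: tX; apply; apply: gcell_in_range H.
Qed.

Lemma trivIset_gcell a h : 0 < h -> trivIset setT (gcell a h).
Proof.
move=> h0; apply/trivIsetP => i j _ _ ij; apply/seteqP; split => // t [ti tj].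
have at_ := gcell_ge h0 ti; move/eqP: ij; apply.
by move/(gcell_index _ h0 at_): ti => <-; apply/(gcell_index _ h0 at_).
Qed.

End cells.

Section step_functions.
Context {R : realType}.
Local Notation leb := (@lebesgue_measure R).

Definition tail (T : Type) n (a : 'I_n.+1 -> T) : 'I_n -> T := fun i => a (lift ord0 i).

Definition exps (T : Type) n (p : 'I_n -> T) : seq T := [seq p i | i <- enum 'I_n].

Lemma expsS T n (p : 'I_n.+1 -> T) : exps p = p ord0 :: exps (tail p).
Proof. by rewrite /exps enum_ordSl /= -map_comp. Qed.

Lemma exps0 T (p : 'I_0 -> T) : exps p = [::].
Proof. by rewrite /exps enum_ord0. Qed.

Fixpoint in_grid h X n : ('I_n -> R) -> euclidean R n -> bool :=
  match n with
  | 0 => fun _ _ => true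
  | m.+1 => fun a x => in_range (a ord0) h X (thead x) &&
                       in_grid h X (tail a) [tuple of behead x]
  end.

Fixpoint grid_index h n : ('I_n -> R) -> euclidean R n -> seq nat :=
  match n with
  | 0 => fun _ _ => [::]
  | m.+1 => fun a x => cell_index (a ord0) h (thead x) ::
                       grid_index h (tail a) [tuple of behead x]
  end.

Definition step_fun h X n (a : 'I_n -> R) (c : seq nat -> R) (x : euclidean R n) : R :=
  if in_grid h X a x then c (grid_index h a x) else 0.

Lemma behead_tcons (T : Type) n (t : T) (y : n.-tuple T) :
  [tuple of behead (tcons (t, y))] = y.
Proof. exact: val_inj. Qed.

Lemma step_fun_tcons h X n (a : 'I_n.+1 -> R) c t (y : euclidean R n) : 0 < h ->
  step_fun h X a c (tcons (t, y)) =
  \sum_(i < X) step_fun h X (tail a) (fun s => c (nat_of_ord i :: s)) y *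
     \1_(gcell (a ord0) h i) t.
Proof.
move=> h0; rewrite (sum_gcell _ _ (fun i => step_fun h X (tail a)
  (fun s => c (i :: s)) y))// /step_fun /= behead_tcons.
by case: (in_range _ _ _ _).
Qed.

Lemma step_fun_ge0 h X n (a : 'I_n -> R) c x :
  (forall s, 0 <= c s) -> 0 <= step_fun h X a c x.
Proof. by move=> c0; rewrite /step_fun; case: ifP. Qed.

Lemma measurable_step_fun h X n (a : 'I_n -> R) c : 0 < h ->
  measurable_fun setT (step_fun h X a c).
Proof.
move=> h0; elim: n a c => [|n IH] a c.
  by rewrite (_ : step_fun _ _ _ _ = cst (c [::]))//; exact: measurable_cst.
rewrite (_ : step_fun h X a c = fun x => \sum_(i < X)
    step_fun h X (tail a) (fun s => c (nat_of_ord i :: s)) [tuple of behead x] *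
    \1_(gcell (a ord0) h i) (thead x)); last first.
  apply/funext => x; rewrite -step_fun_tcons//; congr step_fun.
  by rewrite [LHS]tuple_eta; apply: val_inj.
apply: measurable_sum => i; apply: measurable_funM.
  by apply: (measurableT_comp (IH _ _)); exact: measurable_behead.
have mi : measurable_fun setT (\1_(gcell (a ord0) h i) : measurableTypeR R -> R).
  by apply: measurable_indic; exact: measurable_gcell.
have := measurableT_comp mi (@measurable_tnth _ (measurableTypeR R) n.+1 ord0); apply.
Qed.

Lemma section_norm_step h X n (q : R) (a : 'I_n.+1 -> R) c (y : euclidean R n) :
  0 < h -> 0 < q -> (forall s, 0 <= c s) ->
  section_norm q%:E (EFin \o step_fun h X a c) y =
  (h `^ q^-1 * step_fun h X (tail a) (fun s => lp X q (fun i => c (i :: s))) y)%:E.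
Proof.
move=> h0 q0 c0; rewrite /section_norm Lnorm_fin//; last first.
  by move=> t; rewrite lee_fin step_fun_ge0.
pose b i := step_fun h X (tail a) (fun s => c (i :: s)) y.
have b0 i : 0 <= b i by exact: step_fun_ge0.
have E t : ((EFin \o step_fun h X a c) (tcons (t, y)) `^ q =
    \sum_(i < X) (b i `^ q)%:E * (\1_(gcell (a ord0) h i) t)%:E)%E.
  rewrite /= step_fun_tcons// (sum_gcell _ _ b)//.
  under eq_bigr do rewrite -EFinM.
  rewrite sumEFin (sum_gcell _ _ (fun i => b i `^ q))//; congr EFin.
  by case: ifP => // _; rewrite powR0// gt_eqF.
under eq_fun do rewrite E.
rewrite ge0_integral_sum//; last 2 first.
- move=> i; by apply: measurable_funeM; exact: measurable_indic_gcell.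
- by move=> i t _; rewrite -EFinM lee_fin mulr_ge0 ?powR_ge0.
rewrite (eq_bigr (fun i : 'I_X => (b i `^ q * h)%:E)); last first.
  move=> i _; rewrite ge0_integralZl_EFin ?powR_ge0//; last first.
    exact: measurable_indic_gcell.
  rewrite integral_indic//; last exact: measurable_gcell.
  by rewrite setIT [X in (_ * X)%E]lebesgue_gcell.
rewrite sumEFin poweR_EFin -mulr_suml mulrC powRM ?(ltW h0)//; last first.
  by apply: sumr_ge0 => i _; exact: powR_ge0.
congr (_ * _)%:E; rewrite /b /step_fun; case: ifP => // _.
rewrite big1 ?powR0 ?invr_eq0 ?gt_eqF// => i _; rewrite powR0// gt_eqF//.
Qed.

Lemma mixed_norm_step h X n (q a : 'I_n -> R) c : 0 < h ->
  (forall i, 0 < q i) -> (forall s, 0 <= c s) ->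
  mixed_norm (fun i => (q i)%:E) (EFin \o step_fun h X a c) =
  (h `^ (\sum_i (q i)^-1) * dmix X (exps q) c)%:E.
Proof.
move=> h0; elim: n q a c => [|n IH] q a c q0 c0.
  by rewrite big_ord0 powRr0 mul1r exps0 /= ger0_norm// c0.
rewrite /= big_ord_recl expsS /=.
rewrite (_ : (fun y => _) = (fun y => (h `^ (q ord0)^-1)%:E *
  (step_fun h X (tail a) (fun s => lp X (q ord0) (fun i => c (i :: s))) y)%:E))%E; last first.
  by apply/funext => y; rewrite -EFinM -section_norm_step.
rewrite mixed_norm_scale ?powR_gt0//; last by move=> i; rewrite lte_fin.
rewrite (IH (tail q) (tail a) _ (fun i => q0 _)); last by move=> s; exact: lp_ge0.
rewrite -EFinM mulrA -powRD//.
by rewrite (gt_eqF h0) implybT.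
Qed.

End step_functions.

(** * Cell integrals and their contraction in mixed norms *)

Section ereal_lp.
Context {R : realType}.
Local Open Scope ereal_scope.
Implicit Types (X : nat) (p : R) (c e : nat -> \bar R).

(** [lp] with extended values, because the cell integrals of an arbitrary nonnegative function may
    be infinite. *)
Definition elp X p c : \bar R := (\sum_(i < X) c i `^ p) `^ p^-1.

Lemma elp_ge0 X p c : 0 <= elp X p c.
Proof. exact: poweR_ge0. Qed.

Let sum_ge0 X p c : 0 <= \sum_(i < X) c i `^ p.
Proof. by apply: sume_ge0 => i _; exact: poweR_ge0. Qed.

Lemma le_elp X p c e : (0 < p)%R -> (forall i, 0 <= c i) ->
  (forall i, c i <= e i) -> elp X p c <= elp X p e.
Proof.
move=> p0 c0 cd; apply: le_poweR => //; first by rewrite invr_ge0 ltW.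
by apply: lee_sum => i _; apply: le_poweR => //; exact: ltW.
Qed.

Lemma elp_scale X p (k : R) c : (0 < p)%R -> (0 <= k)%R -> (forall i, 0 <= c i) ->
  elp X p (fun i => k%:E * c i) = k%:E * elp X p c.
Proof.
move=> p0 k0 c0; rewrite /elp; under eq_bigr do rewrite poweRM//.
rewrite -ge0_sume_distrr; last by move=> i _; exact: poweR_ge0.
by rewrite poweRM ?poweR_ge0// poweRK ?gt_eqF// lee_fin.
Qed.

Lemma elp_EFin X p (c : nat -> R) : elp X p (EFin \o c) = (lp X p c)%:E.
Proof.
rewrite /elp /lp -poweR_EFin; congr (_ `^ _).
by rewrite -sumEFin; apply: eq_bigr => i _.
Qed.

Lemma elp_ge X p c i : (0 < p)%R -> (forall i, 0 <= c i) -> (i < X)%N ->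
  c i <= elp X p c.
Proof.
move=> p0 c0 iX; rewrite -[leLHS](@poweRK _ p) ?gt_eqF//; apply: le_poweR.
- by rewrite invr_ge0 ltW.
- exact: poweR_ge0.
rewrite (bigD1 (Ordinal iX))//= leeDl// sume_ge0// => j _; exact: poweR_ge0.
Qed.

Fixpoint edmix X (ps : seq R) (F : seq nat -> \bar R) : \bar R :=
  if ps is p :: ps' then edmix X ps' (fun s => elp X p (fun i => F (i :: s)))
  else F [::].

Lemma le_edmix X ps F G : all (fun p => 0 < p)%R ps ->
  (forall s, 0 <= F s) -> (forall s, F s <= G s) -> edmix X ps F <= edmix X ps G.
Proof.
elim: ps F G => [|p ps IH] F G /=; first by move=> _ _; apply.
move=> /andP[p0 ps0] F0 FG; apply: (IH _ _ ps0) => s; first exact: elp_ge0.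
exact: le_elp.
Qed.

Lemma edmix_scale X ps (k : R) F : all (fun p => 0 < p)%R ps -> (0 <= k)%R ->
  (forall s, 0 <= F s) -> edmix X ps (fun s => k%:E * F s) = k%:E * edmix X ps F.
Proof.
elim: ps F => [//|p ps IH] F /= /andP[p0 ps0] k0 F0.
rewrite -(IH _ ps0 k0); last by move=> s; exact: elp_ge0.
by congr edmix; apply/funext => s; rewrite elp_scale.
Qed.

Lemma edmix_EFin X ps (F : seq nat -> R) :
  edmix X ps (EFin \o F) = (dmix X ps F)%:E.
Proof.
elim: ps F => [//|p ps IH] F /=; rewrite -IH; congr edmix.
by apply/funext => s; exact: elp_EFin.
Qed.

(* Minkowski's inequality for a finite family, by testing against the dual
   vector of the left-hand side. *)
Lemma elp_integral_le d (T : measurableType d) (mu : {measure set T -> \bar R})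
    (D : set T) X p (g : nat -> T -> \bar R) : (1 < p)%R -> measurable D ->
  (forall i, measurable_fun setT (g i)) -> (forall i x, 0 <= g i x) ->
  elp X p (fun i => \int[mu]_(x in D) g i x) <=
  \int[mu]_(x in D) elp X p (fun i => g i x).
Proof.
move=> p1 mD mg g0; have p0 : (0 < p)%R by lra.
set G := fun x => elp X p (fun i => g i x).
have G0 x : 0 <= G x by exact: elp_ge0.
have mG : measurable_fun setT G.
  have ms : measurable_fun setT (fun x => \sum_(i < X) g i x `^ p).
    apply: emeasurable_sum => i.
    by have := measurableT_comp (@measurable_poweR R p) (mg i); apply.
  by have := measurableT_comp (@measurable_poweR R p^-1) ms; apply.
have [->|GN] := eqVneq (\int[mu]_(x in D) G x) +oo; first exact: leey.
have mgD i : measurable_fun D (g i) by exact: measurable_funTS.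
have Glty : \int[mu]_(x in D) G x < +oo by rewrite ltey.
pose A i := \int[mu]_(x in D) g i x.
have A0 i : 0 <= A i by apply: integral_ge0.
have Afin (i : nat) : (i < X)%N -> A i \is a fin_num.
  move=> iX; rewrite ge0_fin_numE//; apply: le_lt_trans Glty.
  apply: ge0_le_integral => //; first exact: measurable_funTS.
  by move=> x _; apply: (@elp_ge X p (fun i => g i x)).
pose a i := fine (A i).
have a0 i : (0 <= a i)%R by exact: fine_ge0.
have EA : elp X p A = (lp X p a)%:E.
  rewrite -elp_EFin /elp; congr (_ `^ _); apply: eq_bigr => i _.
  by rewrite -[in LHS](fineK (Afin i (ltn_ord i))).
rewrite -/A EA.
have [L0|LN] := eqVneq (lp X p a) 0%R; first by rewrite L0; apply: integral_ge0 => x _; exact: G0.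
have Lp : (0 < lp X p a)%R by rewrite lt_def LN lp_ge0.
have Lpp : (0 < lp X p a `^ (p - 1))%R by exact: powR_gt0.
rewrite -(@lee_pmul2l _ (lp X p a `^ (p - 1))%:E) ?lte_fin//.
rewrite -EFinM powR_mulD ?(ltW Lp)// lp_powR//.
rewrite -ge0_integralZl_EFin ?(ltW Lpp)//; last exact: measurable_funTS.
apply: (@le_trans _ _ (\int[mu]_(x in D) \sum_(i < X) (a i `^ (p - 1))%:E * g i x)).
  rewrite ge0_integral_sum//; last 2 first.
  - by move=> i; apply: measurable_funeM.
  - by move=> i x _; rewrite mule_ge0// lee_fin powR_ge0.
  rewrite -sumEFin; apply: lee_sum => i _.
  rewrite ge0_integralZl_EFin ?powR_ge0//.
  by rewrite -(powR_mulD (a0 i) p0) EFinM /a fineK ?Afin.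
apply: ge0_le_integral => //.
- by move=> x _; apply: sume_ge0 => i _; rewrite mule_ge0// lee_fin powR_ge0.
- by apply: emeasurable_sum => i; exact: measurable_funeM.
- by apply: measurable_funeM; exact: measurable_funTS.
move=> x _; rewrite -/(G x); have [->|GxN] := eqVneq (G x) +oo.
  by rewrite gt0_muley ?leey// lte_fin.
have gfin (i : nat) : (i < X)%N -> g i x \is a fin_num.
  move=> iX; rewrite ge0_fin_numE//.
  apply: (@le_lt_trans _ _ (G x)); last by rewrite ltey.
  exact: (@elp_ge X p (fun i => g i x)).
pose b i := fine (g i x); have b0 i : (0 <= b i)%R by exact: fine_ge0.
have -> : G x = (lp X p b)%:E.
  rewrite -elp_EFin /G /elp; congr (_ `^ _); apply: eq_bigr => i _.
  by rewrite -[in LHS](fineK (gfin i (ltn_ord i))).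
rewrite (eq_bigr (fun i : 'I_X => (a i `^ (p - 1) * b i)%:E)); last first.
  by move=> i _; rewrite EFinM /b fineK// gfin.
by rewrite sumEFin -EFinM lee_fin; exact: lp_holder.
by move=> x _; exact: G0.
Qed.

End ereal_lp.

Section cell_integrals.
Context {R : realType}.
Local Open Scope ereal_scope.
Local Notation leb := (@lebesgue_measure R).

(** Peels off the first coordinate, as [mixed_norm] does. Through [head 0%N] and [behead] an index
    [s] that is too short counts as completed by zeros. *)
Fixpoint cell_int (h : R) n : ('I_n -> R) -> (euclidean R n -> \bar R) ->
    seq nat -> \bar R :=
  match n with
  | 0 => fun _ f _ => f [tuple]
  | m.+1 => fun a f s => cell_int h (tail a)
      (fun y => \int[leb]_(t in gcell (a ord0) h (head 0%N s)) f (tcons (t, y)))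
      (behead s)
  end.

Let patch_section n (f : euclidean R n.+1 -> \bar R) (a h : R) i :=
  fun x : euclidean R n.+1 => f x * (\1_(gcell a h i) (thead x))%:E.

Lemma cell_sectionE n (f : euclidean R n.+1 -> \bar R) (a h : R) i y :
  \int[leb]_(t in gcell a h i) f (tcons (t, y)) =
  \int[leb]_t (f (tcons (t, y)) * (\1_(gcell a h i) t)%:E).
Proof.
rewrite integral_mkcond; apply: eq_integral => t _.
by rewrite epatch_indic.
Qed.

Let measurable_patch_section n (f : euclidean R n.+1 -> \bar R) (a h : R) i :
  measurable_fun setT f -> measurable_fun setT (patch_section f a h i).
Proof.
move=> mf; apply: emeasurable_funM => //.
have := measurableT_comp (measurable_indic_gcell a h i)
  (@measurable_tnth _ (measurableTypeR R) n.+1 ord0); apply.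
Qed.

Lemma measurable_cell_section n (f : euclidean R n.+1 -> \bar R) (a h : R) i :
  measurable_fun setT f -> (forall x, 0 <= f x) ->
  measurable_fun setT (fun y => \int[leb]_(t in gcell a h i) f (tcons (t, y))).
Proof.
move=> mf f0; under eq_fun do rewrite cell_sectionE.
apply: (measurable_integral_section (measurable_patch_section a h i mf)) => x.
by rewrite mule_ge0// lee_fin.
Qed.

Lemma cell_section_ge0 n (f : euclidean R n.+1 -> \bar R) (a h : R) i y :
  (forall x, 0 <= f x) -> 0 <= \int[leb]_(t in gcell a h i) f (tcons (t, y)).
Proof. by move=> f0; apply: integral_ge0. Qed.

Lemma cell_int_ge0 h n (a : 'I_n -> R) f s : (forall x, 0 <= f x) ->
  0 <= cell_int h a f s.
Proof.
elim: n a f s => [|n IH] a f s f0 /=; first exact: f0.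
by apply: IH => y; apply: integral_ge0.
Qed.

Lemma le_cell_int h n (a : 'I_n -> R) f g s :
  measurable_fun setT f -> measurable_fun setT g -> (forall x, 0 <= f x) ->
  (forall x, f x <= g x) -> cell_int h a f s <= cell_int h a g s.
Proof.
elim: n a f g s => [|n IH] a f g s mf mg f0 fg /=; first exact: fg.
have g0 x : 0 <= g x by exact: le_trans (fg x).
apply: IH => [|||y]; try exact: measurable_cell_section.
  by move=> y; exact: cell_section_ge0.
apply: ge0_le_integral => //; first exact: measurable_gcell.
- by apply: measurable_funTS; exact: measurable_section.
- by apply: measurable_funTS; exact: measurable_section.
Qed.

Lemma cell_int_scale h n (a : 'I_n -> R) f s (k : R) :
  measurable_fun setT f -> (forall x, 0 <= f x) -> (0 <= k)%R ->
  cell_int h a (fun x => k%:E * f x) s = k%:E * cell_int h a f s.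
Proof.
elim: n a f s => [//|n IH] a f s mf f0 k0 /=.
rewrite -IH//; last 2 first.
- exact: measurable_cell_section.
- by move=> y; exact: cell_section_ge0.
congr cell_int; apply/funext => y; rewrite ge0_integralZl_EFin//.
- exact: measurable_gcell.
- by apply: measurable_funTS; exact: measurable_section.
Qed.

Lemma cell_int_sum h n (a : 'I_n -> R) (X : nat) (g : nat -> euclidean R n -> \bar R) s :
  (forall i, measurable_fun setT (g i)) -> (forall i x, 0 <= g i x) ->
  cell_int h a (fun x => \sum_(i < X) g i x) s = \sum_(i < X) cell_int h a (g i) s.
Proof.
elim: n a g s => [//|n IH] a g s mg g0 /=.
rewrite -(IH _ (fun i y => \int[leb]_(t in gcell (a ord0) h (head 0%N s))
  g i (tcons (t, y)))); last 2 first.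
- by move=> i; exact: measurable_cell_section.
- by move=> i y; exact: cell_section_ge0.
congr cell_int; apply/funext => y; rewrite ge0_integral_sum//.
- exact: measurable_gcell.
- by move=> i; apply: measurable_funTS; exact: measurable_section.
Qed.

Lemma elp_cell_int h n (a : 'I_n -> R) (X : nat) (p : R)
    (g : nat -> euclidean R n -> \bar R) s : (1 < p)%R ->
  (forall i, measurable_fun setT (g i)) -> (forall i x, 0 <= g i x) ->
  elp X p (fun i => cell_int h a (g i) s) <=
  cell_int h a (fun x => elp X p (fun i => g i x)) s.
Proof.
move=> p1; have p0 : (0 < p)%R by lra.
have mE m (k : nat -> euclidean R m -> \bar R) :
    (forall i, measurable_fun setT (k i)) ->
    measurable_fun setT (fun x => elp X p (fun i => k i x)).
  move=> mk; have ms : measurable_fun setT (fun x => \sum_(i < X) k i x `^ p).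
    apply: emeasurable_sum => i.
    by have := measurableT_comp (@measurable_poweR R p) (mk i); apply.
  by have := measurableT_comp (@measurable_poweR R p^-1) ms; apply.
elim: n a g s => [//|n IH] a g s mg g0 /=.
pose G i y := \int[leb]_(t in gcell (a ord0) h (head 0%N s)) g i (tcons (t, y)).
have mG i : measurable_fun setT (G i) by exact: measurable_cell_section.
have G0 i y : 0 <= G i y by exact: cell_section_ge0.
apply: (le_trans (IH (tail a) G (behead s) mG G0)).
apply: le_cell_int; first exact: mE.
- apply: (@measurable_cell_section _ (fun x => elp X p (fun i => g i x))).
    exact: mE.
  by move=> x; exact: elp_ge0.
- by move=> y; exact: elp_ge0.
move=> y; apply: (@elp_integral_le _ _ _ leb _ X p (fun i t => g i (tcons (t, y)))) => //.
- exact: measurable_gcell.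
- by move=> i; exact: measurable_section.
Qed.

(** Hoelder's inequality costs the same factor h^(1 - 1/p) on every cell; the cells are disjoint, so
    the integrals of the p-th powers over them add up to at most the integral over the line. *)
Lemma elp_cell_section (h : R) n (a : R) (X : nat) (p : R) f (y : euclidean R n) :
  (0 < h)%R -> (1 < p)%R -> measurable_fun setT f -> (forall x, 0 <= f x) ->
  elp X p (fun i => \int[leb]_(t in gcell a h i) f (tcons (t, y))) <=
  (h `^ (1 - p^-1))%:E * section_norm p%:E f y.
Proof.
move=> h0 p1 mf f0; have p0 : (0 < p)%R by lra.
have ip0 : (0 < p^-1)%R by rewrite invr_gt0.
pose F i (t : measurableTypeR R) := f (tcons (t, y)) * (\1_(gcell a h i) t)%:E.
have ms := measurable_section y mf.
have mF i : measurable_fun setT (F i).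
  by apply: emeasurable_funM => //; exact: measurable_indic_gcell.
have F0 i t : 0 <= F i t by rewrite mule_ge0// lee_fin.
have FE i t : ~ gcell a h i t -> F i t = 0.
  by move=> Ht; rewrite /F indicE memNset// mule0.
rewrite /section_norm Lnorm_fin// /elp.
rewrite -[X in X%:E * _](_ : (h `^ (p - 1)) `^ p^-1 = _)%R; last first.
  by rewrite -powRrM mulrBl divff ?gt_eqF// mul1r.
rewrite -poweR_EFin -poweRM ?lee_fin ?powR_ge0//; last first.
  by apply: integral_ge0 => t _; exact: poweR_ge0.
apply: le_poweR; [exact: ltW|by apply: sume_ge0 => i _; exact: poweR_ge0|].
apply: (@le_trans _ _ (\sum_(i < X) (h `^ (p - 1))%:E * \int[leb]_t (F i t `^ p))).
  apply: lee_sum => i _; rewrite cell_sectionE -/(F i).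
  have := integral_poweR_le (measurable_gcell a h i) (lebesgue_gcell a i h0) h0
    ltr01 p1 (mF i) (F0 i) (FE i).
  under eq_integral do rewrite poweRe1//.
  move=> /(le_poweR (ltW p0)) -/(_ (integral_ge0 _ _)) H.
  apply: le_trans (H _) _; first by move=> *; exact: F0.
  rewrite poweRM ?lee_fin ?powR_ge0 ?poweR_ge0// -poweRrM div1r mulVf ?gt_eqF//.
  rewrite poweRe1; last by apply: integral_ge0 => t _; exact: poweR_ge0.
  by rewrite poweR_EFin -powRrM mulrBl mul1r mulVf ?gt_eqF.
rewrite -ge0_sume_distrr; last first.
  by move=> i _; apply: integral_ge0 => t _; exact: poweR_ge0.
apply: lee_wpmul2l; first by rewrite lee_fin powR_ge0.
rewrite -ge0_integral_sum//; last 2 first.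
- by move=> i; have := measurableT_comp (@measurable_poweR R p) (mF i); apply.
- by move=> i t _; exact: poweR_ge0.
apply: le_lower_integral => t; first by apply: sume_ge0 => i _; exact: poweR_ge0.
have [[i0 it]|none] := pselect (exists i0 : 'I_X, gcell a h i0 t); last first.
  rewrite big1 ?poweR_ge0// => i _; rewrite FE ?poweR0r ?gt_eqF//.
  by move=> it; apply: none; exists i.
rewrite (bigD1 i0)//= big1 ?adde0.
  by rewrite /F indicE mem_set// mule1.
move=> i ii0; rewrite FE ?poweR0r ?gt_eqF// => it'.
have at_ := gcell_ge h0 it.
move/(gcell_index _ h0 at_) : it => E; move/(gcell_index _ h0 at_) : it' => E'.
by move/eqP: ii0; apply; apply/val_inj; rewrite /= -E' -E.
Qed.

(* Jensen's inequality in the first variable, whose norm is then moved inside the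
   remaining averages by Minkowski's inequality. *)
Lemma cell_int_contraction h n (a p : 'I_n -> R) (X : nat) f : (0 < h)%R ->
  (forall i, 1 < p i)%R -> measurable_fun setT f -> (forall x, 0 <= f x) ->
  (h `^ (\sum_i (p i)^-1))%:E *
    edmix X (exps p) (fun s => (h^-1 ^+ n)%:E * cell_int h a f s) <=
  mixed_norm (fun i => (p i)%:E) f.
Proof.
move=> h0; elim: n a p f => [|n IH] a p f p1 mf f0.
  by rewrite big_ord0 powRr0 exps0 expr0 /= !mul1e gee0_abs.
have p0 i : (0 < p i)%R by have := p1 i; lra.
have hi0 : (0 <= h^-1)%R by rewrite invr_ge0 ltW.
pose g := section_norm (p ord0)%:E f.
have mg : measurable_fun setT g by exact: measurable_section_norm.
have g0 y : 0 <= g y by exact: section_norm_ge0.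
have allp : all (fun q => 0 < q)%R (exps (tail p)).
  by apply/allP => q /mapP[i _ ->]; exact: p0.
apply: le_trans (IH (tail a) (tail p) g (fun i => p1 _) mg g0).
rewrite expsS /= big_ord_recl addrC powRD; last by rewrite (gt_eqF h0) implybT.
rewrite EFinM -muleA; apply: lee_wpmul2l; first by rewrite lee_fin powR_ge0.
rewrite -edmix_scale//; last 2 first.
- exact: powR_ge0.
- by move=> s; exact: elp_ge0.
apply: le_edmix => // s.
  by rewrite mule_ge0 ?elp_ge0// lee_fin powR_ge0.
rewrite elp_scale//; last 2 first.
- by rewrite exprn_ge0.
- by move=> i; apply: cell_int_ge0 => y; exact: cell_section_ge0.
pose G i y := \int[leb]_(t in gcell (a ord0) h i) f (tcons (t, y)).
have mG i : measurable_fun setT (G i) by exact: measurable_cell_section.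
have G0 i y : 0 <= G i y by exact: cell_section_ge0.
have B : elp X (p ord0) (fun i => cell_int h (tail a) (G i) s) <=
    (h `^ (1 - (p ord0)^-1))%:E * cell_int h (tail a) g s.
  apply: (le_trans (@elp_cell_int h n (tail a) X (p ord0) G s (p1 ord0) mG G0)).
  rewrite -cell_int_scale ?powR_ge0//; apply: le_cell_int => //.
  - have ms : measurable_fun setT (fun x => \sum_(i < X) G i x `^ p ord0).
      apply: emeasurable_sum => i.
      by have := measurableT_comp (@measurable_poweR R (p ord0)) (mG i); apply.
    by have := measurableT_comp (@measurable_poweR R (p ord0)^-1) ms; apply.
  - exact: measurable_funeM.
  - by move=> y; exact: elp_ge0.
  - by move=> y; exact: elp_cell_section.
apply: (@le_trans _ _ ((h `^ (p ord0)^-1)%:E * ((h^-1 ^+ n.+1)%:E *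
    ((h `^ (1 - (p ord0)^-1))%:E * cell_int h (tail a) g s)))).
  apply: lee_wpmul2l; first by rewrite lee_fin powR_ge0.
  by apply: lee_wpmul2l; first by rewrite lee_fin exprn_ge0.
rewrite !muleA -!EFinM; apply: le_of_eq; congr (_%:E * _).
have E : (h `^ (p ord0)^-1 * h `^ (1 - (p ord0)^-1) = h)%R.
  rewrite -powRD; last by rewrite (gt_eqF h0) implybT.
  by rewrite addrC subrK powRr1 ?(ltW h0).
transitivity (h `^ (p ord0)^-1 * h `^ (1 - (p ord0)^-1) * h^-1 * h^-1 ^+ n)%R.
  by rewrite exprSr; ring.
by rewrite E divff ?mul1r// gt_eqF.
Qed.

Lemma cell_int_block (h : R) k n (a : 'I_n -> R) f s : (0 < h)%R -> size s = n ->
  measurable_fun setT f -> (forall x, 0 <= f x) ->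
  (forall u, cell_int h a f u < +oo) ->
  cell_int ((2 ^ k)%:R * h) a f [seq (i %/ 2 ^ k)%N | i <- s] =
  ((2 ^ k)%:R ^+ n * box_avg k s (fun u => fine (cell_int h a f u)))%:E.
Proof.
move=> h0; elim: n a f s => [|n IH] a f s.
  move=> /size0nil -> mf f0 ffin; rewrite /= expr0 mul1r fineK//.
  by rewrite ge0_fin_numE// (ffin [::]).
case: s => [//|i s] /= [ss] mf f0 ffin.
pose G j y := \int[leb]_(t in gcell (a ord0) h j) f (tcons (t, y)).
have mG j : measurable_fun setT (G j) by exact: measurable_cell_section.
have G0 j y : 0 <= G j y by exact: cell_section_ge0.
pose m := ((i %/ 2 ^ k) * 2 ^ k)%N.
rewrite (_ : (fun y => _) = (fun y => \sum_(j < 2 ^ k) G (m + j)%N y)); last first.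
  apply/funext => y; rewrite /G.
  have -> : gcell (a ord0) ((2 ^ k)%:R * h) (i %/ 2 ^ k) =
      \big[setU/set0]_(j < 2 ^ k) gcell (a ord0) h (m + j)%N.
    rewrite -(bigcup_mkord _ (fun j => gcell (a ord0) h (m + j)%N)).
    apply/seteqP; split => [t /(gcell_block _ _ _ _ h0)[at_ E]|t [j /= jk tj]].
      exists (cell_index (a ord0) h t %% 2 ^ k)%N => /=.
        by rewrite ltn_mod expn_gt0.
      by apply/(gcell_index _ h0 at_); rewrite /m -E -divn_eq.
    have at_ := gcell_ge h0 tj; apply/(gcell_block _ _ _ _ h0); split => //.
    move/(gcell_index _ h0 at_) : tj => ->.
    by rewrite /m divnMDl ?expn_gt0// (divn_small jk) addn0.
  rewrite -(big_mkord xpredT (fun j => gcell (a ord0) h (m + j)%N)).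
  rewrite ge0_integral_bigsetU//=.
  - by rewrite big_mkord.
  - by move=> j; exact: measurable_gcell.
  - exact: iota_uniq.
  - apply/trivIsetP => j j' _ _ jj'.
    have /trivIsetP := @trivIset_gcell _ (a ord0) h h0; apply => //.
    by rewrite eqn_add2l.
  - by apply: measurable_funTS; exact: measurable_section.
rewrite (cell_int_sum _ _ _ (g := fun j => G (m + j)%N))//.
rewrite (eq_bigr (fun j : 'I_(2 ^ k) => ((2 ^ k)%:R ^+ n *
    box_avg k s (fun u => fine (cell_int h a f ((m + j)%N :: u))))%:E)).
  rewrite sumEFin -mulr_sumr; congr EFin.
  rewrite /cell_avg -/m exprSr -mulrA; congr (_ * _)%R.
  by rewrite mulrC divfK// gt_eqF// pow2_gt0.
move=> j _; rewrite IH// => u.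
exact: (ffin ((m + j)%N :: u)).
Qed.

Lemma integral_cells h n (a : 'I_n -> R) f s : size s = n ->
  measurable_fun setT f -> (forall x, 0 <= f x) ->
  \int[lebesgue R n]_(y in [set y : euclidean R n | forall i,
     gcell (a i) h (nth 0%N s i) (tnth y i)]) f y = cell_int h a f s.
Proof.
elim: n a f s => [|n IH] a f s.
  move=> /size0nil -> mf f0 /=; rewrite (_ : [set _ | _] = setT); last first.
    by apply/seteqP; split => // y _ [].
  by rewrite integral_dirac// diracT mul1e.
case: s => [//|j s] [ss] mf f0; rewrite [RHS]/=.
set B := [set y | _].
have mB : measurable B.
  rewrite (_ : B = \bigcap_(i in [set: 'I_n.+1])
      ((fun y : euclidean R n.+1 => tnth y i) @^-1` gcell (a i) h (nth 0%N (j :: s) i))).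
    apply: fin_bigcap_measurable => // i _; rewrite -[X in measurable X]setTI.
    by apply: measurable_tnth => //; exact: measurable_gcell.
  by apply/seteqP; split => [y H i _|y H i]; exact: H.
rewrite integral_mkcond.
have mfB : measurable_fun setT (f \_ B).
  by apply/(measurable_restrictT _ _).1 => //; exact: measurable_funTS.
have fB0 x : 0 <= (f \_ B) x by apply: erestrict_ge0.
rewrite (integral_tcons mfB fB0) -IH//; last 2 first.
- exact: measurable_cell_section.
- by move=> y; exact: cell_section_ge0.
set B' := [set y | _].
rewrite [RHS]integral_mkcond; apply: eq_integral => y _.
rewrite [in RHS]/patch; case: ifPn => yB'.
  rewrite [RHS]integral_mkcond; apply: eq_integral => t _; rewrite /patch.
  have -> // : (tcons (t, y) \in B) = (t \in gcell (a ord0) h j).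
  apply/idP/idP; rewrite !inE => H; first by have := H ord0; rewrite tnth0.
  move=> i; have [k ->|->] := unliftP ord0 i; last by rewrite tnth0.
  by rewrite tnthS /=; move: yB'; rewrite inE; apply.
apply: integral0_eq => t _; rewrite /patch memNset// => H.
move/negP: yB'; apply; rewrite inE => i.
by have := H (lift ord0 i); rewrite tnthS.
Qed.

End cell_integrals.

(** * The Riesz kernel on dyadic grids *)

Section one_third.
Context {R : realType}.
Implicit Types (r s t h : R).

(* Two points closer than a third of the mesh share a cell in one of two grids
   shifted by a third of the length [12 r] of the whole interval: the cell ends
   of the two grids are never closer than a third of the mesh, as 3 does not
   divide a power of 2. *)
Lemma one_third r s t m : 0 < r -> - (2 * r) <= s -> - (2 * r) <= t ->
  `|s - t| < 12 * r / (2 ^ m)%:R / 3 ->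
  cell_index (- (6 * r)) (12 * r / (2 ^ m)%:R) s =
    cell_index (- (6 * r)) (12 * r / (2 ^ m)%:R) t \/
  cell_index (- (2 * r)) (12 * r / (2 ^ m)%:R) s =
    cell_index (- (2 * r)) (12 * r / (2 ^ m)%:R) t.
Proof.
move=> r0; wlog st : s t / s <= t => [H s0 t0 d|s0 t0].
  have [st|/ltW ts] := leP s t; first exact: H.
  have [] := H t s ts t0 s0; first by rewrite distrC.
    by move=> ->; left.
  by move=> ->; right.
have M0 : 0 < (2 ^ m)%:R :> R by exact: pow2_gt0.
set l := 12 * r / _; have l0 : 0 < l by rewrite divr_gt0// mulr_gt0.
rewrite distrC ger0_norm ?subr_ge0// => d.
have E a : (t - a) / l < (s - a) / l + 3^-1.
  rewrite -ltrBlDl -mulrBl ltr_pdivrMr// mulrC; lra.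
have shift x : (x + 2 * r) / l = (x + 6 * r) / l - (2 ^ m)%:R / 3.
  by rewrite /l; field; rewrite !gt_eqF.
have split a : a <= s -> cell_index a l s <> cell_index a l t ->
    exists N : nat, (s - a) / l < N%:R <= (t - a) / l.
  move=> as_ ne; exists (cell_index a l t).
  have t1 : 0 <= (t - a) / l by rewrite divr_ge0 ?subr_ge0 ?(le_trans as_)// ltW.
  have /andP[-> _] := truncn_itv t1; rewrite andbT.
  have : (cell_index a l s <= cell_index a l t)%N.
    by apply: le_truncn; rewrite ler_pM2r ?invr_gt0// lerD2r.
  rewrite leq_eqVlt => /orP[/eqP//|lt]; apply: lt_le_trans (truncnS_gt _) _.
  by rewrite ler_nat.
(* If both grids separate s and t, then N and N' + 2^m / 3 lie in one interval of length below 1/3,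
   since the offsets differ by 4 r = (2^m / 3) l. So |3 N - 3 N' - 2^m| < 1, and 3 would divide
   2^m. *)
apply: contrapT => /not_orP[n1 n2].
have s6 : - (6 * r) <= s by lra.
have [N /andP[N1 N2]] := split _ s6 n1.
have [N' /andP[N1' N2']] := split _ s0 n2.
have e := E (- (6 * r)).
rewrite !opprK in N1 N2 N1' N2' e; rewrite !shift in N1' N2'.
have h1 : (3 * N)%:R = 3 * N%:R :> R by rewrite natrM.
have h2 : (3 * N')%:R = 3 * N'%:R :> R by rewrite natrM.
have a1 : (3 * N < 3 * N' + 2 ^ m + 1)%N.
  by rewrite -(ltr_nat R) [(3 * N' + 2 ^ m + 1)%:R]natrD [(3 * N' + 2 ^ m)%:R]natrD h1 h2; lra.
have a2 : (3 * N' + 2 ^ m < 3 * N + 1)%N.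
  by rewrite -(ltr_nat R) [(3 * N + 1)%:R]natrD [(3 * N' + 2 ^ m)%:R]natrD h1 h2; lra.
have : (3 %| 2 ^ m)%N.
  have e3 : (3 * N = 3 * N' + 2 ^ m)%N.
    by move: a1 a2; rewrite !addn1 !ltnS => a1 a2; apply/eqP; rewrite eqn_leq a1 a2.
  have -> : (2 ^ m = 3 * (N - N'))%N by rewrite mulnBr e3 addKn.
  exact: dvdn_mulr.
by rewrite Euclid_dvdX.
Qed.

Lemma scale_exists h (d : R) J : h / 3 <= d -> d < (2 ^ J)%:R * h / 3 ->
  exists2 k, (k < J)%N & (2 ^ k)%:R * h / 3 <= d < (2 ^ k.+1)%:R * h / 3.
Proof.
elim: J => [|J IH] hd; first by rewrite expn0 mul1r ltNge hd.
move=> dJ; have [dl|ld] := ltP d ((2 ^ J)%:R * h / 3).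
  by have [k kJ H] := IH hd dl; exists k => //; exact: ltnW.
by exists J => //; rewrite ld.
Qed.

End one_third.

Section riesz_kernel.
Context {R : realType} (n : nat).
Implicit Types (x y : euclidean R n) (alpha r : R).

(** For alpha < n the kernel is 0 on the diagonal, since 0^(n - alpha) = 0 and the inverse of 0 is
    0. *)
Definition riesz_kernel alpha x y : R :=
  (euclidean_dist x y `^ (n%:R - alpha))^-1.

Lemma riesz_kernel_ge0 alpha x y : 0 <= riesz_kernel alpha x y.
Proof. by rewrite invr_ge0 powR_ge0. Qed.

Let sqd x y : R := \sum_(i < n) (tnth x i - tnth y i) ^+ 2.

Let sqd_ge0 x y : 0 <= sqd x y.
Proof. by apply: sumr_ge0 => i _; exact: sqr_ge0. Qed.

Lemma measurable_riesz_kernel alpha :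
  measurable_fun setT (fun z : euclidean R n * euclidean R n =>
    riesz_kernel alpha z.1 z.2).
Proof.
rewrite (_ : (fun _ => _) = (fun z : euclidean R n * euclidean R n =>
    sqd z.1 z.2 `^ (2^-1 * - (n%:R - alpha)))); last first.
  apply/funext => z; rewrite /riesz_kernel /euclidean_dist -/(sqd z.1 z.2).
  by rewrite -powR12_sqrt// powRrM powRN.
have ms : measurable_fun setT (fun z : euclidean R n * euclidean R n => sqd z.1 z.2).
  apply: measurable_sum => i; apply: measurable_funX; apply: measurable_funB.
    have := measurableT_comp (@measurable_tnth _ (measurableTypeR R) n i)
      (@measurable_fst _ _ (euclidean R n) (euclidean R n)); apply.
  have := measurableT_comp (@measurable_tnth _ (measurableTypeR R) n i)
    (@measurable_snd _ _ (euclidean R n) (euclidean R n)); apply.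
by have := measurableT_comp (@measurable_powR R (2^-1 * - (n%:R - alpha))) ms; apply.
Qed.

Lemma euclidean_dist_ge0 x y : 0 <= euclidean_dist x y.
Proof. exact: sqrtr_ge0. Qed.

Lemma coord_le_dist x y i : `|tnth x i - tnth y i| <= euclidean_dist x y.
Proof.
rewrite -sqrtr_sqr; apply: ler_wsqrtr.
by rewrite (bigD1 i)//= lerDl sumr_ge0// => j _; exact: sqr_ge0.
Qed.

Lemma riesz_kernel_le alpha x y (d : R) : 0 < d -> alpha <= n%:R ->
  d <= euclidean_dist x y -> riesz_kernel alpha x y <= d `^ (alpha - n%:R).
Proof.
move=> d0 an dxy; rewrite /riesz_kernel -[alpha - n%:R](opprB n%:R alpha).
rewrite powRN lef_pV2 ?posrE ?powR_gt0//.
  by apply: ler_powRl => //; [rewrite subr_ge0|exact: ltW].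
exact: lt_le_trans dxy.
Qed.

(** One of the two offsets of [one_third] in each coordinate, hence 2^n grids. From either offset an
    interval of length 12 r contains [-2r, 2r], where all coordinates in question lie. *)
Definition offset r (e : {ffun 'I_n -> bool}) (i : 'I_n) : R :=
  if e i then - (2 * r) else - (6 * r).

Definition mesh r J : R := 12 * r / (2 ^ J)%:R.

Lemma mesh_gt0 r J : 0 < r -> 0 < mesh r J.
Proof. by move=> r0; rewrite divr_gt0 ?pow2_gt0// mulr_gt0. Qed.

Definition same_box r J e k x : set (euclidean R n) :=
  [set y | forall i, gcell (offset r e i) ((2 ^ k)%:R * mesh r J)
    (cell_index (offset r e i) (mesh r J) (tnth x i) %/ 2 ^ k) (tnth y i)].

(** The scale is read off the largest coordinate difference d: with h the mesh and 2^k h / 3 <= d <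
    2^(k+1) h / 3, each coordinate has a grid in which x and y share a cell of side 2^(k+1) h. Since
    d >= 2^(k+1) h / 6, the kernel costs 6^(n - alpha). The mesh has to be at most 3 d, so [J0]
    depends on x and y. *)
Lemma riesz_kernel_boxes alpha r x y : 0 < r -> alpha < n%:R ->
  cube (origin R n) r x -> cube (origin R n) (2 * r) y ->
  0 < riesz_kernel alpha x y ->
  exists J0, forall J, (J0 <= J)%N -> exists e k, [/\ (k <= J)%N,
    same_box r J e k x y &
    riesz_kernel alpha x y <=
      6 `^ (n%:R - alpha) * ((2 ^ k)%:R * mesh r J) `^ (alpha - n%:R)].
Proof.
move=> r0 an xr yr kp.
have nx i : `|tnth x i| < r by have := xr i; rewrite tnth_mktuple subr0.
have ny i : `|tnth y i| < 2 * r by have := yr i; rewrite tnth_mktuple subr0.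
pose d := \big[Num.max/0]_(i < n) `|tnth x i - tnth y i|.
have di i : `|tnth x i - tnth y i| <= d.
  exact: (le_bigmax _ (fun i => `|tnth x i - tnth y i|) i).
have dD : d <= euclidean_dist x y.
  by apply: bigmax_le => [|i _]; [exact: euclidean_dist_ge0|exact: coord_le_dist].
have d_ge0 : 0 <= d by exact: bigmax_ge_id.
have d0 : 0 < d.
  rewrite lt_def d_ge0 andbT; apply/eqP => dE; move: kp.
  have xy i : tnth x i - tnth y i = 0.
    by apply/eqP; rewrite -normr_le0 -dE.
  rewrite /riesz_kernel /euclidean_dist big1 ?sqrtr0 ?powR0 ?invr0 ?ltxx//.
    by rewrite gt_eqF// subr_gt0.
  by move=> i _; rewrite xy expr0n.
have d3 : d < 3 * r.
  apply: bigmax_lt => [|i _]; first by rewrite mulr_gt0.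
  by apply: le_lt_trans (ler_normB _ _) _; have := nx i; have := ny i; lra.
have [J0 HJ0] : exists J0 : nat, forall J, (J0 <= J)%N -> mesh r J / 3 <= d.
  exists (Num.truncn (4 * r / d)).+1 => J JJ.
  have J4 : 4 * r / d <= (2 ^ J)%:R.
    apply: ltW; apply: lt_le_trans (truncnS_gt _) _; rewrite ler_nat.
    by apply: leq_trans JJ _; apply: ltnW; exact: ltn_expl.
  move: J4; rewrite ler_pdivrMr// => J4; rewrite /mesh.
  rewrite ler_pdivrMr// ler_pdivrMr ?pow2_gt0//; lra.
exists J0 => J /HJ0 Jd; set h := mesh r J; have h0 : 0 < h by exact: mesh_gt0.
have dJ : d < (2 ^ J)%:R * h / 3.
  have -> : (2 ^ J)%:R * h = 12 * r.
    by rewrite /h /mesh mulrCA divff ?mulr1// gt_eqF// pow2_gt0.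
  by lra.
have [k kJ /andP[kd dk]] := scale_exists Jd dJ.
have El : (2 ^ k.+1)%:R * h = 12 * r / (2 ^ (J - k.+1))%:R.
  rewrite /h /mesh; have -> : (2 ^ J = 2 ^ (J - k.+1) * 2 ^ k.+1)%N.
    by rewrite -expnD subnK.
  rewrite natrM; field.
  by rewrite !gt_eqF// pow2_gt0.
have xlo i : - (2 * r) <= tnth x i.
  by have := nx i; rewrite ltr_norml => /andP[]; lra.
have ylo i : - (2 * r) <= tnth y i.
  by have := ny i; rewrite ltr_norml => /andP[]; lra.
have choice_e i : exists b : bool,
    cell_index (if b then - (2 * r) else - (6 * r)) ((2 ^ k.+1)%:R * h) (tnth x i) =
    cell_index (if b then - (2 * r) else - (6 * r)) ((2 ^ k.+1)%:R * h) (tnth y i).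
  have cl : `|tnth x i - tnth y i| < 12 * r / (2 ^ (J - k.+1))%:R / 3.
    by rewrite -El; exact: le_lt_trans (di i) dk.
  by rewrite El; have [H|H] := one_third r0 (xlo i) (ylo i) cl; [exists false|exists true].
have [e He] := choice choice_e.
exists [ffun i => e i], k.+1; split => //.
  move=> i; rewrite /offset ffunE -/h; set a := if _ then _ else _.
  have kh0 : 0 < (2 ^ k.+1)%:R * h by rewrite mulr_gt0// pow2_gt0.
  have ax : a <= tnth x i by rewrite /a; case: ifP => _ //; have := xlo i; lra.
  have ay : a <= tnth y i by rewrite /a; case: ifP => _ //; have := ylo i; lra.
  have cx : gcell a ((2 ^ k.+1)%:R * h) (cell_index a h (tnth x i) %/ 2 ^ k.+1) (tnth x i).
    exact/(gcell_block _ _ _ _ h0).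
  by apply/(gcell_index _ kh0 ay); move/(gcell_index _ kh0 ax) : cx => <-; rewrite -He.
have kh : 0 < (2 ^ k.+1)%:R * h / 6 by rewrite divr_gt0// mulr_gt0// pow2_gt0.
apply: le_trans (riesz_kernel_le kh (ltW an) _) _.
  by apply: le_trans dD; apply: le_trans kd; rewrite pow2S -/h; lra.
rewrite powRM ?invr_ge0//; last by rewrite mulr_ge0 ?(ltW h0).
rewrite mulrC -[6^-1]powR_inv1// -powRrM mulN1r opprB.
exact: lexx.
Qed.

End riesz_kernel.

Section mixed_norm_sums.
Context {R : realType}.
Local Open Scope ereal_scope.

Lemma mixed_norm0 n (p : 'I_n -> \bar R) : (forall i, 0 < p i) ->
  mixed_norm p (fun=> 0) = 0.
Proof.
elim: n p => [|n IH] p p0 /=; first by rewrite normr0.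
rewrite -[RHS](IH (fun i => p (lift ord0 i)))//.
by congr mixed_norm; apply/funext => y; rewrite Lnorm0// gt_eqF.
Qed.

Lemma mixed_norm_sum_le n (q : 'I_n -> R) (I : Type) (s : seq I) :
  (forall i, 0 < q i)%R ->
  exists2 C : R, (0 < C)%R &
  forall (F : I -> euclidean R n -> \bar R) B, 0 <= B ->
    (forall i, measurable_fun setT (F i)) -> (forall i x, 0 <= F i x) ->
    (forall i, mixed_norm (fun i => (q i)%:E) (F i) <= B) ->
    mixed_norm (fun i => (q i)%:E) (fun x => \sum_(i <- s) F i x) <= C%:E * B.
Proof.
move=> q0; have [C0 C00 HC0] := mixed_norm_add_le q0.
elim: s => [|i s [C C_gt0 HC]].
  exists 1%R => // F B B0 mF F0 FB.
  rewrite (_ : (fun x => \sum_(j <- [::]) F j x) = (fun=> 0)); last first.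
    by apply/funext => x; rewrite big_nil.
  by rewrite mixed_norm0 ?mul1e// => i; rewrite lte_fin.
exists (C0 * (1 + C))%R => [|F B B0 mF F0 FB]; first by rewrite mulr_gt0// addr_gt0.
rewrite (_ : (fun x => \sum_(j <- i :: s) F j x) =
    fun x => F i x + \sum_(j <- s) F j x); last first.
  by apply/funext => x; rewrite big_cons.
apply: (le_trans (HC0 (F i) (fun x => \sum_(j <- s) F j x) _ _ _ _)) => //.
- exact: emeasurable_sum.
- by move=> x; apply: sume_ge0.
rewrite EFinM -muleA; apply: lee_wpmul2l; first by rewrite lee_fin ltW.
rewrite EFinD ge0_muleDl ?lee_fin ?(ltW C_gt0)// mul1e.
by apply: leeD => //; exact: HC.
Qed.

End mixed_norm_sums.

Section grids.
Context {R : realType}.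
Implicit Types h r : R.

Lemma size_grid_index h n (a : 'I_n -> R) x : size (grid_index h a x) = n.
Proof. by elim: n a x => [//|n IH] a x /=; rewrite IH. Qed.

Lemma nth_grid_index h n (a : 'I_n -> R) x (i : 'I_n) :
  nth 0%N (grid_index h a x) i = cell_index (a i) h (tnth x i).
Proof.
elim: n a x i => [a x []//|n IH] a x i /=.
have [k ->|->] := unliftP ord0 i; last by [].
rewrite [LHS]/= IH /tail; congr cell_index.
by rewrite [x in RHS]tuple_eta tnthS.
Qed.

Lemma in_gridP h X n (a : 'I_n -> R) x :
  (forall i, in_range (a i) h X (tnth x i)) -> in_grid h X a x.
Proof.
elim: n a x => [//|n IH] a x H /=; rewrite (H ord0)/=; apply: IH => i.
have := H (lift ord0 i); rewrite /tail.
by rewrite [x in X in in_range _ _ _ X -> _]tuple_eta tnthS.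
Qed.

End grids.

(** * The potential near the cube *)

Section potential.
Context {R : realType} (n : nat).
Local Open Scope ereal_scope.
Implicit Types (f : euclidean R n -> \bar R) (x y : euclidean R n) (alpha r : R).

Definition potential alpha f x : \bar R :=
  \int[lebesgue R n]_y (f y * (riesz_kernel alpha x y)%:E).

Lemma potential_ge0 alpha f x : (forall y, 0 <= f y) -> 0 <= potential alpha f x.
Proof.
by move=> f0; apply: integral_ge0 => y _; rewrite mule_ge0// lee_fin riesz_kernel_ge0.
Qed.

Lemma measurable_potential alpha f : measurable_fun setT f ->
  (forall y, 0 <= f y) -> measurable_fun setT (potential alpha f).
Proof.
move=> mf f0.
apply: (@measurable_fun_fubini_tonelli_F _ _ _ _ _ (lebesgue R n)
  (fun z : euclidean R n * euclidean R n =>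
     f z.2 * (riesz_kernel alpha z.1 z.2)%:E)).
  apply: emeasurable_funM.
    have := measurableT_comp mf (@measurable_snd _ _ (euclidean R n) (euclidean R n)).
    exact.
  by apply/measurable_EFinP; exact: measurable_riesz_kernel.
by move=> z; rewrite mule_ge0// lee_fin riesz_kernel_ge0.
Qed.

End potential.

Section cell_int_bound.
Context {R : realType}.
Local Open Scope ereal_scope.

Lemma cell_int_le_integral (h : R) n (a : 'I_n -> R) f s :
  measurable_fun setT f -> (forall x, 0 <= f x) ->
  cell_int h a f s <= \int[lebesgue R n]_x f x.
Proof.
elim: n a f s => [|n IH] a f s mf f0.
  by rewrite integral_dirac// diracT mul1e.
rewrite (integral_tcons mf f0) /=.
apply: le_trans (IH _ _ _ _ _) _.
- exact: measurable_cell_section.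
- by move=> y; exact: cell_section_ge0.
apply: le_lower_integral => y; first exact: cell_section_ge0.
apply: ge0_subset_integral => //; first exact: measurable_gcell.
exact: measurable_section.
Qed.

End cell_int_bound.

Section local_bound.
Context {R : realType} (n : nat) (alpha : R).
Local Open Scope ereal_scope.
Implicit Types (f : euclidean R n -> \bar R) (x y : euclidean R n) (r : R).
Implicit Type e : {ffun 'I_n -> bool}.

Let C1 : R := (6 `^ (n%:R - alpha))%R.

Let coef r J k : R := (C1 * ((2 ^ k)%:R * mesh r J) `^ (alpha - n%:R))%R.

Let coef_ge0 r J k : (0 <= coef r J k)%R.
Proof. by rewrite mulr_ge0 ?powR_ge0. Qed.

Let cellF r J e f u := fine (cell_int (mesh r J) (offset r e) f u).

(** What the dominating kernel gives when integrated against [f]: on each of the 2^n grids, a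
    discrete fractional integral. As [cellF] is an integral and not a mean, the mesh enters with the
    power alpha - n. *)
Let boxed r J f x : \bar R := \sum_(e : {ffun 'I_n -> bool})
  (C1 * mesh r J `^ (alpha - n%:R))%:E *
  (step_fun (mesh r J) (2 ^ J) (offset r e)
     (fun s => frac_sum J alpha s (cellF r J e f)) x)%:E.

Lemma measurable_same_box r J e k x : measurable (same_box r J e k x).
Proof.
rewrite (_ : same_box r J e k x = \bigcap_(i in [set: 'I_n])
  ((fun y : euclidean R n => tnth y i) @^-1` gcell (offset r e i)
    ((2 ^ k)%:R * mesh r J)
    (cell_index (offset r e i) (mesh r J) (tnth x i) %/ 2 ^ k))).
  apply: fin_bigcap_measurable => // i _; rewrite -[X in measurable X]setTI.
  by apply: measurable_tnth => //; exact: measurable_gcell.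
by apply/seteqP; split => [y H i _|y H i]; exact: H.
Qed.

Lemma integral_same_box r J e k x f : (0 < r)%R -> measurable_fun setT f ->
  (forall y, 0 <= f y) -> \int[lebesgue R n]_y f y < +oo ->
  \int[lebesgue R n]_(y in same_box r J e k x) f y =
  ((2 ^ k)%:R ^+ n * box_avg k (grid_index (mesh r J) (offset r e) x)
     (cellF r J e f))%:E.
Proof.
move=> r0 mf f0 flty; have h0 : (0 < mesh r J)%R by exact: mesh_gt0.
rewrite -cell_int_block//; last 2 first.
- exact: size_grid_index.
- by move=> u; apply: le_lt_trans (cell_int_le_integral _ _ _ mf f0) flty.
rewrite -integral_cells//; last by rewrite size_map size_grid_index.
congr (integral _ _ _); apply/seteqP; split => y H i.
  have := H i; rewrite (nth_map 0%N) ?size_grid_index// nth_grid_index.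
  exact.
by have := H i; rewrite (nth_map 0%N) ?size_grid_index// nth_grid_index.
Qed.

Let box_kernel r J x y : R := (\sum_(e : {ffun 'I_n -> bool}) \sum_(k < J.+1)
  coef r J k * \1_(same_box r J e k x) y)%R.

Let box_kernel_ge0 r J x y : (0 <= box_kernel r J x y)%R.
Proof.
by apply: sumr_ge0 => e _; apply: sumr_ge0 => k _; rewrite mulr_ge0.
Qed.

Let measurable_box_kernel r J x :
  measurable_fun setT (fun y => (box_kernel r J x y)%:E : \bar R).
Proof.
apply/measurable_EFinP; apply: measurable_sum => e; apply: measurable_sum => k.
by apply: measurable_funM => //; apply: measurable_indic; exact: measurable_same_box.
Qed.

Let integral_box_kernel r J x f : (0 < r)%R -> measurable_fun setT f ->
  (forall y, 0 <= f y) -> \int[lebesgue R n]_y f y < +oo ->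
  cube (origin R n) r x ->
  \int[lebesgue R n]_y (f y * (box_kernel r J x y)%:E) = boxed r J f x.
Proof.
move=> r0 mf f0 flty xr; have h0 : (0 < mesh r J)%R by exact: mesh_gt0.
set h := mesh r J in h0 *.
have mfi e k : measurable_fun setT
    (fun y => (coef r J k)%:E * (f y * (\1_(same_box r J e k x) y)%:E)).
  apply: measurable_funeM; apply: emeasurable_funM => //.
  by apply/measurable_EFinP; apply: measurable_indic; exact: measurable_same_box.
have fi0 e k y : 0 <= (coef r J k)%:E * (f y * (\1_(same_box r J e k x) y)%:E).
  by rewrite !mule_ge0// lee_fin.
under eq_integral => y _.
  rewrite /box_kernel -sumEFin ge0_sume_distrr; last first.
    by move=> e _; rewrite lee_fin sumr_ge0// => k _; rewrite mulr_ge0.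
  under eq_bigr => e _.
    rewrite -sumEFin ge0_sume_distrr; last first.
      by move=> k _; rewrite lee_fin mulr_ge0.
    under eq_bigr => k _ do rewrite EFinM muleCA.
    over.
  over.
rewrite ge0_integral_sum//; last 2 first.
- by move=> e; apply: emeasurable_sum => k; exact: mfi.
- by move=> e y _; apply: sume_ge0 => k _; exact: fi0.
apply: eq_bigr => e _.
rewrite ge0_integral_sum//.
rewrite /step_fun in_gridP; last first.
  move=> i; rewrite /in_range /mesh; have := xr i.
  rewrite /origin tnth_mktuple subr0 ltr_norml => /andP[x1 x2].
  have -> : ((2 ^ J)%:R * (12 * r / (2 ^ J)%:R) = 12 * r)%R.
    by rewrite mulrCA divff ?mulr1// gt_eqF// pow2_gt0.
  by rewrite /offset; case: ifP => _; apply/andP; split; lra.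
rewrite /frac_sum -EFinM mulr_sumr -sumEFin; apply: eq_bigr => k _.
rewrite lower_integral_scale; last 2 first.
- by rewrite mulr_gt0 ?powR_gt0// mulr_gt0// pow2_gt0.
- by move=> y; rewrite mule_ge0// lee_fin.
rewrite -[X in _ * X](_ : \int[lebesgue R n]_(y in same_box r J e k x) f y = _); last first.
  by rewrite [LHS]integral_mkcond; apply: eq_integral => y _; rewrite epatch_indic.
rewrite (integral_same_box _ _ _ _ r0 mf f0 flty) -EFinM; congr EFin.
rewrite mulrA mulrA; congr (_ * _)%R; rewrite /coef -/h powRM ?(ltW h0)//.
have P0 := @pow2_gt0 R k.
(* A box integral is 2^(k n) times the average of the cell integrals, which turns 2^(k (alpha - n))
   into the weight 2^(k alpha) of [frac_sum]. *)
have -> : ((2 ^ k)%:R `^ alpha =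
    (2 ^ k)%:R `^ (alpha - n%:R) * (2 ^ k)%:R ^+ n :> R)%R.
  by rewrite -powR_mulrn ?(ltW P0)// -powRD ?subrK// (gt_eqF P0) implybT.
ring.
Qed.

Hypothesis alpha_lt : (alpha < n%:R)%R.

(** The kernel is dominated only from some [J0] depending on y on, so the domination survives in the
    limit inferior, by Fatou's lemma. This limit is written as the supremum of [einfs], an
    increasing sequence, as [mixed_norm_sup_le] requires. *)
Let potential_le_boxed r x f : (0 < r)%R -> measurable_fun setT f ->
  (forall y, 0 <= f y) -> \int[lebesgue R n]_y f y < +oo ->
  (forall y, ~ cube (origin R n) (2 * r) y -> f y = 0) ->
  cube (origin R n) r x ->
  potential alpha f x <= ereal_sup (range (einfs (fun J => boxed r J f x))).
Proof.
move=> r0 mf f0 flty fE xr.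
rewrite -(cvg_lim _ (@cvg_einfs_sup _ (fun J => boxed r J f x)))//.
rewrite -limn_einf_lim.
under [X in limn_einf X]eq_fun do rewrite -integral_box_kernel//.
apply: le_trans (fatou _ _ _ _) => //; last 2 first.
- by move=> J; apply: emeasurable_funM => //; exact: measurable_box_kernel.
- by move=> J y _; rewrite mule_ge0// lee_fin.
apply: le_lower_integral => y.
  by rewrite mule_ge0// lee_fin riesz_kernel_ge0.
set u := fun J => f y * (box_kernel r J x y)%:E.
have u0 J : 0 <= u J by rewrite mule_ge0// lee_fin.
rewrite limn_einf_lim (cvg_lim _ (@cvg_einfs_sup _ u))//.
have sup0 : 0 <= ereal_sup (range (einfs u)).
  apply: (@le_trans _ _ (einfs u 0%N)); last by apply: ereal_sup_ubound; exists 0%N.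
  by apply: le_ereal_inf_tmp => _ [J /= _ <-].
have [yr|/fE ->] := pselect (cube (origin R n) (2 * r) y); last by rewrite mul0e.
have [k0|kp] := leP (riesz_kernel alpha x y) 0%R.
  have -> : riesz_kernel alpha x y = 0%R by apply/eqP; rewrite eq_le k0 riesz_kernel_ge0.
  by rewrite mule0.
have [J0 HJ0] := riesz_kernel_boxes r0 alpha_lt xr yr kp.
apply: (@le_trans _ _ (einfs u J0)); last by apply: ereal_sup_ubound; exists J0.
apply: le_ereal_inf_tmp => _ [J /= JJ <-].
have [e [k [kJ yk kle]]] := HJ0 J JJ.
apply: lee_wpmul2l => //; rewrite lee_fin; apply: (le_trans kle).
have kJ1 : (k < J.+1)%N by [].
rewrite /box_kernel (bigD1 e)//= (bigD1 (Ordinal kJ1))//= indicE mem_set// mulr1.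
rewrite -/(coef r J k) -addrA lerDl addr_ge0//.
  by apply: sumr_ge0 => i _; rewrite mulr_ge0.
by apply: sumr_ge0 => e' _; apply: sumr_ge0 => i _; rewrite mulr_ge0.
Qed.

(** [discrete_mixed_hls] is applied to the cell integrals of [f], with a constant free of the depth,
    and [cell_int_contraction] leads back from cell means to [f]. The condition on the exponents
    makes the powers of the mesh cancel. *)
Lemma local_potential_bound (p q : 'I_n -> R) :
  (forall i, 1 < p i)%R -> (forall i, p i <= q i)%R -> (exists i, p i != q i) ->
  (\sum_i ((p i)^-1 - (q i)^-1) = alpha)%R ->
  exists2 C : R, (0 < C)%R &
  forall r f, (0 < r)%R -> measurable_fun setT f -> (forall y, 0 <= f y) ->
    \int[lebesgue R n]_y f y < +oo ->
    (forall y, ~ cube (origin R n) (2 * r) y -> f y = 0) ->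
    mixed_norm (fun i => (q i)%:E) ((potential alpha f) \_ (cube (origin R n) r)) <=
    C%:E * mixed_norm (fun i => (p i)%:E) f.
Proof.
move=> p1 pq [i0 pqi0] gainE.
have p0 i : (0 < p i)%R by have := p1 i; lra.
have q0 i : (0 < q i)%R by have := pq i; have := p0 i; lra.
pose e := [seq (p i, q i) | i <- enum 'I_n].
have e1 : unzip1 e = exps p by rewrite /unzip1 -map_comp.
have e2 : unzip2 e = exps q by rewrite /unzip2 -map_comp.
have ok : exponents_ok e.
  by rewrite /exponents_ok all_map; apply/allP => i _ /=; rewrite p1 pq.
have ne : has (fun z => z.1 != z.2) e.
  by rewrite has_map; apply/hasP; exists i0; rewrite ?mem_enum.
have ge : gain e = alpha by rewrite /gain big_map big_enum.
have [Cd Cd0 Hd] := discrete_mixed_hls ok ne; rewrite ge e1 e2 in Hd.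
have [Cs Cs0 Hs] := mixed_norm_sum_le (index_enum {ffun 'I_n -> bool}) q0.
have C10 : (0 < C1)%R by exact: powR_gt0.
exists (Cs * (C1 * Cd))%R => [|r f r0 mf f0 flty fE].
  by rewrite !mulr_gt0.
have allq : all (fun z => 0 < z)%R (exps q) by apply/allP => z /mapP[i _ ->].
have allp : all (fun z => 0 < z)%R (exps p) by apply/allP => z /mapP[i _ ->].
have F0 J ee u : (0 <= cellF r J ee f u)%R by apply: fine_ge0; exact: cell_int_ge0.
have S0 J ee s : (0 <= frac_sum J alpha s (cellF r J ee f))%R.
  by apply: frac_sum_ge0 => u; exact: F0.
have term_ge0 J ee x : 0 <= (C1 * mesh r J `^ (alpha - n%:R))%:E *
    (step_fun (mesh r J) (2 ^ J) (offset r ee)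
       (fun s => frac_sum J alpha s (cellF r J ee f)) x)%:E.
  by rewrite mule_ge0// lee_fin ?mulr_ge0 ?powR_ge0// step_fun_ge0.
have mterm J ee : measurable_fun setT (fun x => (C1 * mesh r J `^ (alpha - n%:R))%:E *
    (step_fun (mesh r J) (2 ^ J) (offset r ee)
       (fun s => frac_sum J alpha s (cellF r J ee f)) x)%:E).
  apply: measurable_funeM; apply/measurable_EFinP.
  by apply: measurable_step_fun; exact: mesh_gt0.
have B0 x J : 0 <= boxed r J f x by apply: sume_ge0 => ee _; exact: term_ge0.
pose V J x := einfs (fun J => boxed r J f x) J.
have V0 J x : 0 <= V J x by apply: le_ereal_inf_tmp => _ [J' /= _ <-].
have VB J x : V J x <= boxed r J f x by apply: ereal_inf_lbound; exists J => /=.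
apply: (@mixed_norm_sup_le _ _ _ V) => //.
- move=> J; apply: measurable_fun_einfs => J'.
  by apply: emeasurable_sum => ee; exact: mterm.
- move=> x; exact: nondecreasing_einfs.
- move=> x; rewrite /patch; case: ifP => // _; exact: potential_ge0.
- move=> x; rewrite /patch; case: ifPn => xr.
    apply: potential_le_boxed => //; by move: xr; rewrite inE.
  by apply: le_trans (V0 0%N x) _; apply: ereal_sup_ubound; exists 0%N.
move=> J; apply: (@le_trans _ _ (mixed_norm (fun i => (q i)%:E) (boxed r J f))).
  apply: le_mixed_norm => [i|x]; first by rewrite lte_fin.
  by rewrite !gee0_abs.
rewrite EFinM -muleA; apply: Hs => //.
  by rewrite mule_ge0 ?mixed_norm_ge0// lee_fin mulr_ge0 ?ltW.
move=> ee; set h := mesh r J; have h0 : (0 < h)%R by exact: mesh_gt0.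
rewrite mixed_norm_scale ?mulr_gt0 ?powR_gt0//.
rewrite (mixed_norm_step _ _ h0 q0 (S0 J ee)) -EFinM.
set F := cellF r J ee f.
apply: (@le_trans _ _ (C1 * Cd * (h `^ (\sum_i (p i)^-1) *
    (h^-1 ^+ n * dmix (2 ^ J) (exps p) F)))%:E).
  rewrite lee_fin.
  apply: (@le_trans _ _ (C1 * h `^ (alpha - n%:R) * (h `^ (\sum_i (q i)^-1) *
     (Cd * dmix (2 ^ J) (exps p) F)))%R).
    rewrite ler_wpM2l ?mulr_ge0 ?powR_ge0// ler_wpM2l ?powR_ge0//.
    by apply: Hd => s; exact: F0.
  rewrite [(h `^ (\sum_i (p i)^-1) * (_ * _))%R]mulrA.
  have -> : (h `^ (\sum_i (p i)^-1) * h^-1 ^+ n =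
      h `^ (alpha - n%:R) * h `^ (\sum_i (q i)^-1))%R.
    rewrite -powRD; last by rewrite (gt_eqF h0) implybT.
    rewrite exprVn -powR_mulrn ?(ltW h0)// -powRN -powRD; last first.
      by rewrite (gt_eqF h0) implybT.
    by congr (_ `^ _)%R; rewrite -gainE sumrB; ring.
  by apply: le_of_eq; ring.
rewrite EFinM; apply: lee_wpmul2l; first by rewrite lee_fin mulr_ge0 ?ltW.
apply: le_trans (cell_int_contraction (offset r ee) (2 ^ J) h0 p1 mf f0).
rewrite EFinM; apply: lee_wpmul2l; first by rewrite lee_fin powR_ge0.
rewrite edmix_scale ?exprn_ge0 ?invr_ge0 ?(ltW h0)//; last first.
  by move=> s; exact: cell_int_ge0.
rewrite EFinM; apply: lee_wpmul2l; first by rewrite lee_fin exprn_ge0// invr_ge0 ltW.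
rewrite -edmix_EFin (_ : cell_int _ _ _ = EFin \o F)//.
apply/funext => u; rewrite /= /F /cellF fineK// ge0_fin_numE ?cell_int_ge0//.
exact: le_lt_trans (cell_int_le_integral _ _ _ mf f0) flty.
Qed.

End local_bound.

(** * The estimate over a cube *)

Section exponents.
Context {R : realType}.
Implicit Types (x y : \bar R) (t u v : R).

Lemma recipE (r : R) : r != 0 -> recip r%:E = r^-1.
Proof. by move=> r0; rewrite /recip inver (negbTE r0). Qed.

Lemma recip_pinfty : recip (+oo%E : \bar R) = 0.
Proof. by rewrite /recip invey. Qed.

Lemma recip_ge0 x : (0 < x)%E -> 0 <= recip x.
Proof.
case: x => [r| |]; [|by rewrite recip_pinfty|by rewrite ltNge leNye].
by rewrite lte_fin => r0; rewrite recipE ?gt_eqF// invr_ge0 ltW.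
Qed.

Lemma recip_lt1 x : (1 < x)%E -> recip x < 1.
Proof.
case: x => [r| |]; [|by rewrite recip_pinfty|by rewrite ltNge leNye].
rewrite lte_fin => r1; have r0 : 0 < r by lra.
by rewrite recipE ?gt_eqF// invf_lt1.
Qed.

Lemma le_recip x y : (0 < x)%E -> (x <= y)%E -> recip y <= recip x.
Proof.
case: y => [s| |]; last by case: x.
  case: x => [r| |]; [|by rewrite leye_eq|by rewrite ltNge leNye]; rewrite lte_fin lee_fin => r0 rs.
  have s0 : 0 < s by lra.
  by rewrite !recipE ?gt_eqF// lef_pV2.
by move=> x0 _; rewrite recip_pinfty recip_ge0.
Qed.

Lemma recip_le_inv x t : (0 < x)%E -> 0 < t -> recip x <= t -> (t^-1%:E <= x)%E.
Proof.
case: x => [r| |]; [|by rewrite leey|by rewrite ltNge leNye].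
rewrite lte_fin lee_fin => r0 t0; rewrite recipE ?gt_eqF// => rt.
by rewrite -[leRHS]invrK lef_pV2 ?posrE// invr_gt0.
Qed.

(* [ab] is the pair of reciprocals of the new exponents: the old pair, adjusted
   so that the first entry is not below the second, is moved towards (1, 0). *)
Lemma interpolated_exponents t u v : 0 < t < 1 -> 0 <= u < 1 -> 0 < v ->
  exists ab : R * R, [/\ u <= ab.1, ab.1 < 1, 0 < ab.2, ab.2 <= v &
    ab.1 - ab.2 = (1 - t) * Num.max (u - v) 0 + t].
Proof.
move=> /andP[t0 t1] /andP[u0 u1] v0; have [vu|uv] := leP v u.
  exists ((1 - t) * u + t, (1 - t) * v); rewrite max_l ?subr_ge0//=.
  by split; [nra|nra|nra|nra|ring].
have [w [w0 w1 uw wv]] : exists w, [/\ 0 < w, w < 1, u <= w & w <= v].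
  have [v1|v1] := leP v 2^-1; first by exists v; split => //; lra.
  have [u2|u2] := leP u 2^-1; first by exists 2^-1; split => //; lra.
  by exists u; split => //; lra.
exists ((1 - t) * w + t, (1 - t) * w); rewrite max_r ?subr_le0 ?(ltW uv)//=.
by split; [nra|nra|nra|nra|ring].
Qed.

(** In the strict case the sum S of positive parts is the least gain that admissible exponents can
    have, and it is below alpha; the reciprocals (1, 0) in every coordinate would give n > alpha.
    The parameter t solves (1 - t) S + t n = alpha. At the endpoint the given exponents already have
    gain alpha. *)
Lemma hls_exponents n alpha (p1 p2 : 'I_n -> \bar R) :
  alpha < n%:R ->
  (forall i, [/\ (1 < p1 i)%E, (0 < p2 i)%E & (p2 i < +oo)%E]) ->
  ((forall i, (p1 i <= p2 i)%E) /\
    \sum_i recip (p1 i) - \sum_i recip (p2 i) = alpha) \/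
  \sum_i Num.max (recip (p1 i) - recip (p2 i)) 0 < alpha ->
  exists p q : 'I_n -> R, [/\ forall i, 1 < p i, forall i, p i <= q i,
    forall i, ((p i)%:E <= p1 i)%E, forall i, (p2 i <= (q i)%:E)%E &
    \sum_i ((p i)^-1 - (q i)^-1) = alpha].
Proof.
move=> alpha_lt hp [[p12 gainE]|gain_lt].
  exists (fun i => fine (p1 i)), (fun i => fine (p2 i)).
  have f1 i : p1 i \is a fin_num.
    have [p1i _ p2i] := hp i; rewrite ge0_fin_numE; last by apply: ltW; exact: lt_trans p1i.
    exact: le_lt_trans (p12 i) p2i.
  have f2 i : p2 i \is a fin_num.
    by have [_ p20 p2i] := hp i; rewrite ge0_fin_numE// ltW.
  split => [i|i|i|i|].
  - by have [+ _ _] := hp i; rewrite -lte_fin fineK.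
  - by rewrite fine_le.
  - by rewrite fineK.
  - by rewrite fineK.
  rewrite -gainE -sumrB; apply: eq_bigr => i _.
  have [p1i p2i _] := hp i.
  rewrite -(fineK (f1 i)) -(fineK (f2 i)) !recipE//.
    by rewrite gt_eqF// -lte_fin fineK.
  by rewrite gt_eqF// -lte_fin fineK//; exact: lt_trans p1i.
set S := \sum_i _ in gain_lt.
pose t := (alpha - S) / (n%:R - S).
have D0 : 0 < n%:R - S by rewrite subr_gt0 (lt_trans gain_lt).
have t01 : 0 < t < 1.
  apply/andP; split; first by rewrite /t divr_gt0// subr_gt0.
  by rewrite /t ltr_pdivrMr// mul1r ltrD2r.
have recip2_gt0 i : 0 < recip (p2 i).
  have [_ p20 p2y] := hp i; rewrite -(@fineK _ (p2 i)); last by rewrite ge0_fin_numE// ltW.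
  have r0 : 0 < fine (p2 i) by rewrite fine_gt0// p20.
  by rewrite recipE ?gt_eqF// invr_gt0.
have p1_gt0 i : (0 < p1 i)%E by have [p1i _ _] := hp i; exact: lt_trans p1i.
have /choice[ab Hab] i : exists ab : R * R, [/\ recip (p1 i) <= ab.1, ab.1 < 1,
    0 < ab.2, ab.2 <= recip (p2 i) &
    ab.1 - ab.2 = (1 - t) * Num.max (recip (p1 i) - recip (p2 i)) 0 + t].
  apply: interpolated_exponents => //; rewrite recip_ge0//=.
  by have [p1i _ _] := hp i; exact: recip_lt1.
have diff i : (ab i).2 < (ab i).1.
  have [_ _ _ _ E] := Hab i; rewrite -subr_gt0 E.
  have := t01 => /andP[t0 t1].
  by rewrite ltr_wpDl// mulr_ge0 ?subr_ge0 ?(ltW t1)// le_max lexx orbT.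
have a0 i : 0 < (ab i).1 by have [_ _ b0 _ _] := Hab i; exact: lt_trans b0 (diff i).
exists (fun i => (ab i).1^-1), (fun i => (ab i).2^-1); split => [i|i|i|i|].
- by have [_ a1 _ _ _] := Hab i; rewrite invf_gt1.
- by have [_ _ b0 _ _] := Hab i; rewrite lef_pV2 ?posrE// ltW.
- by have [ua _ _ _ _] := Hab i; exact: recip_le_inv.
- have [_ p20 p2y] := hp i; have [_ _ b0 bv _] := Hab i.
  have f2 : p2 i \is a fin_num by rewrite ge0_fin_numE// ltW.
  have r0 : 0 < fine (p2 i) by rewrite fine_gt0// p20.
  move: bv; rewrite -(fineK f2) recipE ?gt_eqF// lee_fin => bv.
  by rewrite -[leLHS]invrK lef_pV2 ?posrE// invr_gt0.
under eq_bigr do rewrite !invrK.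
transitivity (\sum_i ((1 - t) * Num.max (recip (p1 i) - recip (p2 i)) 0 + t)).
  by apply: eq_bigr => i _; have [] := Hab i.
rewrite big_split/= -mulr_sumr -/S sumr_const card_ord -mulr_natr.
have -> : (1 - t) * S + t * n%:R = S + t * (n%:R - S) by ring.
by rewrite /t mulfVK ?gt_eqF//; ring.
Qed.

End exponents.

Section negative_powers.
Context {R : realType}.
Implicit Types (s x y b : R).

Lemma powR_anti s x y : 0 <= s -> 0 < x -> x <= y -> y `^ (- s) <= x `^ (- s).
Proof.
move=> s0 x0 xy; have y0 : 0 < y by exact: lt_le_trans xy.
rewrite !powRN lef_pV2 ?posrE ?(powR_gt0 s x0) ?(powR_gt0 s y0)//.
exact: (ler_powRl s0 (ltW x0) xy).
Qed.

Lemma powR_oppVK s b : 0 < s -> 0 < b -> (b `^ (- s)) `^ (- s^-1) = b.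
Proof. by move=> s0 b0; rewrite -powRrM mulrNN mulfV ?gt_eqF// powRr1// ltW. Qed.

Lemma powR_oppKV s b : 0 < s -> 0 < b -> (b `^ (- s^-1)) `^ (- s) = b.
Proof. by move=> s0 b0; rewrite -powRrM mulrNN mulVf ?gt_eqF// powRr1// ltW. Qed.

Lemma powR_opp_lt s x b : 0 < s -> 0 < x -> 0 < b ->
  (b `^ (- s^-1) < x) = (x `^ (- s) < b).
Proof.
move=> s0 x0 b0; have si0 : 0 <= s^-1 by rewrite invr_ge0 ltW.
rewrite !ltNge; congr (~~ _); apply/idP/idP => H.
  by rewrite -[leLHS](powR_oppKV s0 b0); exact: powR_anti (ltW s0) x0 H.
by rewrite -[leLHS](powR_oppVK s0 x0); exact: powR_anti si0 b0 H.
Qed.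

End negative_powers.

Section dyadic_sums.
Context {R : realType}.
Local Open Scope ereal_scope.
Implicit Types (s r : R) (N : R -> \bar R).

Definition dyadic_sum s N r J : \bar R :=
  \sum_(j < J) (((2 ^ j)%:R * r) `^ (- s))%:E * N ((2 ^ j)%:R * r)%R.

Lemma dyadic_sum_ge s N r J j : (forall t, 0 <= N t) -> (j < J)%N ->
  (((2 ^ j)%:R * r) `^ (- s))%:E * N ((2 ^ j)%:R * r)%R <= dyadic_sum s N r J.
Proof.
move=> N0 jJ; rewrite /dyadic_sum (bigD1 (Ordinal jJ))//= leeDl//.
by apply: sume_ge0 => i _; rewrite mule_ge0// lee_fin powR_ge0.
Qed.

Lemma dyadic_sum_shift s N r J m : (forall t, 0 <= N t) ->
  \sum_(j < J) (((2 ^ (m + j))%:R * r) `^ (- s))%:E * N ((2 ^ (m + j))%:R * r)%R <=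
  dyadic_sum s N r (m + J).
Proof.
by move=> N0; rewrite /dyadic_sum big_split_ord/= leeDr// sume_ge0// => j _;
  rewrite mule_ge0// lee_fin powR_ge0.
Qed.

(** With b_j = 2^j r and a_j = b_j^(-s), the intervals ]a_(j+1), a_j[ are disjoint in ]0, r^(-s)[
    and have length (1 - 2^(-s)) a_j. On them t^(-1/s) > b_j, so the monotone N is at least N(b_j):
    the left side is the integral of a step function below the Hardy integrand. *)
Lemma dyadic_sum_le_hardy s N r J : (0 < s)%R -> (0 < r)%R ->
  (forall t, 0 <= N t) -> (forall t u, (0 < t)%R -> (t <= u)%R -> N t <= N u) ->
  (1 - 2 `^ (- s))%:E * dyadic_sum s N r J <=
  hardy (fun t => N (t `^ (- s^-1))%R) (r `^ (- s)).
Proof.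
move=> s0 r0 N0 ndN; set c := (1 - 2 `^ (- s))%R.
pose b j : R := ((2 ^ j)%:R * r)%R; pose a j : R := (b j `^ (- s))%R.
have b0 j : (0 < b j)%R by rewrite mulr_gt0// pow2_gt0.
have a0 j : (0 < a j)%R by exact: powR_gt0.
have aS j : (a j.+1 = 2 `^ (- s) * a j)%R.
  by rewrite /a /b pow2S -mulrA powRM// ltW// (b0 j).
have c_gt0 : (0 < c)%R.
  by rewrite subr_gt0 powRN invf_lt1 ?powR_gt0//; exact: powR2_gt1.
have aSlt j : (a j.+1 < a j)%R.
  by rewrite aS -subr_gt0 -[X in (X - _)%R]mul1r -mulrBl mulr_gt0.
have a00 : (a 0%N = r `^ (- s))%R by rewrite /a /b expn0 mul1r.
have mI j : measurable (`]a j.+1, a j[%classic : set (measurableTypeR R)).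
  exact: measurable_itv.
have muI j : lebesgue_measure (`]a j.+1, a j[%classic : set (measurableTypeR R)) =
    (a j - a j.+1)%:E.
  by rewrite lebesgue_measure_itv /= lte_fin aSlt.
pose G j := (cst (N (b j)) \_ `]a j.+1, a j[%classic) : R -> \bar R.
have G0 j x : 0 <= G j x by rewrite /G /patch; case: ifP => // _; exact: N0.
have mG j : measurable_fun setT (G j).
  by apply/(measurable_restrictT _ _).1 => //; exact: measurable_cst.
have -> : c%:E * dyadic_sum s N r J =
    \int[@lebesgue_measure R]_x \sum_(j < J) G j x.
  rewrite ge0_integral_sum//; last by move=> j; exact: mG.
  rewrite /dyadic_sum ge0_sume_distrr; last first.
    by move=> j _; rewrite mule_ge0// lee_fin powR_ge0.
  apply: eq_bigr => j _; rewrite -integral_mkcond integral_cst//.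
  rewrite [X in _ = _ * X]muI muleA -EFinM muleC.
  by congr (_ * _%:E); rewrite aS -/(a j) /c; ring.
rewrite /hardy [leRHS]integral_mkcond -a00.
apply: le_lower_integral => x; first exact: sume_ge0.
have below : \sum_(j < J) G j x <=
    ((fun t => N (t `^ (- s^-1))%R) \_ `]a J, a 0%N[%classic) x.
  elim: J => [|J IH].
    by rewrite big_ord0 /patch; case: ifP => // _; exact: N0.
  rewrite big_ord_recr/= {2}/G /patch; have [xJ|xJ] := boolP (x \in `]a J.+1, a J[%classic).
    have /andP[x1 x2] : (a J.+1 < x < a J)%R by move: xJ; rewrite inE/= in_itv.
    have -> : \sum_(j < J) G j x = 0.
      apply/eqP; rewrite eq_le sume_ge0// andbT; apply: (le_trans IH).
      rewrite /patch memNset//= in_itv/= => /andP[x3 _].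
      by move: (lt_trans x2 x3); rewrite ltxx.
    have aJ0 : (a J <= a 0%N)%R.
      have D i : (a i.+1 <= a i)%R by exact: ltW.
      by elim: (J) => // i ih; exact: le_trans (D i) ih.
    rewrite add0e mem_set/=; last by rewrite in_itv/= x1 (lt_le_trans x2).
    apply: ndN => //; rewrite -[b J](powR_oppVK s0)//.
    apply: powR_anti; [by rewrite invr_ge0 ltW|exact: lt_trans x1|exact: ltW].
  rewrite adde0; apply: (le_trans IH); rewrite /patch.
  case: ifPn => [xi|_]; last by case: ifP => // _; exact: N0.
  rewrite mem_set//=; move: xi; rewrite inE/= !in_itv/= => /andP[x3 ->].
  by rewrite andbT (lt_trans _ x3).
apply: (le_trans below); rewrite /patch; case: ifPn => [xi|_]; last by case: ifP => // _; exact: N0.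
rewrite mem_set//=; move: xi; rewrite inE/= !in_itv/= => /andP[x3 ->].
by rewrite andbT (lt_trans _ x3).
Qed.

End dyadic_sums.

Section cubes.
Context {R : realType}.
Local Open Scope ereal_scope.

Lemma measurable_cube n (r : R) : measurable (cube (origin R n) r).
Proof.
rewrite (_ : cube _ _ = \bigcap_(i in [set: 'I_n])
  ((fun y : euclidean R n => tnth y i) @^-1` `](- r)%R, r[%classic)).
  apply: fin_bigcap_measurable => // i _; rewrite -[X in measurable X]setTI.
  by apply: measurable_tnth => //; exact: measurable_itv.
apply/seteqP; split => [y H i _|y H i] /=.
  by have := H i; rewrite /origin tnth_mktuple subr0 in_itv/= -ltr_norml.
by have := H i I; rewrite /= /origin tnth_mktuple subr0 in_itv/= -ltr_norml.
Qed.

Lemma le_cube n (r t : R) : (r <= t)%R -> cube (origin R n) r `<=` cube (origin R n) t.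
Proof. by move=> rt y H i; exact: lt_le_trans rt. Qed.

Lemma mixed_norm_pinfty_le n (f : euclidean R n -> \bar R) B :
  (forall x, `|f x| <= B) -> mixed_norm (fun=> +oo) f <= B.
Proof.
elim: n f => [|n IH] f fB /=; first exact: fB.
apply: IH => y; rewrite gee0_abs ?Lnorm_ge0// unlock.
case: ifPn => [_|_]; last by apply: le_trans (fB (tcons (0%R, y))).
by apply/ess_supP; apply: nearW => t; exact: fB.
Qed.

Lemma mixed_norm_cube_le n (u : 'I_n -> R) (r : R) f B : (0 < r)%R ->
  (forall i, 0 < u i)%R -> measurable_fun setT f -> (forall x, 0 <= f x) ->
  (forall x, cube (origin R n) r x -> f x <= B) -> 0 <= B ->
  mixed_norm (fun i => (u i)%:E) (f \_ (cube (origin R n) r)) <=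
  ((2 * r) `^ (\sum_i (u i)^-1))%:E * B.
Proof.
move=> r0 u0 mf f0 fB B0; set g := f \_ _.
have g0 x : 0 <= g x by rewrite /g /patch; case: ifP.
have mg : measurable_fun setT g.
  apply/(measurable_restrictT _ _).1; first exact: measurable_cube.
  exact: measurable_funTS.
have gE x : ~ cube (origin R n) r x -> g x = 0.
  by move=> xr; rewrite /g /patch memNset.
apply: (le_trans (@mixed_norm_embedding _ n u (fun=> +oo) r g r0 u0 _ mg g0 gE)).
  by move=> i; rewrite leey.
under eq_bigr do rewrite recip_pinfty subr0.
apply: lee_wpmul2l; first by rewrite lee_fin powR_ge0.
apply: mixed_norm_pinfty_le => x; rewrite gee0_abs// /g /patch.
by case: ifPn => // xr; apply: fB; move: xr; rewrite inE.
Qed.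

Lemma integral_cube_le n (v : 'I_n -> \bar R) (r : R) f : (0 < r)%R ->
  (forall i, 1 < v i) -> measurable_fun setT f -> (forall x, 0 <= f x) ->
  \int[lebesgue R n]_x (f \_ (cube (origin R n) r)) x <=
  ((2 * r) `^ (n%:R - \sum_i recip (v i)))%:E *
  mixed_norm_on v (cube (origin R n) r) f.
Proof.
move=> r0 v1 mf f0; rewrite /mixed_norm_on; set g := f \_ _.
have g0 x : 0 <= g x by rewrite /g /patch; case: ifP.
have mg : measurable_fun setT g.
  apply/(measurable_restrictT _ _).1; first exact: measurable_cube.
  exact: measurable_funTS.
have gE x : ~ cube (origin R n) r x -> g x = 0.
  by move=> xr; rewrite /g /patch memNset.
rewrite -mixed_norm1//.
apply: (le_trans (@mixed_norm_embedding _ n (fun=> 1%R) v r g r0 _ _ mg g0 gE)) => //.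
  by move=> i; exact: ltW.
by rewrite sumrB sumr_const card_ord invr1.
Qed.

End cubes.

Section pointwise.
Context {R : realType} (n : nat) (alpha : R).
Local Open Scope ereal_scope.
Implicit Types (f : euclidean R n -> \bar R) (x y : euclidean R n) (r t : R).
Implicit Type v : 'I_n -> \bar R.

Lemma le_mixed_norm_on v r t f : (forall i, 0 < v i) -> (r <= t)%R ->
  (forall x, 0 <= f x) ->
  mixed_norm_on v (cube (origin R n) r) f <= mixed_norm_on v (cube (origin R n) t) f.
Proof.
move=> v0 rt f0; apply: le_mixed_norm => // x; rewrite /patch.
case: ifPn => [xr|_]; last by rewrite abse0 abse_ge0.
by rewrite mem_set//; apply: le_cube rt _ _; move: xr; rewrite inE.
Qed.

Lemma cube_cover r y : (0 < r)%R -> exists j, cube (origin R n) ((2 ^ j)%:R * r) y.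
Proof.
move=> r0; pose M := (\sum_i `|tnth y i|)%R.
have M0 : (0 <= M / r)%R by rewrite divr_ge0 ?(ltW r0)// sumr_ge0.
exists (Num.bound (M / r)) => i; rewrite /origin tnth_mktuple subr0.
apply: (@le_lt_trans _ _ M).
  by rewrite /M (bigD1 i)//= lerDl sumr_ge0.
rewrite -ltr_pdivrMr//; apply: (lt_trans (archi_boundP M0)).
by rewrite ltr_nat ltn_expl.
Qed.

Lemma far_kernel_le r j x y : (0 < r)%R -> (alpha <= n%:R)%R ->
  cube (origin R n) r x -> ~ cube (origin R n) ((2 ^ j.+1)%:R * r) y ->
  (riesz_kernel alpha x y <= ((2 ^ j)%:R * r) `^ (alpha - n%:R))%R.
Proof.
move=> r0 an xr /existsNP[i /negP]; rewrite -leNgt => yi.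
have d0 : (0 < (2 ^ j)%:R * r)%R by rewrite mulr_gt0// pow2_gt0.
apply: riesz_kernel_le => //; apply: le_trans (coord_le_dist x y i).
move: yi (xr i); rewrite /origin !tnth_mktuple !subr0 pow2S => yi xi.
have r1 : (r <= (2 ^ j)%:R * r)%R.
  by rewrite ler_peMl ?(ltW r0)// ler1n expn_gt0.
have := ler_normD (tnth y i - tnth x i)%R (tnth x i : R); rewrite subrK distrC => H.
lra.
Qed.

(** A point outside Q(0, 2r) lies, for some j, in Q(0, 2^(j+2) r) or on its inner side down to the
    complement of Q(0, 2^(j+1) r), where the kernel is at most (2^j r)^(alpha - n). The shell is
    enlarged to the whole cube, on which Hoelder's inequality gives (2^(j+3) r)^(n - sum 1/v_i).
    Rewriting both in terms of 2^(j+2) r leaves the exponent -sigma and the factors with bases 4 and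
    2. *)
Lemma far_potential_le v r f x M : (0 < r)%R -> (alpha <= n%:R)%R ->
  (forall i, 1 < v i) -> measurable_fun setT f -> (forall y, 0 <= f y) ->
  cube (origin R n) r x ->
  (forall J, dyadic_sum (sigma alpha v)
     (fun t => mixed_norm_on v (cube (origin R n) t) f) r J <= M) ->
  potential alpha (f \_ (~` cube (origin R n) (2 * r))) x <=
  (4 `^ (n%:R - alpha) * 2 `^ (n%:R - \sum_i recip (v i)))%:E * M.
Proof.
move=> r0 an v1 mf f0 xr HM.
have v0 i : 0 < v i by exact: lt_trans (v1 i).
set S := (\sum_i _)%R; set C := (4 `^ _ * _)%R.
set N := fun t : R => _ in HM.
have N0 t : 0 <= N t by exact: mixed_norm_ge0.
pose c j : R := (((2 ^ j)%:R * r) `^ (alpha - n%:R))%R.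
have c0 j : (0 <= c j)%R by exact: powR_ge0.
pose q j : set (euclidean R n) := cube (origin R n) ((2 ^ (2 + j))%:R * r).
have mq j : measurable (q j) by exact: measurable_cube.
have mind j : measurable_fun setT (fun y => (\1_(q j) y)%:E : \bar R).
  by apply/measurable_EFinP; apply: measurable_indic.
pose G J y := f y * (\sum_(j < J) c j * \1_(q j) y)%:E.
have G0 J y : 0 <= G J y.
  by rewrite mule_ge0// lee_fin sumr_ge0// => j _; rewrite mulr_ge0.
have GE J y : G J y = \sum_(j < J) (c j)%:E * (f \_ (q j)) y.
  rewrite /G -sumEFin ge0_sume_distrr; last first.
    by move=> j _; rewrite lee_fin mulr_ge0.
  by apply: eq_bigr => j _; rewrite EFinM muleCA epatch_indic.
have mG J : measurable_fun setT (G J).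
  apply: emeasurable_funM => //; apply/measurable_EFinP.
  apply: measurable_sum => j; exact: measurable_funM.
apply: (@le_trans _ _ (\int[lebesgue R n]_y ereal_sup (range (G^~ y)))).
  apply: le_lower_integral => y.
    by rewrite mule_ge0 ?lee_fin ?riesz_kernel_ge0// /patch; case: ifP.
  rewrite /patch; case: ifPn => [|_]; last first.
    by rewrite mul0e; apply: le_trans (G0 0%N y) _; apply: ereal_sup_ubound; exists 0%N.
  rewrite inE /= => yr; have [j yj] := cube_cover y r0.
  have [k yk kmin] : exists2 k, cube (origin R n) ((2 ^ k.+1)%:R * r) y &
      ~ cube (origin R n) ((2 ^ k)%:R * r) y.
    elim: j yj => [|j IH] yj.
      exfalso; apply: yr; apply: le_cube yj; rewrite expn0 mul1r; lra.
    have [yj'|] := pselect (cube (origin R n) ((2 ^ j)%:R * r) y); first exact: IH.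
    by exists j.
  case: k yk kmin => [|k] yk kmin.
    by exfalso; apply: yr; move: yk; rewrite expn1.
  apply: (@le_trans _ _ (G k.+1 y)); last by apply: ereal_sup_ubound; exists k.+1.
  apply: lee_wpmul2l => //; rewrite lee_fin big_ord_recr/= indicE mem_set// mulr1.
  apply: (le_trans (far_kernel_le r0 an xr kmin)).
  by rewrite lerDr sumr_ge0// => i _; rewrite mulr_ge0.
apply: integral_sup_le => // [y|J].
  apply/nondecreasing_seqP => J; apply: lee_wpmul2l => //.
  by rewrite lee_fin big_ord_recr/= lerDl mulr_ge0.
have g0 j y : 0 <= (f \_ (q j)) y by rewrite /patch; case: ifP.
under eq_integral do rewrite GE.
rewrite ge0_integral_sum//; last 2 first.
- move=> j; apply: measurable_funeM; apply/(measurable_restrictT _ _).1 => //.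
  exact: measurable_funTS.
- by move=> j y _; rewrite mule_ge0 ?lee_fin.
apply: (@le_trans _ _ (C%:E * dyadic_sum (sigma alpha v) N r (2 + J))); last first.
  by apply: lee_wpmul2l; rewrite ?lee_fin ?mulr_ge0 ?powR_ge0.
apply: (@le_trans _ _ (C%:E * (\sum_(j < J)
   (((2 ^ (2 + j))%:R * r) `^ (- sigma alpha v))%:E * N ((2 ^ (2 + j))%:R * r)%R))); last first.
  apply: lee_wpmul2l; first by rewrite lee_fin mulr_ge0 ?powR_ge0.
  exact: dyadic_sum_shift.
rewrite ge0_sume_distrr; last by move=> j _; rewrite mule_ge0// lee_fin powR_ge0.
apply: lee_sum => j _; set b := ((2 ^ (2 + j))%:R * r)%R.
have d0 : (0 < (2 ^ j)%:R * r)%R by rewrite mulr_gt0// pow2_gt0.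
have bE : (b = 4 * ((2 ^ j)%:R * r))%R by rewrite /b expnD natrM mulrA.
have b0 : (0 < b)%R by rewrite bE mulr_gt0.
have [cj|cj] := eqVneq (c j) 0%R.
  by move: d0 => /(powR_gt0 (alpha - n%:R)); rewrite -/(c j) cj ltxx.
have cj0 : (0 < c j)%R by rewrite lt_neqAle eq_sym cj c0.
rewrite lower_integral_scale//.
apply: (@le_trans _ _ ((c j)%:E * (((2 * b) `^ (n%:R - S))%:E * N b))).
  apply: lee_wpmul2l; first by rewrite lee_fin.
  exact: integral_cube_le.
rewrite !muleA -!EFinM; apply: le_of_eq.
congr (_%:E * _); rewrite /C -/S.
have -> : (- sigma alpha v = (alpha - n%:R) + (n%:R - S))%R.
  by rewrite /sigma -/S; ring.
rewrite powRM ?(ltW b0)// powRD; last by rewrite (gt_eqF b0) implybT.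
rewrite [in X in (_ = _ * (X `^ (alpha - n%:R) * _))%R]bE powRM ?(ltW d0)//.
rewrite -/(c j).
have -> : (4 `^ (n%:R - alpha) = (4 `^ (alpha - n%:R))^-1 :> R)%R.
  by rewrite -powRN opprB.
have : (4 `^ (alpha - n%:R) != 0 :> R)%R by rewrite gt_eqF// powR_gt0.
move: (4 `^ _)%R (2 `^ _)%R (b `^ _)%R => A B D A0.
by field.
Qed.

End pointwise.

Section cube_bound.
Context {R : realType} (n : nat) (alpha : R).
Local Open Scope ereal_scope.
Implicit Types (f : euclidean R n -> \bar R) (r : R).

Lemma potential_cube_bound (p1 p2 : 'I_n -> \bar R) (p q : 'I_n -> R) :
  (0 < alpha < n%:R)%R -> (0 < sigma alpha p1)%R ->
  (forall i, [/\ 1 < p1 i, 0 < p2 i & p2 i < +oo]) ->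
  (forall i, 1 < p i)%R -> (forall i, p i <= q i)%R ->
  (forall i, (p i)%:E <= p1 i) -> (forall i, p2 i <= (q i)%:E) ->
  (\sum_i ((p i)^-1 - (q i)^-1) = alpha)%R ->
  exists2 C : R, (0 < C)%R &
  forall r f, (0 < r)%R -> measurable_fun setT f -> (forall y, 0 <= f y) ->
    mixed_norm_on p2 (cube (origin R n) r) (potential alpha f) <=
    (C * r `^ (\sum_i recip (p2 i)))%:E *
    hardy (fun t => mixed_norm_on p1
      (cube (origin R n) (t `^ (- (sigma alpha p1)^-1))) f)
      (r `^ (- sigma alpha p1)).
Proof.
move=> /andP[alpha0 alpha_lt] sg0 hp p_gt1 pq pp1 p2q gainE.
set sg := sigma alpha p1 in sg0 *.
have p1_gt1 i : 1 < p1 i by have [] := hp i.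
have p1_gt0 i : 0 < p1 i by exact: lt_trans (p1_gt1 i).
pose s i := fine (p2 i).
have p2E : p2 = fun i => (s i)%:E.
  apply/funext => i; have [_ p20 p2y] := hp i.
  by rewrite /s fineK// ge0_fin_numE// ltW.
have s0 i : (0 < s i)%R by have [_ + _] := hp i; rewrite p2E lte_fin.
have p0 i : (0 < p i)%R by have := p_gt1 i; lra.
have q0 i : (0 < q i)%R by exact: lt_le_trans (pq i).
have pq_neq : exists i, p i != q i.
  apply: contrapT => /forallNP H; move: alpha0; rewrite -gainE big1 ?ltxx// => i _.
  by have /negP := H i; rewrite negbK => /eqP ->; rewrite subrr.
have [Cl Cl0 HCl] := local_potential_bound alpha_lt p_gt1 pq pq_neq gainE.
have [Ca Ca0 HCa] := mixed_norm_add_le s0.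
pose S2 := (\sum_i (s i)^-1)%R.
have S2E : (\sum_i recip (p2 i) = S2)%R.
  by apply: eq_bigr => i _; rewrite p2E recipE// gt_eqF.
(* [e1] and [e2] are the powers of the side lost in passing from q to p2 and from p1 to p; together
   with sigma they make up the exponent of r in the claim, which is [eE]. *)
pose e1 := (\sum_i ((s i)^-1 - recip (q i)%:E))%R.
pose e2 := (\sum_i ((p i)^-1 - recip (p1 i)))%R.
have eE : (e1 + e2 + sg = S2)%R.
  rewrite /e1 /e2 /sg /sigma /S2 -gainE !sumrB.
  have -> : (\sum_i recip (q i)%:E = \sum_i (q i)^-1)%R.
    by apply: eq_bigr => i _; rewrite recipE// gt_eqF.
  ring.
pose Cf := (4 `^ (n%:R - alpha) * 2 `^ (n%:R - \sum_i recip (p1 i)))%R.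
pose c := (1 - 2 `^ (- sg))%R.
have c0 : (0 < c)%R.
  by rewrite subr_gt0 powRN invf_lt1 ?powR_gt0//; exact: powR2_gt1.
have Cf0 : (0 < Cf)%R by rewrite mulr_gt0 ?powR_gt0.
have two0 : (0 < 2 :> R)%R by [].
exists (Ca * (Cl * 2 `^ e2 * 2 `^ S2 + 2 `^ S2 * Cf) / c)%R.
  by rewrite divr_gt0// mulr_gt0// addr_gt0// !mulr_gt0// ?(powR_gt0 _ two0).
move=> r f r0 mf f0.
pose N t := mixed_norm_on p1 (cube (origin R n) t) f.
have N0 t : 0 <= N t by exact: mixed_norm_ge0.
have ndN t u : (0 < t)%R -> (t <= u)%R -> N t <= N u.
  by move=> _ tu; exact: le_mixed_norm_on.
rewrite S2E; set H := hardy _ _.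
have H0 : 0 <= H by apply: integral_ge0 => t _; exact: mixed_norm_ge0.
pose M := (c^-1)%:E * H.
have M0 : 0 <= M by rewrite mule_ge0// lee_fin invr_ge0 ltW.
have HM J : dyadic_sum sg N r J <= M.
  rewrite /M muleC lee_pdivlMr// muleC.
  exact: dyadic_sum_le_hardy.
(* If the Hardy integral is infinite there is nothing to prove. Otherwise the single term j = 1 of
   the dyadic sum bounds the norm over Q(0, 2r), and [f] is integrable there, as
   [local_potential_bound] requires. *)
have [Hy|Hfin] := eqVneq H +oo.
  rewrite Hy gt0_muley ?leey// lte_fin mulr_gt0 ?powR_gt0//.
  by rewrite divr_gt0// mulr_gt0// addr_gt0// !mulr_gt0// ?(powR_gt0 _ two0).
have Mfin : M < +oo.
  by rewrite lte_mul_pinfty ?lee_fin ?invr_ge0 ?(ltW c0)// lt_neqAle Hfin leey.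
have r20 : (0 < 2 * r)%R by rewrite mulr_gt0.
have N2 : N (2 * r)%R <= ((2 * r) `^ sg)%:E * M.
  have := le_trans (@dyadic_sum_ge _ sg N r 2 1 N0 isT) (HM 2%N).
  rewrite expn1 powRN => H2.
  rewrite muleC -lee_pdivrMr ?powR_gt0// muleC.
  exact: H2.
have N2fin : N (2 * r)%R < +oo.
  by apply: le_lt_trans N2 _; rewrite lte_mul_pinfty ?lee_fin ?powR_ge0.
set Q2 := cube (origin R n) (2 * r); set Q1 := cube (origin R n) r.
pose fl := f \_ Q2; pose fr := f \_ (~` Q2).
have mQ2 : measurable Q2 by exact: measurable_cube.
have mQ1 : measurable Q1 by exact: measurable_cube.
have mfl : measurable_fun setT fl.
  by apply/(measurable_restrictT _ _).1 => //; exact: measurable_funTS.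
have mfr : measurable_fun setT fr.
  apply/(measurable_restrictT _ _).1; first exact: measurableC.
  exact: measurable_funTS.
have fl0 y : 0 <= fl y by rewrite /fl /patch; case: ifP.
have fr0 y : 0 <= fr y by rewrite /fr /patch; case: ifP.
have flE y : ~ Q2 y -> fl y = 0 by move=> yr; rewrite /fl /patch memNset.
have fD y : f y = fl y + fr y.
  rewrite /fl /fr /patch; have [yQ|yQ] := pselect (Q2 y).
    by rewrite mem_set// memNset ?adde0// => /(_ yQ).
  by rewrite memNset// mem_set// add0e.
have K0 (x y : euclidean R n) : 0 <= (riesz_kernel alpha x y)%:E.
  by rewrite lee_fin riesz_kernel_ge0.
have mK (x : euclidean R n) : measurable_fun setT (fun y => (riesz_kernel alpha x y)%:E : \bar R).
  apply/measurable_EFinP.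
  have := measurableT_comp (@measurable_riesz_kernel R n alpha)
    (@measurable_pair1 _ _ (euclidean R n) (euclidean R n) x); exact.
have potD x : potential alpha f x = potential alpha fl x + potential alpha fr x.
  rewrite /potential -ge0_integralD//.
  - by apply: eq_integral => y _; rewrite fD ge0_muleDl.
  - by move=> y _; exact: mule_ge0.
  - exact: emeasurable_funM.
  - by move=> y _; exact: mule_ge0.
  - exact: emeasurable_funM.
pose Pl := potential alpha fl \_ Q1; pose Pr := potential alpha fr \_ Q1.
have mP g : measurable_fun setT g -> (forall y, 0 <= g y) ->
    measurable_fun setT (potential alpha g \_ Q1).
  move=> mg g0; apply/(measurable_restrictT _ _).1 => //; apply: measurable_funTS.
  exact: measurable_potential.
have P0 g x : (forall y, 0 <= g y) -> 0 <= (potential alpha g \_ Q1) x.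
  by move=> g0; rewrite /patch; case: ifP => // _; exact: potential_ge0.
have PE : potential alpha f \_ Q1 = fun x => Pl x + Pr x.
  apply/funext => x; rewrite /Pl /Pr /patch; case: ifP => _; first exact: potD.
  by rewrite adde0.
rewrite /mixed_norm_on PE p2E.
have bound_l : mixed_norm (fun i => (s i)%:E) Pl <=
    (Cl * 2 `^ e2 * 2 `^ S2 * r `^ S2)%:E * M.
  have sq i : (s i)%:E <= (q i)%:E by have := p2q i; rewrite p2E.
  apply: (le_trans (@mixed_norm_embedding _ n s (fun i => (q i)%:E) r Pl r0 s0 sq _ _ _)).
  - exact: mP.
  - by move=> x; exact: P0.
  - by move=> x xr; rewrite /Pl /patch memNset.
  have flfin : \int[lebesgue R n]_y fl y < +oo.
    apply: le_lt_trans (integral_cube_le r20 p1_gt1 mf f0) _.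
    by rewrite lte_mul_pinfty ?lee_fin ?powR_ge0.
  apply: (@le_trans _ _ (((2 * r) `^ e1)%:E * (Cl%:E *
      (((2 * (2 * r)) `^ e2)%:E * (((2 * r) `^ sg)%:E * M))))).
    apply: lee_wpmul2l; first by rewrite lee_fin powR_ge0.
    apply: (le_trans (HCl r fl r0 mfl fl0 flfin flE)).
    apply: lee_wpmul2l; first by rewrite lee_fin ltW.
    apply: (le_trans (@mixed_norm_embedding _ n p p1 (2 * r)%R fl r20 p0 pp1 mfl fl0 flE)).
    apply: lee_wpmul2l; first by rewrite lee_fin powR_ge0.
    exact: N2.
  rewrite !muleA -!EFinM; apply: lee_wpmul2r => //; rewrite lee_fin.
  rewrite [((2 * (2 * r)) `^ e2)%R]powRM ?(ltW r20)//.
  have -> : (Cl * 2 `^ e2 * 2 `^ S2 * r `^ S2 =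
      Cl * 2 `^ e2 * (2 * r) `^ S2)%R.
    by rewrite [((2 * r) `^ S2)%R]powRM ?(ltW r0)// mulrA.
  have -> : ((2 * r) `^ S2 = (2 * r) `^ e1 * (2 * r) `^ e2 * (2 * r) `^ sg)%R.
    rewrite -eE (@powRD _ (2 * r) (e1 + e2) sg) ?(gt_eqF r20) ?implybT//.
    by rewrite (@powRD _ (2 * r) e1 e2) ?(gt_eqF r20) ?implybT.
  by apply: le_of_eq; ring.
have bound_r : mixed_norm (fun i => (s i)%:E) Pr <=
    (2 `^ S2 * Cf * r `^ S2)%:E * M.
  have potr0 x : 0 <= potential alpha fr x by exact: potential_ge0.
  have CM0 : 0 <= Cf%:E * M by rewrite mule_ge0// lee_fin ltW.
  apply: (le_trans (@mixed_norm_cube_le _ n s r (potential alpha fr) (Cf%:E * M)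
    r0 s0 (measurable_potential alpha mfr fr0) potr0 _ CM0)).
    by move=> x xr; exact: far_potential_le (ltW alpha_lt) p1_gt1 mf f0 xr HM.
  rewrite muleA -EFinM -/S2 powRM ?(ltW r0)//; apply: lee_wpmul2r => //.
  by rewrite lee_fin; apply: le_of_eq; ring.
apply: (le_trans (HCa Pl Pr (mP fl mfl fl0) (mP fr mfr fr0) _ _)).
- by move=> x; exact: P0.
- by move=> x; exact: P0.
apply: (@le_trans _ _ (Ca%:E * ((Cl * 2 `^ e2 * 2 `^ S2 * r `^ S2)%:E * M +
   (2 `^ S2 * Cf * r `^ S2)%:E * M))).
  by apply: lee_wpmul2l; [rewrite lee_fin ltW|exact: leeD].
rewrite -ge0_muleDl ?lee_fin; last 2 first.
- by rewrite !mulr_ge0 ?(ltW Cl0) ?powR_ge0.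
- by rewrite !mulr_ge0 ?(ltW Cf0) ?powR_ge0.
rewrite /M !muleA -!EFinM; apply: lee_wpmul2r => //.
by rewrite lee_fin; apply: le_of_eq; ring.
Qed.

End cube_bound.

(** * The substitution in the outer norm *)

Section power_substitution.
Context {R : realType} (k : R) (k0 : 0 < k).
Local Open Scope ereal_scope.
Local Notation leb := (@lebesgue_measure R).
Local Notation D := (`]0%R, +oo[%classic : set (measurableTypeR R)).
Implicit Types (u x b : R).

Let phi (u : measurableTypeR R) : measurableTypeR R := (u `^ (- k))%R.

Let mphi : measurable_fun setT (phi : measurableTypeR R -> measurableTypeR R).
Proof. exact: measurable_powR. Qed.

Let mD : measurable D. Proof. exact: measurable_itv. Qed.

Let dens : measurableTypeR R -> \bar R :=
  (fun u => (k * u `^ (- k - 1))%:E) \_ D.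

Let dens_ge0 u : 0 <= dens u.
Proof.
rewrite /dens /patch; case: ifP => // _.
by rewrite lee_fin mulr_ge0 ?powR_ge0 ?(ltW k0).
Qed.

Let mweight : measurable_fun setT
  (fun u : measurableTypeR R => (k * u `^ (- k - 1))%:E : \bar R).
Proof.
by apply/measurable_EFinP; apply: measurable_funM => //; exact: measurable_powR.
Qed.

Let mdens : measurable_fun setT dens.
Proof.
by apply/(measurable_restrictT _ _).1 => //; exact: measurable_funTS.
Qed.

Definition power_image_measure (A : set (measurableTypeR R)) : \bar R :=
  \int[leb]_(u in phi @^-1` A) dens u.

Let pim0 : power_image_measure set0 = 0.
Proof. by rewrite /power_image_measure preimage_set0 integral_set0. Qed.

Let pim_ge0 A : 0 <= power_image_measure A.
Proof. by apply: integral_ge0 => u _; exact: dens_ge0. Qed.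

Let pim_sigma_additive : semi_sigma_additive power_image_measure.
Proof.
move=> F mF tF mUF; rewrite /power_image_measure preimage_bigcup.
apply: (semi_sigma_additive_nng_induced mdens dens_ge0).
- by move=> i; rewrite -[X in measurable X]setTI; exact: mphi.
- apply/trivIsetP => /= i j _ _ ij; rewrite -preimage_setI.
  by move/trivIsetP : tF => /(_ _ _ _ _ ij) ->//; rewrite preimage_set0.
- by rewrite -preimage_bigcup -[X in measurable X]setTI; exact: mphi.
Qed.

HB.instance Definition _ := isMeasure.Build _ _ _ power_image_measure
  pim0 pim_ge0 pim_sigma_additive.

Let cvg_powRN : (fun u : R => u `^ (- k))%R x @[x --> +oo%R] --> 0%R.
Proof.
apply/cvgr0Pnorm_lt => e e0; near=> x.
have ex : (e `^ (- k^-1) < x)%R by near: x; exact: nbhs_pinfty_gt.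
have x0 : (0 < x)%R by apply: lt_trans ex; exact: powR_gt0.
by rewrite ger0_norm ?powR_ge0// -(powR_opp_lt k0 x0 e0).
Unshelve. all: by end_near. Qed.

Let tail_mass a : (0 < a)%R ->
  \int[leb]_(u in `]a, +oo[) (k * u `^ (- k - 1))%:E = (a `^ (- k))%:E.
Proof.
move=> a0.
have D1 x : (a <= x)%R -> is_derive x 1%R (fun u => - u `^ (- k))%R (k * x `^ (- k - 1))%R.
  move=> ax; have x0 : (0 < x)%R by exact: lt_le_trans ax.
  rewrite (_ : (k * _)%R = - (- k * x `^ (- k - 1)))%R; last by ring.
  by apply: is_deriveN; exact: is_derive1_powR.
rewrite integral_itv_obnd_cbnd; last exact: measurable_funTS mweight.
rewrite (@ge0_continuous_FTC2y _ _ (fun u => - u `^ (- k))%R _ 0%R).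
- by rewrite sub0e EFinN oppeK.
- by move=> x _; rewrite mulr_ge0 ?powR_ge0 ?(ltW k0).
- apply: continuous_in_subspaceT => x; rewrite inE/= in_itv/= andbT => ax.
  have x0 : (0 < x)%R by exact: lt_le_trans ax.
  apply: cvgM; first exact: cvg_cst.
  have : derivable (fun u : R => u `^ (- k - 1))%R x 1%R.
    by apply: derivable_powR; rewrite in_itv/= x0.
  by move=> /derivable1_diffP/differentiable_continuous; apply.
- by rewrite -oppr0; apply: cvgN; exact: cvg_powRN.
- by move=> x ax; have [] := D1 x (ltW ax).
- apply: cvg_at_right_filter; have [+ _] := D1 a (lexx a).
  by move=> /derivable1_diffP/differentiable_continuous; apply.
- move=> x; rewrite in_itv/= andbT => ax; rewrite derive1E.
  by have H := D1 x (ltW ax); rewrite derive_val.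
Qed.

(** The rays ]-oo, b[ form a pi-system that generates the Borel sets. For b > 0 such a ray pulls
    back, within ]0, +oo[, to ]b^(-1/k), +oo[, whose mass is b by [tail_mass]; for b <= 0 both sides
    vanish. *)
Lemma power_image_measureE A : measurable A ->
  leb (A `&` D) = power_image_measure A.
Proof.
move=> mA; rewrite -[LHS]/(mrestr leb mD A).
have rayE b : `]-oo, b[%classic `&` D = `]0%R, b[%classic.
  apply/seteqP; split => x /=; rewrite !in_itv/= ?andbT; first by move=> [-> ->].
  by move=> /andP[-> ->].
apply: (@measure_unique _ R (measurableTypeR R) (@RGenInftyO.G R)
  (fun n => `]-oo, n%:R[%classic) _ _ _ _ (mrestr leb mD) power_image_measure) => //.
- exact: RGenInftyO.measurableE.
- move=> _ _ [x ->] [y ->]; exists (Num.min x y); apply/seteqP; split => z /=.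
    by rewrite !in_itv/= lt_min => -[-> ->].
  by rewrite !in_itv/= lt_min => /andP[].
- by move=> i; exists i%:R.
- apply/seteqP; split => // x _; exists (Num.bound `|x|) => //=.
  by rewrite in_itv/=; exact: le_lt_trans (ler_norm x) (archi_boundP (normr_ge0 x)).
- move=> _ [b ->].
  change (leb (`]-oo, b[%classic `&` D) = \int[leb]_(u in phi @^-1` `]-oo, b[%classic) dens u).
  rewrite rayE lebesgue_measure_itv/= lte_fin.
  have [b0|b0] := ltP 0%R b; last first.
    rewrite integral0_eq// => u /=; rewrite in_itv/= => ub.
    rewrite /dens /patch; case: ifPn => //; rewrite inE/= in_itv/= andbT => u0.
    by move: (powR_gt0 (- k) u0); rewrite ltNge (le_trans (ltW ub) b0).
  rewrite sube0 -[in LHS](powR_oppKV k0 b0) -tail_mass ?powR_gt0//.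
  have a0 : (0 < b `^ (- k^-1))%R by exact: powR_gt0.
  rewrite [LHS]integral_mkcond [RHS]integral_mkcond; apply: eq_integral => u _.
  rewrite /dens /patch; have [u0|u0] := ltP 0%R u; last first.
    have nD : (u \in D) = false.
      by apply: memNset; rewrite /= in_itv/= andbT; apply/negP; rewrite -leNgt.
    have na : (u \in `](b `^ (- k^-1))%R, +oo[%classic) = false.
      apply: memNset; rewrite /= in_itv/= andbT; apply/negP; rewrite -leNgt.
      exact: le_trans u0 (ltW a0).
    by rewrite nD na if_same.
  rewrite [X in if _ then (if X then _ else _) else _]mem_set/= ?in_itv/= ?u0//.
  congr (if _ then _ else _); apply/idP/idP; rewrite !inE/= !in_itv/= ?andbT.
    by rewrite (powR_opp_lt k0 u0 b0).
  by move=> ub; rewrite (powR_opp_lt k0 u0 b0).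
- move=> n; change (leb (`]-oo, n%:R[%classic `&` D) < +oo).
  by rewrite rayE lebesgue_measure_itv/=; case: ifP => _; rewrite ?ltry.
Qed.

Import HBNNSimple.

(* An inequality, so that [G] need not be measurable: the left-hand side is the
   supremum of the integrals of the simple functions below [G]. *)
Lemma power_substitution_le (G : R -> \bar R) : (forall x, 0 <= G x) ->
  \int[leb]_x (G \_ D) x <=
  \int[leb]_u ((fun u => (k * u `^ (- k - 1))%:E * G (u `^ (- k))%R) \_ D) u.
Proof.
move=> G0; apply: integral_lower_le => [x|h hG].
  by rewrite /patch; case: ifP.
pose hf : measurableTypeR R -> R := h.
have hf0 x : (0 <= hf x)%R by exact: fun_ge0.
(* As [h] lies below [G] cut off to ]0, +oo[, its level sets at nonzero heights are contained in ]0,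
   +oo[, where the two measures agree. *)
have hD (y : R) : y != 0%R -> hf @^-1` [set y] `&` D = hf @^-1` [set y].
  move=> y0; apply/seteqP; split => [x []//|x /= hx]; split => //=.
  have := hG x; rewrite /patch; case: ifPn => [|_]; first by rewrite inE.
  rewrite -/(hf x) hx lee_fin => y1; have y2 := hf0 x; rewrite hx in y2.
  by exfalso; move/eqP: y0; apply; apply/eqP; rewrite eq_le y1.
have mh (y : R) : measurable (hf @^-1` [set y]) by exact: measurable_sfunP.
have mpre (y : R) : measurable (phi @^-1` (hf @^-1` [set y])).
  by rewrite -[X in measurable X]setTI; exact: mphi.
pose f (y : R) (u : measurableTypeR R) := `|y|%:E * (dens \_ (phi @^-1` (hf @^-1` [set y]))) u.
have f0 y u : 0 <= f y u.
  by rewrite mule_ge0 ?lee_fin// /patch; case: ifP => // _; exact: dens_ge0.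
have mf y : measurable_fun setT (f y).
  have H : measurable_fun setT (dens \_ (phi @^-1` (hf @^-1` [set y]))).
    have [+ _] := measurable_restrictT dens (mpre y); apply.
    exact: (measurable_funTS mdens).
  exact: measurable_funeM.
rewrite integralT_nnsfun sintegralE.
have -> : \sum_(y \in range hf) y%:E * leb (hf @^-1` [set y]) =
    \int[leb]_u \sum_(y \in range hf) f y u.
  rewrite ge0_integral_fsum//.
  apply: eq_fsbigr => y /set_mem[x _ yx].
  have y0 : (0 <= y)%R by rewrite -yx.
  rewrite /f ger0_norm//; have [->|yn0] := eqVneq y 0%R.
    by rewrite mul0e integral0_eq// => u _; rewrite mul0e.
  rewrite lower_integral_scale ?lt_neqAle 1?eq_sym ?yn0//; last first.
    by move=> u; rewrite /patch; case: ifP => // _; exact: dens_ge0.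
  congr (_ * _); rewrite -[in LHS](hD y yn0) (power_image_measureE (mh y)).
  exact: integral_mkcond.
apply: le_lower_integral => u; first by rewrite fsume_ge0.
rewrite (fsbigD1 (hf (phi u)))//=; last by exists (phi u).
rewrite fsbig1 ?adde0; last first.
  move=> y [_ /= yh]; rewrite /f /patch memNset ?mule0//= => hy.
  by apply: yh; rewrite hy.
rewrite /f /patch mem_set// ger0_norm// /dens /patch.
case: ifPn => [uD|_]; last by rewrite mule0.
rewrite muleC; apply: lee_wpmul2l; first by rewrite lee_fin mulr_ge0 ?powR_ge0 ?(ltW k0).
have := hG (phi u); rewrite /patch mem_set//= in_itv/= andbT powR_gt0//.
by move: uD; rewrite inE/= in_itv/= andbT.
Qed.

End power_substitution.

Section Lnorm_substitution.
Context {R : realType}.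
Local Open Scope ereal_scope.
Local Notation leb := (@lebesgue_measure R).
Local Notation D := (`]0%R, +oo[%classic : set (measurableTypeR R)).

Lemma patch_abse (W : R -> \bar R) x : (forall x, 0 <= W x) ->
  `|(W \_ D) x| = (W \_ D) x.
Proof. by move=> W0; rewrite gee0_abs// /patch; case: ifP. Qed.

(** The Jacobian k u^(-k-1) enters the norm with the power 1/theta: k^(1/theta) becomes the constant
    and the rest the weight. For theta = +oo the weight is 1, [recip] being 0, and the point is that
    null sets correspond. *)
Lemma Lnorm_on_substitution (theta : \bar R) (k : R) : 0 < theta -> (0 < k)%R ->
  exists2 C : R, (0 < C)%R & forall W : R -> \bar R, (forall x, 0 <= W x) ->
    Lnorm_on theta D W <=
    C%:E * Lnorm_on theta D
      (fun u => (u `^ (- (recip theta * (k + 1))))%:E * W (u `^ (- k))%R).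
Proof.
move=> + k0; case: theta => [r| |]; last by rewrite ltNge leNye.
  rewrite lte_fin => r0; have rn0 : r != 0%R by rewrite gt_eqF.
  exists (k `^ r^-1)%R => [|W W0]; first exact: powR_gt0.
  rewrite recipE//; set V := fun u : R => _.
  have V0 u : 0 <= V u by rewrite mule_ge0// lee_fin powR_ge0.
  have pD (U : R -> \bar R) : (forall x, 0 <= U x) -> forall x, 0 <= (U \_ D) x.
    by move=> U0 x; rewrite /patch; case: ifP.
  rewrite /Lnorm_on !Lnorm_fin//; [|exact: pD|exact: pD].
  have I0 : 0 <= \int[leb]_x ((V \_ D) x `^ r).
    by apply: integral_ge0 => x _; exact: poweR_ge0.
  rewrite -poweR_EFin -poweRM//; last by rewrite lee_fin ltW.
  apply: le_poweR; first by rewrite invr_ge0 ltW.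
    by apply: integral_ge0 => x _; exact: poweR_ge0.
  rewrite -lower_integral_scale//; last by move=> x; exact: poweR_ge0.
  have patchM (U : R -> \bar R) x : (U \_ D) x `^ r = ((fun y => U y `^ r) \_ D) x.
    by rewrite /patch; case: ifP => // _; rewrite poweR0r.
  under eq_integral do rewrite patchM.
  have Wr0 x : 0 <= W x `^ r by exact: poweR_ge0.
  apply: (le_trans (power_substitution_le k0 Wr0)).
  apply: le_of_eq; apply: eq_integral => u _.
  rewrite patchM /patch; case: ifPn => [uD|_]; last by rewrite mule0.
  have u0 : (0 < u)%R by move: uD; rewrite inE/= in_itv/= andbT.
  rewrite /V poweRM ?lee_fin ?powR_ge0// poweR_EFin -powRrM muleA -EFinM.
  congr ((_ * _ `^ _)%R%:E * _); rewrite -opprD mulNr; congr (- _)%R.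
  by rewrite mulrAC mulVf// mul1r.
move=> _; exists 1%R => // W W0; rewrite mul1e recip_pinfty mul0r oppr0.
rewrite [X in _ <= Lnorm_on _ _ X](_ : _ = fun u => W (u `^ (- k))%R); last first.
  by apply/funext => u; rewrite powRr0 mul1e.
set V := fun u : R => W _.
have M0 := @Lnorm_ge0 _ _ R leb +oo (V \_ D).
rewrite /Lnorm_on; move: M0; set M := Lnorm _ _ (V \_ D) => M0.
rewrite unlock; case: ifPn => // muT; apply/ess_supP.
have HM : {ae leb, forall u, `|(V \_ D) u| <= M}.
  by rewrite /M unlock muT; exact: ess_sup_ge.
have [N [mN N0 HN]] := HM.
pose psi (x : measurableTypeR R) : measurableTypeR R := (x `^ (- k^-1))%R.
have mpsi : measurable_fun setT psi by exact: measurable_powR.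
pose B : set (measurableTypeR R) := psi @^-1` N `&` D.
have mB : measurable B.
  by apply: measurableI => //; rewrite -[X in measurable X]setTI; exact: mpsi.
(* [B] corresponds to the null set [N] under the substitution: the substitution inequality for its
   indicator has a right-hand integrand that vanishes off [N]. *)
have B0 : leb B = 0.
  apply/eqP; rewrite eq_le measure_ge0 andbT.
  have -> : leb B = \int[leb]_x (\1_B x)%:E by rewrite integral_indic// setIT.
  rewrite [X in X <= _](_ : _ = \int[leb]_x ((EFin \o (\1_B : _ -> R)) \_ D) x); last first.
    apply: eq_integral => x _; rewrite /patch; case: ifPn => // /negP xD /=.
    by rewrite indicE memNset// => -[_ /mem_set].
  apply: (le_trans (power_substitution_le k0 _)).
    by move=> x; rewrite lee_fin.
  rewrite -[leRHS](integral0 leb setT); apply: le_lower_integral_ae => //.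
    move=> u; rewrite /patch; case: ifP => // _.
    by rewrite mule_ge0 ?lee_fin ?mulr_ge0 ?powR_ge0 ?(ltW k0).
  exists N; split => // u /=; apply: contra_notP => Nu.
  rewrite /patch; case: ifPn => // uD.
  have u0 : (0 < u)%R by move: uD; rewrite inE/= in_itv/= andbT.
  by rewrite /= indicE memNset ?mule0// => -[+ _]; rewrite /= /psi powR_oppVK.
exists B; split => // x /= /negP; rewrite -ltNge patch_abse// => Mx.
have xD : D x.
  by apply: contrapT => xD; move: Mx; rewrite /patch memNset// ltNge M0.
split => //=; apply: HN => /=; apply/negP; rewrite -ltNge.
have x0 : (0 < x)%R by move: xD; rewrite /= in_itv/= andbT.
rewrite patch_abse; last by move=> u; exact: W0.
move: Mx; rewrite /patch !mem_set//=; last by rewrite in_itv/= andbT powR_gt0.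
by rewrite /V /psi powR_oppKV.
Qed.

End Lnorm_substitution.

(** The integral is the difference of the lower integrals of the positive and negative parts, each
    at most the integral of [g]. Should both be infinite, the value -oo has absolute value +oo, and
    the integral of [g] is infinite as well. *)
Lemma abse_integral_le_ae d (T : measurableType d) (R : realType)
    (mu : {measure set T -> \bar R}) (f g : T -> \bar R) :
  (forall x, (0 <= g x)%E) -> (\forall x \ae mu, (`|f x| <= g x)%E) ->
  (`|\int[mu]_x f x| <= \int[mu]_x g x)%E.
Proof.
move=> g0 fg; rewrite integralE.
have le h : (forall x, 0 <= h x)%E -> (forall x, (h x <= `|f x|)%E) ->
    (0 <= \int[mu]_x h x <= \int[mu]_x g x)%E.
  move=> h0 hf; rewrite integral_ge0//=; apply: le_lower_integral_ae => //.
  by apply: filterS fg => x; exact: le_trans.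
have pos_le x : (f^\+ x <= `|f x|)%E by rewrite funeposE ge_max lee_abs abse_ge0.
have neg_le x : (f^\- x <= `|f x|)%E by rewrite funenegE ge_max -abseN lee_abs abse_ge0.
have /andP[p0 pg] := le _ (funepos_ge0 f) pos_le.
have /andP[m0 mg] := le _ (funeneg_ge0 f) neg_le.
move: (\int[mu]_x f^\+ x)%E (\int[mu]_x f^\- x)%E (\int[mu]_x g x)%E p0 pg m0 mg.
case=> [a| |] [b| |] [c| |]; rewrite ?lee_fin ?leey ?leye_eq//= => a0 ac b0 bc.
by rewrite ler_norml; apply/andP; split; lra.
Qed.

Section riesz_potential.
Context {R : realType} (n : nat) (alpha : R).
Local Open Scope ereal_scope.

Lemma riesz_potential_le (f : euclidean R n -> R) (F : euclidean R n -> \bar R) x :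
  (forall y, 0 <= F y) -> (\forall y \ae lebesgue R n, `|f y|%:E = F y) ->
  `|riesz_potential alpha f x| <= potential alpha F x.
Proof.
move=> F0 fF; apply: abse_integral_le_ae => [y|].
  by rewrite mule_ge0// lee_fin riesz_kernel_ge0.
apply: filterS fF => y <-; rewrite -EFinM abse_EFin lee_fin normrM.
by rewrite [X in (_ * X)%R]ger0_norm ?riesz_kernel_ge0.
Qed.

End riesz_potential.

(** When p1 <= p2 every difference of reciprocals is its own positive part, so (a) is either the
    strict case or the endpoint; in (b) all positive parts are 0, which is below alpha. *)
Lemma case_exponents (R : realType) n (alpha : R) (p1 p2 : 'I_n -> \bar R) :
  0 < alpha ->
  [/\ forall i, [/\ (1 < p1 i)%E, (p1 i <= p2 i)%E & (p2 i < +oo)%E],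
      p1 <> p2 &
      \sum_(i < n) recip (p1 i) - \sum_(i < n) recip (p2 i) <= alpha] \/
  (forall i, [/\ (0 < p2 i)%E, (p2 i < p1 i)%E & (1 < p1 i)%E]) \/
  ((forall i, [/\ (0 < p2 i)%E, (p2 i < +oo)%E, (1 < p1 i)%E &
                  (p1 i < +oo)%E]) /\
   \sum_(i < n) Num.max (recip (p1 i) - recip (p2 i)) 0 < alpha) ->
  (forall i, [/\ (1 < p1 i)%E, (0 < p2 i)%E & (p2 i < +oo)%E]) /\
  (((forall i, (p1 i <= p2 i)%E) /\
    \sum_i recip (p1 i) - \sum_i recip (p2 i) = alpha) \/
  \sum_i Num.max (recip (p1 i) - recip (p2 i)) 0 < alpha).
Proof.
move=> alpha0 [[hp _ gain_le]|[hp|[hp gain_lt]]].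
- have p12 i : (p1 i <= p2 i)%E by have [] := hp i.
  have p1_gt0 i : (0 < p1 i)%E by have [+ _ _] := hp i; exact: lt_trans.
  split=> [i|]; first by have [p1i _ p2i] := hp i; split => //; exact: lt_le_trans (p12 i).
  move: gain_le; rewrite le_eqVlt => /predU1P[gainE|gain_lt]; [by left|right].
  rewrite (eq_bigr (fun i => recip (p1 i) - recip (p2 i))) ?sumrB// => i _.
  by rewrite max_l// subr_ge0 le_recip.
- split=> [i|].
    by have [p20 p21 p1i] := hp i; split => //; apply: lt_le_trans p21 _; exact: leey.
  right; rewrite big1// => i _; have [p20 p21 _] := hp i.
  by rewrite max_r// subr_le0 le_recip// ltW.
by split=> [i|]; [have [] := hp i|right].
Qed.

Theorem theorem5p1 (R : realType) (n : nat) (alpha : R)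
    (p1 p2 : 'I_n -> \bar R) (theta2 : \bar R) (omega2 : R -> R)
    (halpha : 0 < alpha < n%:R)
    (hp :
      (* (a) *)
      [/\ forall i, [/\ (1 < p1 i)%E, (p1 i <= p2 i)%E & (p2 i < +oo)%E],
          p1 <> p2 &
          \sum_(i < n) recip (p1 i) - \sum_(i < n) recip (p2 i) <= alpha] \/
      (* (b) *)
      (forall i, [/\ (0 < p2 i)%E, (p2 i < p1 i)%E & (1 < p1 i)%E]) \/
      (* (c) *)
      ((forall i, [/\ (0 < p2 i)%E, (p2 i < +oo)%E, (1 < p1 i)%E &
                      (p1 i < +oo)%E]) /\
       \sum_(i < n) Num.max (recip (p1 i) - recip (p2 i)) 0 < alpha))
    (hsigma : 0 < sigma alpha p1)
    (htheta2 : (0 < theta2)%E)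
    (homega2 : Omega theta2 omega2) :
  exists2 C : R, 0 < C &
    forall f : euclidean R n -> R, L1loc f ->
      (LM_norm p2 theta2 omega2 (riesz_potential alpha f)
         <= C%:E * weighted_norm theta2 (nu_fun alpha p1 p2 theta2 omega2)
                     (hardy (g_fun alpha p1 f)))%E.
Proof.
have /andP[alpha0 alpha_lt] := halpha.
have [homega _ _ _] := homega2.
have [hp12 hgain] := case_exponents alpha0 hp.
have p10 i : (0 < p1 i)%E by have [+ _ _] := hp12 i; exact: lt_trans.
have p20 i : (0 < p2 i)%E by have [] := hp12 i.
have [p [q [p_gt1 pq pp1 p2q gainE]]] := hls_exponents alpha_lt hp12 hgain.
have [C C0 HC] := potential_cube_bound halpha hsigma hp12 p_gt1 pq pp1 p2q gainE.
set sg := sigma alpha p1 in hsigma HC *.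
set S2 := \sum_i recip (p2 i) in HC.
have isg0 : 0 < sg^-1 by rewrite invr_gt0.
have [C' C'0 HC'] := Lnorm_on_substitution htheta2 isg0.
exists (C * C') => [|f [[g mg [N [mN N0 fgN]]] _]]; first exact: mulr_gt0.
have fg : \forall y \ae lebesgue R n, `|f y|%:E = `|g y|%:E.
  exists N; split => // y /= fgy; apply: fgN => /= H; apply: fgy.
  by rewrite H.
(* The estimates are run for the absolute value of the Borel representative [g]; the null set is
   crossed twice, at the potential and at [g_fun]. *)
pose F (y : euclidean R n) : \bar R := `|g y|%:E.
have F0 y : (0 <= F y)%E by rewrite lee_fin.
have mF : measurable_fun setT F.
  by apply/measurable_EFinP; exact: measurableT_comp.
have gF t : (mixed_norm_on p1 (cube (origin R n) (t `^ (- sg^-1))) F <=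
    g_fun alpha p1 f t)%E.
  apply: le_mixed_norm_ae => //; apply: filterS fg => y fgy.
  by rewrite /patch; case: ifP => // _; rewrite /F -fgy /= normr_id.
pose H := hardy (g_fun alpha p1 f).
have H0 t : (0 <= H t)%E by apply: integral_ge0 => u _; exact: mixed_norm_ge0.
have cube_bound (r : R) : 0 < r ->
    (mixed_norm_on p2 (cube (origin R n) r) (riesz_potential alpha f) <=
     (C * r `^ S2)%:E * H (r `^ (- sg))%R)%E.
  move=> r0; apply: (@le_trans _ _
    (mixed_norm_on p2 (cube (origin R n) r) (potential alpha F))).
    apply: le_mixed_norm => // x; rewrite /patch; case: ifP => // _.
    rewrite [leRHS]gee0_abs; last exact: potential_ge0.
    exact: riesz_potential_le.
  apply: (le_trans (HC r F r0 mF F0)); apply: lee_wpmul2l.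
    by rewrite lee_fin mulr_ge0 ?powR_ge0 ?(ltW C0).
  rewrite /H /hardy [leLHS]integral_mkcond [leRHS]integral_mkcond.
  apply: le_lower_integral => t; rewrite /patch; case: ifP => // _.
  exact: mixed_norm_ge0.
(* The sign of [omega2] is known on ]0, +oo[ only; the absolute value makes [W] nonnegative
   everywhere, as the substitution asks. *)
pose W (r : R) := ((`|omega2 r| * r `^ S2)%:E * H (r `^ (- sg))%R)%E.
have W0 r : (0 <= W r)%E by rewrite mule_ge0// lee_fin mulr_ge0 ?powR_ge0.
have pos (r : R) : r \in `]0, +oo[%classic -> 0 < r.
  by rewrite inE/= in_itv/= andbT.
apply: (@le_trans _ _ (C%:E * Lnorm_on theta2 `]0%R, +oo[ W)%E).
  rewrite /LM_norm /weighted_norm /Lnorm_on -Lnorm_scale//.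
  apply: le_Lnorm => // r; rewrite /patch; case: ifPn => [/pos r0|_]; last first.
    by rewrite mule0.
  rewrite !gee0_abs; last 2 first.
  - by rewrite mule_ge0// lee_fin ltW.
  - by rewrite mule_ge0 ?mixed_norm_ge0// lee_fin homega.
  apply: (@le_trans _ _ ((omega2 r)%:E * ((C * r `^ S2)%:E * H (r `^ (- sg))%R))%E).
    by apply: lee_wpmul2l; [rewrite lee_fin homega|exact: cube_bound].
  rewrite /W ger0_norm ?homega// !muleA -!EFinM.
  by apply: le_of_eq; congr (_%:E * _)%E; ring.
rewrite EFinM -muleA; apply: lee_wpmul2l; first by rewrite lee_fin ltW.
apply: (le_trans (HC' W W0)).
apply: lee_wpmul2l; first by rewrite lee_fin ltW.
apply: le_Lnorm => // u; rewrite /patch; case: ifPn => [/pos u0|_] //.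
have v0 : 0 < u `^ (- sg^-1) by exact: powR_gt0.
apply: le_of_eq; congr (`| _ |)%E.
(* With r = u^(-1/sigma), the factor r^(sum 1/p2_i) and the weight u^(-(1/theta2) (1/sigma + 1)) of
   the substitution multiply to the power of u in [nu_fun]. *)
rewrite /W powR_oppKV// muleA -EFinM; congr (_%:E * _)%E.
rewrite /nu_fun -/sg -/S2 ger0_norm ?homega// -powRrM mulrCA; congr (_ * _).
rewrite -powRD; last by rewrite (gt_eqF u0) implybT.
by congr (_ `^ _); ring.
Qed.
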